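(* Let $\Lambda$ and $\Gamma$ be two finite dimensional algebras which are related by a 1-APR tilt. Then their posets of functorially finite torsion classes $\mathrm{ff\text{-}tors}\,\Lambda$ and $\mathrm{ff\text{-}tors}\,\Gamma$ are related by a flip-flop.
   Context: Fix a field $k$. All algebras are basic and finite dimensional over $k$; $\mathrm{mod}\,\Lambda$ is the category of finitely generated right $\Lambda$-modules. A subcategory always means a full subcategory closed under isomorphisms, finite direct sums and direct summands. Torsion classes: a torsion pair in $\mathrm{mod}\,\Lambda$ is a pair $(\mathcal T,\mathcal F)$ of subcategories with $\mathrm{Hom}_\Lambda(\mathcal T,\mathcal F)=0$ such that every $X\in\mathrm{mod}\,\Lambda$ fits in a short exact sequence $0\to tX\to X\to fX\to 0$ with $tX\in\mathcal T$, $fX\in\mathcal F$; then $\mathcal T$ is called a torsion class. A subcategory $\mathcal X$ of $\mathrm{mod}\,\Lambda$ is functorially finite if every module $M$ admits a left $\mathcal X$-approximation (a morphism $M\to X$, $X\in\mathcal X$, through which every morphism from $M$ to an object of $\mathcal X$ factors) and, dually, a right $\mathcal X$-approximation. $\mathrm{ff\text{-}tors}\,\Lambda$ is the set of functorially finite torsion classes of $\mathrm{mod}\,\Lambda$, partially ordered by inclusion. 1-APR tilt: let $P$ be a simple projective $\Lambda$-module of injective dimension exactly $1$, and write $\Lambda=P\oplus R$ as $\Lambda$-modules. The module $T=\tau^{-1}P\oplus R$ (with $\tau^{-1}$ the inverse Auslander--Reiten translation of $\mathrm{mod}\,\Lambda$) is called a 1-APR tilting module, and $\Gamma=\mathrm{End}_\Lambda(T)$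 is called a 1-APR tilt of $\Lambda$. Two algebras $\Lambda,\Gamma$ are related by a 1-APR tilt if $\Gamma\simeq\mathrm{End}_\Lambda(T)$ for such a $P$ and $T$. Flip-flop: let $(X,\leq_X)$, $(Y,\leq_Y)$ be posets and $f:X\to Y$ an order-preserving map. Define two partial orders $\leq^f_+$ and $\leq^f_-$ on $X\sqcup Y$: both restrict to $\leq_X$ on $X$ and to $\leq_Y$ on $Y$; for $x\in X$, $y\in Y$, $x\leq^f_+y\iff f(x)\leq_Y y$, and $y\leq^f_-x\iff y\leq_Y f(x)$; there are no other relations. Two posets $Z,Z'$ are related by a flip-flop if there exist $X,Y,f$ such that one of them is isomorphic to $(X\sqcup Y,\leq^f_+)$ and the other to $(X\sqcup Y,\leq^f_-)$. *)

(* Defs.v *)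
From HB Require Import structures.
From mathcomp Require Import all_boot all_algebra all_field.
From mathcomp Require Import boolp.

Set Implicit Arguments.
Unset Strict Implicit.
Unset Printing Implicit Defensive.

Import GRing.Theory.
Local Open Scope ring_scope.

(* The converse A^c of a finite dimensional algebra A has the same underlying *)
(* vector space, and the product a * b of A^c is b * a computed in A; right   *)
(* A^c-modules are left A-modules.                                            *)
Section ConverseFalgebra.
Variables (k : fieldType) (A : falgType k).

HB.instance Definition _ := Vector.copy A^c A.

Fact converse_scalerAl (c : k) (a b : A^c) : c *: (a * b) = (c *: a : A^c) * b.
Proof. exact: (@scalerAr k A c b a). Qed.
HB.instance Definition _ :=
  GRing.LSemiModule_isLSemiAlgebra.Build k A^c converse_scalerAl.

Fact converse_scalerAr (c : k) (a b : A^c) : c *: (a * b) = a * (c *: b : A^c).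
Proof. exact: (@scalerAl k A c b a). Qed.
HB.instance Definition _ :=
  GRing.Lalgebra_isAlgebra.Build k A^c converse_scalerAr.

End ConverseFalgebra.

(* Finitely generated right modules over a finite dimensional algebra are the *)
(* finite dimensional ones.                                                   *)
Record rmod (k : fieldType) (A : falgType k) := RMod {
  rmod_sort :> vectType k;
  ract : rmod_sort -> A -> rmod_sort;
  ract_linearl : forall a, linear (ract^~ a);
  ract_linearr : forall x, linear (ract x);
  ract1 : forall x, ract x 1 = x;
  ractM : forall x a b, ract x (a * b) = ract (ract x a) b }.

Section Modules.
Variables (k : fieldType) (A : falgType k).

Definition ractl (M : rmod A) (a : A) (x : M) : M := ract x a.
HB.instance Definition _ (M : rmod A) (a : A) :=
  GRing.isLinear.Build k M M *:%R (@ractl M a) (ract_linearl a).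
HB.instance Definition _ (M : rmod A) (x : M) :=
  GRing.isLinear.Build k A M *:%R (ract x) (ract_linearr x).

Implicit Types M N X Y Z P I : rmod A.

Definition is_hom M N (f : 'Hom(M, N)) : Prop :=
  forall x a, f (ract x a) = ract (f x) a.

Definition hom_defect M N (a : A) (f : 'Hom(M, N)) : 'Hom(M, N) :=
  (f \o linfun (@ractl M a))%VF - (linfun (@ractl N a) \o f)%VF.

Lemma hom_defectE M N a (f : 'Hom(M, N)) x :
  hom_defect a f x = f (ract x a) - ract (f x) a.
Proof. by rewrite add_lfunE opp_lfunE !comp_lfunE !lfunE. Qed.

Fact hom_defect_linear M N a : linear (@hom_defect M N a).
Proof.
move=> c f g; apply/lfunP => x; rewrite [RHS]add_lfunE scale_lfunE !hom_defectE.
rewrite !add_lfunE !scale_lfunE.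
have -> u v : @ract k A N (c *: u + v) a = c *: ract u a + ract v a.
  exact: ract_linearl.
rewrite scalerBr opprD !addrA; congr (_ - _).
by rewrite addrAC.
Qed.
HB.instance Definition _ M N a :=
  GRing.isLinear.Build k 'Hom(M, N) 'Hom(M, N) *:%R (@hom_defect M N a)
    (@hom_defect_linear M N a).

(* Hom_A(M, N) as a k-subspace of Hom_k(M, N)                                 *)
Definition homs M N : {vspace 'Hom(M, N)} :=
  (\bigcap_(i < \dim {:A}) lker (linfun (@hom_defect M N (vbasis {:A})`_i)))%VS.

Lemma homsP M N (f : 'Hom(M, N)) : f \in homs M N <-> is_hom f.
Proof.
split=> [|fP].
  rewrite memvE => /subv_bigcapP fP x a.
  have -> := coord_vbasis (memvf a).
  rewrite !linear_sum; apply: eq_bigr => i _; rewrite !linearZ; congr (_ *: _).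
  have := fP i isT; rewrite -memvE memv_ker lfunE /= => /eqP/lfunP/(_ x).
  by rewrite hom_defectE zero_lfunE => /eqP; rewrite subr_eq0 => /eqP.
rewrite memvE; apply/subv_bigcapP => i _.
rewrite -memvE memv_ker lfunE /=; apply/eqP/lfunP => x.
by rewrite hom_defectE fP subrr zero_lfunE.
Qed.

Definition regular_mod : rmod A.
Proof.
apply: (@RMod k A A (fun x a => x * a)).
- by move=> a c x y; rewrite mulrDl scalerAl.
- by move=> x c a b; rewrite mulrDr scalerAr.
- exact: mulr1.
- exact: mulrA.
Defined.

Definition zero_mod : rmod A.
Proof.
apply: (@RMod k A 'rV[k]_0 (fun x _ => x)) => [a c x y|x c a b|x|x a b] //.
by rewrite [LHS]thinmx0 [RHS]thinmx0.
Defined.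

Definition sum_mod M N : rmod A.
Proof.
apply: (@RMod k A (M * N)%type (fun x a => (ract x.1 a, ract x.2 a))).
- by move=> a c x y; congr pair; apply: ract_linearl.
- by move=> x c a b; congr pair; apply: ract_linearr.
- by case=> x y; rewrite !ract1.
- by move=> x a b; rewrite !ractM.
Defined.

Definition mod_iso M N : Prop :=
  exists f : 'Hom(M, N), [/\ is_hom f, lker f = 0%VS & limg f = fullv].

Definition short_exact X Y Z (f : 'Hom(X, Y)) (g : 'Hom(Y, Z)) : Prop :=
  [/\ is_hom f, is_hom g, lker f = 0%VS, limg f = lker g & limg g = fullv].

Definition is_zero M : Prop := \dim {:M} = 0%N.

Definition is_submodule M (U : {vspace M}) : Prop :=
  forall x a, x \in U -> ract x a \in U.

Definition is_simple M : Prop :=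
  ~ is_zero M /\
  forall U : {vspace M}, is_submodule U -> U = 0%VS \/ U = fullv.

Definition is_indecomposable M : Prop :=
  ~ is_zero M /\
  forall X Y, mod_iso M (sum_mod X Y) -> is_zero X \/ is_zero Y.

Definition is_projective P : Prop :=
  forall X Y (g : 'Hom(X, Y)) (f : 'Hom(P, Y)),
    is_hom g -> limg g = fullv -> is_hom f ->
  exists h : 'Hom(P, X), is_hom h /\ f = (g \o h)%VF.

Definition is_injective I : Prop :=
  forall X Y (g : 'Hom(X, Y)) (f : 'Hom(X, I)),
    is_hom g -> lker g = 0%VS -> is_hom f ->
  exists h : 'Hom(Y, I), is_hom h /\ f = (h \o g)%VF.

(* inj_dim_le n M: there is an injective resolution                           *)
(* 0 -> M -> I^0 -> I^1 -> ... -> I^n -> 0.                                   *)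
Fixpoint inj_dim_le (n : nat) M : Prop :=
  if n is n'.+1 then
    exists (I C : rmod A) (f : 'Hom(M, I)) (g : 'Hom(I, C)),
      [/\ is_injective I, short_exact f g & inj_dim_le n' C]
  else is_injective M.

Definition inj_dim_eq1 M : Prop := inj_dim_le 1 M /\ ~ inj_dim_le 0 M.

Definition is_basic : Prop :=
  exists (n : nat) (P : 'I_n -> rmod A),
    [/\ forall i, is_indecomposable (P i),
        forall i j, mod_iso (P i) (P j) -> i = j
      & mod_iso regular_mod (\big[sum_mod/zero_mod]_(i < n) P i)].

(* U is a superfluous submodule of M.                                         *)
Definition superfluous M (U : {vspace M}) : Prop :=
  forall V : {vspace M}, is_submodule V -> (U + V)%VS = fullv -> V = fullv.

(* P1 -p1-> P0 -p0-> M -> 0 is a minimal projective presentation: p0 is a     *)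
(* projective cover of M and p1 a projective cover of the kernel of p0.       *)
Definition min_proj_presentation M P1 P0
    (p1 : 'Hom(P1, P0)) (p0 : 'Hom(P0, M)) : Prop :=
  [/\ is_projective P1 /\ is_projective P0, is_hom p1 /\ is_hom p0,
      limg p1 = lker p0 /\ limg p0 = fullv,
      superfluous (lker p0) & superfluous (lker p1)].

End Modules.

Arguments zero_mod {k A}.
Arguments is_basic {k} A.

Section InverseTranslate.
Variables (k : fieldType) (A : falgType k).

(* D M = Hom_k(M, k), a left A-module by (a f)(x) = f (x a).                  *)
Definition dual_mod (M : rmod A) : rmod A^c.
Proof.
apply: (@RMod k A^c 'Hom(M, k^o) (fun f a => (f \o linfun (@ractl k A M a))%VF)).
- by move=> a c f g; rewrite comp_lfunDl comp_lfunZl.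
- move=> f c a b; apply/lfunP => x.
  rewrite !(add_lfunE, scale_lfunE, comp_lfunE, lfunE) /= /ractl.
  by have -> := ract_linearr x c a b; rewrite linearP.
- by move=> f; apply/lfunP => x; rewrite comp_lfunE lfunE /= /ractl ract1.
- move=> f a b; apply/lfunP => x.
  by rewrite !(comp_lfunE, lfunE) /= /ractl -ractM.
Defined.

Implicit Types M N : rmod A^c.

(* The space Hom_A(M, A) of maps from the left A-module M to A.               *)
Definition star_space M : {vspace 'Hom(M, regular_mod A^c)} :=
  homs M (regular_mod A^c).

(* amull a in A^c is the right multiplication by a in A.                      *)
Definition star_act M (f : subvs_of (star_space M)) (a : A) :
    subvs_of (star_space M) :=
  vsproj (star_space M) (amull (a : A^c) \o vsval f)%VF.

Fact star_actE M (f : subvs_of (star_space M)) (a : A) (x : M) :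
  vsval (star_act f a) x = (vsval f x : A) * a :> A.
Proof.
rewrite vsprojK ?comp_lfunE ?lfunE //.
apply/(@homsP k A^c M (regular_mod A^c)) => y b.
rewrite !comp_lfunE !lfunE /=.
have /(@homsP k A^c M (regular_mod A^c)) -> := subvsP f.
exact: (esym (@mulrA A _ _ _)).
Qed.

(* M^* = Hom_A(M, A), a right A-module by (f a)(x) = f x * a.                 *)
Definition star_mod M : rmod A.
Proof.
apply: (@RMod k A (subvs_of (star_space M)) (@star_act M)).
- move=> a c f g; apply/val_inj/lfunP => x.
  rewrite linearP /= add_lfunE scale_lfunE !star_actE.
  rewrite linearP /= add_lfunE scale_lfunE.
  exact: (@ract_linearl k A (regular_mod A) a c (vsval f x) (vsval g x)).
- move=> f c a b; apply/val_inj/lfunP => x.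
  rewrite linearP /= add_lfunE scale_lfunE !star_actE.
  exact: (@ract_linearr k A (regular_mod A) (vsval f x) c a b).
- move=> f; apply/val_inj/lfunP => x.
  by rewrite star_actE mulr1.
- move=> f a b; apply/val_inj/lfunP => x.
  by rewrite !star_actE mulrA.
Defined.

(* p^* : N^* -> M^*, f |-> f \o p, meaningful when p is a homomorphism.       *)
Definition star_map M N (p : 'Hom(M, N)) : 'Hom(star_mod N, star_mod M) :=
  linfun (fun f : subvs_of (star_space N) =>
    vsproj (star_space M) (vsval f \o p)%VF).

Lemma star_mapE M N (p : 'Hom(M, N)) (f : subvs_of (star_space N)) (x : M) :
  is_hom p -> vsval (star_map p f : subvs_of (star_space M)) x = vsval f (p x).
Proof.
move=> homp; pose F (f : subvs_of (star_space N)) :=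
  vsproj (star_space M) (vsval f \o p)%VF.
have linF : linear F.
  move=> c g h; rewrite /F -linearP; congr vsproj.
  by rewrite linearP /= comp_lfunDl comp_lfunZl.
pose FL := GRing.isLinear.Build k _ _ *:%R F linF.
pose FF : {linear subvs_of (star_space N) -> subvs_of (star_space M)} :=
  HB.pack F FL.
rewrite /star_map -/F (lfunE FF) /= vsprojK ?comp_lfunE //.
apply/(@homsP k A^c M (regular_mod A^c)) => y b; rewrite !comp_lfunE homp.
by have /(@homsP k A^c N (regular_mod A^c)) -> := subvsP f.
Qed.

(* N is the transpose of the left module M: there are a minimal projective    *)
(* presentation P1 -p1-> P0 -> M -> 0 and an exact sequence                   *)
(* P0^* -p1^*-> P1^* -> N -> 0.  This determines N up to isomorphism.         *)
Definition is_transpose M (N : rmod A) : Prop :=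
  exists (P1 P0 : rmod A^c) (p1 : 'Hom(P1, P0)) (p0 : 'Hom(P0, M))
         (q : 'Hom(star_mod P1, N)),
    [/\ min_proj_presentation p1 p0,
        is_hom q, lker q = limg (star_map p1) & limg q = fullv].

(* N = tau^{-1} M = Tr (D M)                                                  *)
Definition is_tau_inv (M N : rmod A) : Prop := is_transpose (dual_mod M) N.

End InverseTranslate.

Section Tilts.
Variable k : fieldType.

Definition is_APR_tilting (A : falgType k) (T : rmod A) : Prop :=
  exists P R P' : rmod A,
    [/\ is_simple P /\ is_projective P,
        inj_dim_eq1 P,
        mod_iso (regular_mod A) (sum_mod P R),
        is_tau_inv P P'
      & mod_iso T (sum_mod P' R)].

(* B is isomorphic to End_A(T), acting on the left of the right module T.     *)
Definition is_End_algebra (A : falgType k) (T : rmod A) (B : falgType k) : Prop :=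
  exists phi : 'Hom(B, 'End(T)),
    [/\ lker phi = 0%VS, limg phi = homs T T, phi 1 = \1%VF
      & forall a b, phi (a * b) = (phi a \o phi b)%VF].

Definition related_by_APR_tilt (A B : falgType k) : Prop :=
  exists T : rmod A, is_APR_tilting T /\ is_End_algebra T B.

End Tilts.

Section TorsionClasses.
Variables (k : fieldType) (A : falgType k).
Implicit Types (M N X Y : rmod A) (C T F : rmod A -> Prop).

Definition is_subcategory C : Prop :=
  [/\ forall M N, mod_iso M N -> C M -> C N,
      C zero_mod,
      forall M N, C M -> C N -> C (sum_mod M N)
    & forall M N, C (sum_mod M N) -> C M /\ C N].

Definition is_torsion_pair T F : Prop :=
  [/\ is_subcategory T, is_subcategory F,
      forall X Y (f : 'Hom(X, Y)), T X -> F Y -> is_hom f -> f = 0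
    & forall X, exists (tX fX : rmod A) (i : 'Hom(tX, X)) (p : 'Hom(X, fX)),
        [/\ T tX, F fX & short_exact i p]].

Definition is_torsion_class T : Prop := exists F, is_torsion_pair T F.

Definition is_left_approx C M X (f : 'Hom(M, X)) : Prop :=
  [/\ C X, is_hom f
    & forall Y (g : 'Hom(M, Y)), C Y -> is_hom g ->
        exists h : 'Hom(X, Y), is_hom h /\ g = (h \o f)%VF].

Definition is_right_approx C M X (f : 'Hom(X, M)) : Prop :=
  [/\ C X, is_hom f
    & forall Y (g : 'Hom(Y, M)), C Y -> is_hom g ->
        exists h : 'Hom(Y, X), is_hom h /\ g = (f \o h)%VF].

Definition functorially_finite C : Prop :=
  forall M, (exists X (f : 'Hom(M, X)), is_left_approx C f)
         /\ (exists X (f : 'Hom(X, M)), is_right_approx C f).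

Record fftors := FFTors {
  fftors_mem :> rmod A -> Prop;
  fftorsP : is_torsion_class fftors_mem /\ functorially_finite fftors_mem }.

Definition fftors_le (T T' : fftors) : Prop := forall M, T M -> T' M.

Fact fftors_le_refl (T : fftors) : fftors_le T T. Proof. by []. Qed.

Fact fftors_le_trans (T T' T'' : fftors) :
  fftors_le T T' -> fftors_le T' T'' -> fftors_le T T''.
Proof. by move=> le1 le2 M /le1/le2. Qed.

Fact fftors_le_anti (T T' : fftors) : fftors_le T T' -> fftors_le T' T -> T = T'.
Proof.
case: T T' => [T HT] [T' HT'] /= le1 le2.
have eqT : T = T'.
  by apply/funext => M; apply/propext; split; [apply: le1|apply: le2].
by case: _ / eqT HT' {le1 le2} => HT'; congr FFTors; apply: Prop_irrelevance.
Qed.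

End TorsionClasses.

(* porderType is not usable here: the type of subcategories of mod A lives in *)
(* a universe strictly above the one allowed for the carriers of library      *)
(* structures.                                                                *)
Record poset := Poset {
  pos_sort :> Type;
  ple : pos_sort -> pos_sort -> Prop;
  ple_refl : forall x, ple x x;
  ple_trans : forall x y z, ple x y -> ple y z -> ple x z;
  ple_anti : forall x y, ple x y -> ple y x -> x = y }.

Definition fftors_poset (k : fieldType) (A : falgType k) : poset :=
  Poset (@fftors_le_refl k A) (@fftors_le_trans k A) (@fftors_le_anti k A).

Section FlipFlop.
Variables X Y : poset.

Definition order_preserving (f : X -> Y) : Prop :=
  forall x x', ple x x' -> ple (f x) (f x').

Variables (f : X -> Y) (f_mono : order_preserving f).

Definition le_plus (u v : X + Y) : Prop :=
  match u, v with
  | inl x, inl x' => ple x x'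
  | inr y, inr y' => ple y y'
  | inl x, inr y => ple (f x) y
  | inr _, inl _ => False
  end.

Definition le_minus (u v : X + Y) : Prop :=
  match u, v with
  | inl x, inl x' => ple x x'
  | inr y, inr y' => ple y y'
  | inr y, inl x => ple y (f x)
  | inl _, inr _ => False
  end.

Fact le_plus_refl u : le_plus u u.
Proof. by case: u => z; apply: ple_refl. Qed.

Fact le_plus_trans u v w : le_plus u v -> le_plus v w -> le_plus u w.
Proof.
case: u v w => u [] v [] w //=; try exact: ple_trans.
by move=> /f_mono; apply: ple_trans.
Qed.

Fact le_plus_anti u v : le_plus u v -> le_plus v u -> u = v.
Proof. by case: u v => u [] v //= le1 le2; congr (_ _); apply: ple_anti. Qed.

Definition flip_plus : poset := Poset le_plus_refl le_plus_trans le_plus_anti.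

Fact le_minus_refl u : le_minus u u.
Proof. by case: u => z; apply: ple_refl. Qed.

Fact le_minus_trans u v w : le_minus u v -> le_minus v w -> le_minus u w.
Proof.
case: u v w => u [] v [] w //=; try exact: ple_trans.
by move=> le_uv /f_mono; apply: ple_trans.
Qed.

Fact le_minus_anti u v : le_minus u v -> le_minus v u -> u = v.
Proof. by case: u v => u [] v //= le1 le2; congr (_ _); apply: ple_anti. Qed.

Definition flip_minus : poset :=
  Poset le_minus_refl le_minus_trans le_minus_anti.

End FlipFlop.

Definition poset_iso (Z Z' : poset) : Prop :=
  exists g : Z -> Z', bijective g /\ forall x y, ple x y <-> ple (g x) (g y).

Definition related_by_flip_flop (Z Z' : poset) : Prop :=
  exists (X Y : poset) (f : X -> Y) (f_mono : order_preserving f),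
       (poset_iso Z (flip_plus f_mono) /\ poset_iso Z' (flip_minus f_mono))
    \/ (poset_iso Z (flip_minus f_mono) /\ poset_iso Z' (flip_plus f_mono)).

(* Main.v *)
Require Import Defs.
From mathcomp Require Import all_boot all_algebra all_field.
From HB Require Import structures.
From mathcomp Require Import boolp.

(** Write Lambda = P + R with P simple projective (Lambda and Gamma are A and B
    below, P and R are eA and aA). The proof splits the torsion
    classes of Lambda into those that contain P and those that do not, and the
    torsion classes of Gamma = End(T) into those that contain the simple
    injective module S = Ext^1(T, P) and those that do not, and it compares the
    four kinds through Hom(T, -) and its left adjoint, the tensor product with
    T.

    The almost split sequence 0 -> P -> E -> P' -> 0, with P' = tau^-1 P, has
    projective middle term E generated by R, every map from P to a module
    generated by R extends to E, and Hom(P', Lambda) = 0. All this follows from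
    the minimal projective presentation of the left module DP: its dual is the
    sequence because P is not injective, and its first map is injective because
    P has injective dimension 1 (apr_data_exists). These facts imply that
    Hom(T, -) is exact and fully faithful on the modules generated by R
    (T_lift, T_lift_inj, G_full), and that every Gamma-module is an extension
    of some Hom(T, M) by a sum of copies of S (G_presentation); this is the
    part of Brenner-Butler theory that matters here. A torsion class of Lambda
    that does not contain P consists of modules generated by R, and so such
    classes correspond to the torsion classes of Gamma that contain S
    (psi_psi_inv, psi_G).

    Let eps in Gamma be the projection of T to R along P'. A torsion class of
    Gamma that does not contain S consists of modules N with N eps = N, since
    N / N eps is a sum of copies of S. These are the modules over End(R), which
    is also the quotient of Lambda by the idempotent of P. A torsion class of
    Lambda that contains P is determined by the End(R)-modules Hom(R, M) for M
    in it, so that such classes correspond to the torsion classes of Gamma that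
    do not contain S (phi_phi_inv, psi_eps_GP).

    In Gamma, a class U without S is contained in a class D with S if and only
    if D contains the class of the modules N with N eps in U, which is the
    smallest torsion class containing U and S. In Lambda, the class of U
    contains the class of D if and only if the same class (eps_ext U) contains
    D: the tensor products of N and N eps with T differ by copies of P
    (psi_eps_mod). This is the flip-flop along U |-> eps_ext U.

    A torsion class is the left orthogonal of its torsion-free class
    (tors_perp), so that membership of a tensor product of N with T is
    expressed by maps from N to the modules Hom(T, Y) (psi). It is functorially
    finite if and only if it is generated by one of its objects
    (functorially_finiteP), and such generators are carried along each of the
    correspondences. *)

Set Implicit Arguments.
Unset Strict Implicit.
Unset Printing Implicit Defensive.

Import GRing.Theory.
Local Open Scope ring_scope.
Local Notation "x ** a" := (ract x a) (at level 40, left associativity).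

(** * Linear algebra by predicates *)

Section LinearAlgebra.
Variable k : fieldType.
Implicit Types U V W : vectType k.

(* Linearity of an lfun f, restated so that rewriting leaves the coercion of f
   in the form in which the other facts about f mention it. *)
Lemma lfL U V (f : 'Hom(U, V)) (c : k) x y : f (c *: x + y) = c *: f x + f y.
Proof. exact: linearP. Qed.
Lemma lfD U V (f : 'Hom(U, V)) x y : f (x + y) = f x + f y.
Proof. exact: linearD. Qed.
Lemma lfB U V (f : 'Hom(U, V)) x y : f (x - y) = f x - f y.
Proof. exact: linearB. Qed.
Lemma lfN U V (f : 'Hom(U, V)) x : f (- x) = - f x.
Proof. exact: linearN. Qed.
Lemma lfZ U V (f : 'Hom(U, V)) (c : k) x : f (c *: x) = c *: f x.
Proof. exact: linearZ. Qed.
Lemma lf0 U V (f : 'Hom(U, V)) : f 0 = 0.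
Proof. exact: linear0. Qed.
Lemma lf_sum U V (f : 'Hom(U, V)) I (r : seq I) (F : I -> U) :
  f (\sum_(i <- r) F i) = \sum_(i <- r) f (F i).
Proof. exact: linear_sum. Qed.

Lemma lfun_of_linear U V (f : U -> V) :
  linear f -> exists g : 'Hom(U, V), g =1 f.
Proof.
move=> linf; pose FL := GRing.isLinear.Build k _ _ *:%R f linf.
pose F : {linear U -> V} := HB.pack f FL.
by exists (linfun F) => x; rewrite lfunE.
Qed.

Definition subspace_pred V (Q : V -> Prop) : Prop :=
  Q 0 /\ forall (c : k) x y, Q x -> Q y -> Q (c *: x + y).

(** Subspaces and submodules are mostly given by Prop-valued predicates below;
    a largest subspace contained in such a predicate is all of it. *)
Lemma vspace_of_pred V (Q : V -> Prop) :
  subspace_pred Q -> exists U : {vspace V}, forall x, x \in U <-> Q x.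
Proof.
case=> Q0 QD.
suff grow n (U : {vspace V}) : (forall x, x \in U -> Q x) ->
    (\dim {:V} <= \dim U + n)%N ->
    exists U' : {vspace V}, forall x, x \in U' <-> Q x.
  apply: (grow (\dim {:V}) 0%VS); last by rewrite dimv0.
  by move=> x; rewrite memv0 => /eqP->.
elim: n U => [|n IHn] U UQ dimU.
  exists U => x; split; first exact: UQ.
  move=> _; have -> : U = fullv; last exact: memvf.
  by apply/eqP; rewrite eqEdim subvf -(addn0 (\dim U)).
have [QU|] := pselect (forall x, Q x -> x \in U).
  by exists U => x; split; [apply: UQ | apply: QU].
move=> /existsNP[x /not_implyP[Qx /negP xU]].
apply: (IHn (U + <[x]>)%VS) => [y /memv_addP[u uU [v /vlineP[c ->] ->]]|].
  by rewrite addrC; apply: QD => //; apply: UQ.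
apply: leq_trans dimU _; rewrite addnS -addSn leq_add2r.
rewrite ltnNge; apply/negP => le_dim; case/negP: xU.
have /eqP-> : U == (U + <[x]>)%VS by rewrite eqEdim addvSl.
by rewrite memvE addvSr.
Qed.

(** Finite dimensional spaces are reflexive: expand in a basis and its dual
    basis. *)
Lemma dual_reflexive V (phi : 'Hom('Hom(V, k^o), k^o)) :
  exists x : V, forall f : 'Hom(V, k^o), phi f = f x.
Proof.
pose b := vbasis {:V}; pose cf i : 'Hom(V, k^o) := linfun (coord b i : V -> k^o).
exists (\sum_(i < \dim {:V}) (phi (cf i) : k) *: b`_i) => f.
have {1}-> : f = \sum_(i < \dim {:V}) (f b`_i : k) *: cf i.
  apply/lfunP => x; rewrite {1}(coord_vbasis (memvf x)) sum_lfunE linear_sum /=.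
  apply: eq_bigr => i _; rewrite linearZ scale_lfunE lfunE /=.
  exact: mulrC.
rewrite !linear_sum /=; apply: eq_bigr => i _; rewrite !linearZ /=.
exact: mulrC.
Qed.

Lemma dual_separates V (x : V) : x != 0 -> exists f : 'Hom(V, k^o), f x != 0.
Proof.
move=> xn0; apply: contrapT => /forallNP no_f; case/negP: xn0; apply/eqP.
rewrite (coord_vbasis (memvf x)) big1 // => i _.
have := no_f (linfun (coord (vbasis {:V}) i : V -> k^o)).
by rewrite lfunE => /negP; rewrite negbK => /eqP ->; rewrite scale0r.
Qed.

(** The map is x |-> x - p x for a projection p onto U, with its image as
    codomain. *)
Lemma vspace_is_kernel V (U : {vspace V}) :
  exists (W : vectType k) (p : 'Hom(V, W)),
    (forall y, exists x, p x = y) /\ forall x, p x = 0 <-> x \in U.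
Proof.
pose q : 'Hom(V, V) := (\1 - projv U)%VF.
have qE x : q x = x - projv U x by rewrite add_lfunE opp_lfunE id_lfunE.
have [p pE] : exists p : 'Hom(V, subvs_of (limg q)),
    p =1 fun x => vsproj (limg q) (q x).
  by apply: lfun_of_linear => c x y; rewrite !linearP.
exists (subvs_of (limg q)), p; split=> [y|x].
  have /memv_imgP[x _ yE] := subvsP y.
  by exists x; apply: val_inj; rewrite pE /= -yE vsvalK.
have -> : p x = 0 <-> q x = 0.
  rewrite pE; split=> [|->]; last by rewrite linear0.
  move/(congr1 vsval); rewrite linear0 vsprojK //.
  exact/memv_img/memvf.
rewrite qE; split=> [/eqP|xU]; last by rewrite projv_id ?subrr.
by rewrite subr_eq0 => /eqP->; apply: memv_proj.
Qed.

Lemma dual_span V (U : {vspace 'Hom(V, k^o)}) :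
  (forall x : V, (forall f, f \in U -> f x = 0) -> x = 0) -> U = fullv.
Proof.
move=> sepU; apply/eqP; rewrite eqEsubv subvf /=; apply/subvP => f _.
apply: contrapT => fU.
have [W [p [_ kerp]]] := vspace_is_kernel U.
have /dual_separates[g gf] : p f != 0 by apply/eqP => /kerp.
have [x xE] := dual_reflexive (g \o p)%VF.
case/negP: gf; rewrite -[g _]comp_lfunE xE (sepU x) ?linear0 // => h hU.
by rewrite -xE comp_lfunE (proj2 (kerp h) hU) linear0.
Qed.

(** Used for maps prescribed on generators: only the well-definedness at 0 has
    to be checked. *)
Lemma lfun_of_rel U V (Rl : U -> V -> Prop) :
    (forall (c : k) x y x' y', Rl x y -> Rl x' y' -> Rl (c *: x + x') (c *: y + y')) ->
    (forall x, exists y, Rl x y) -> (forall y, Rl 0 y -> y = 0) ->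
  exists f : 'Hom(U, V), forall x y, Rl x y <-> y = f x.
Proof.
move=> linR totR zeroR; have [f fR] := choice totR.
have uniqR x y y' : Rl x y -> Rl x y' -> y = y'.
  move=> Ry Ry'; apply/eqP; rewrite -subr_eq0 addrC -scaleN1r; apply/eqP/zeroR.
  by have := linR (-1) _ _ _ _ Ry' Ry; rewrite (scaleN1r x) addNr.
have [g gE] : exists g : 'Hom(U, V), g =1 f.
  by apply: lfun_of_linear => c x y; apply: uniqR (fR _) _; apply: linR.
by exists g => x y; rewrite gE; split=> [/uniqR/(_ (fR x))//|->].
Qed.

End LinearAlgebra.

(** * Modules and homomorphisms *)

Section ModuleBasics.
Variables (k : fieldType) (A : falgType k).
Implicit Types M N X Y Z Q K E : rmod A.

Lemma ractDl M (x y : M) a : (x + y) ** a = x ** a + y ** a.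
Proof. exact: (linearD (@ractl k A M a)). Qed.
Lemma ractZl M (c : k) (x : M) a : (c *: x) ** a = c *: (x ** a).
Proof. exact: (linearZ_LR (@ractl k A M a)). Qed.
Lemma ract0l M a : (0 : M) ** a = 0.
Proof. exact: (linear0 (@ractl k A M a)). Qed.
Lemma ractNl M (x : M) a : (- x) ** a = - (x ** a).
Proof. exact: (linearN (@ractl k A M a)). Qed.
Lemma ractBl M (x y : M) a : (x - y) ** a = x ** a - y ** a.
Proof. exact: (linearB (@ractl k A M a)). Qed.
Lemma ract_suml M I (r : seq I) (F : I -> M) a :
  (\sum_(i <- r) F i) ** a = \sum_(i <- r) F i ** a.
Proof. exact: (linear_sum (@ractl k A M a)). Qed.
Lemma ractDr M (x : M) a b : x ** (a + b) = x ** a + x ** b.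
Proof. exact: (linearD (@ract k A M x)). Qed.
Lemma ractZr M (x : M) (c : k) a : x ** (c *: a) = c *: (x ** a).
Proof. exact: (linearZ_LR (@ract k A M x)). Qed.
Lemma ract0r M (x : M) : x ** 0 = 0.
Proof. exact: (linear0 (@ract k A M x)). Qed.
Lemma ractBr M (x : M) a b : x ** (a - b) = x ** a - x ** b.
Proof. exact: (linearB (@ract k A M x)). Qed.

Lemma hom_of_fun M N (f : M -> N) :
    linear f -> (forall x a, f (x ** a) = f x ** a) ->
  exists g : 'Hom(M, N), is_hom g /\ g =1 f.
Proof.
move=> linf eqf; have [g gE] := lfun_of_linear linf.
by exists g; split=> // x a; rewrite !gE.
Qed.

Lemma hom_of_rel M N (Rl : M -> N -> Prop) :
    (forall (c : k) x y x' y', Rl x y -> Rl x' y' -> Rl (c *: x + x') (c *: y + y')) ->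
    (forall x y a, Rl x y -> Rl (x ** a) (y ** a)) ->
    (forall x, exists y, Rl x y) -> (forall y, Rl 0 y -> y = 0) ->
  exists f : 'Hom(M, N), is_hom f /\ forall x y, Rl x y -> y = f x.
Proof.
move=> linR actR totR zeroR; have [f fP] := lfun_of_rel linR totR zeroR.
exists f; split=> [x a|x y /fP//].
by apply/esym/fP/actR/fP.
Qed.

Lemma hom_comp X Y Z (g : 'Hom(Y, Z)) (f : 'Hom(X, Y)) :
  is_hom g -> is_hom f -> is_hom (g \o f)%VF.
Proof. by move=> homg homf x a; rewrite !comp_lfunE homf homg. Qed.
Lemma hom_id X : is_hom (\1%VF : 'Hom(X, X)).
Proof. by move=> x a; rewrite !id_lfunE. Qed.
Lemma hom_0 X Y : is_hom (0 : 'Hom(X, Y)).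
Proof. by move=> x a; rewrite !zero_lfunE ract0l. Qed.
Lemma hom_add X Y (f g : 'Hom(X, Y)) : is_hom f -> is_hom g -> is_hom (f + g).
Proof. by move=> homf homg x a; rewrite !add_lfunE homf homg ractDl. Qed.
Lemma hom_scale X Y (c : k) (f : 'Hom(X, Y)) : is_hom f -> is_hom (c *: f).
Proof. by move=> homf x a; rewrite !scale_lfunE homf ractZl. Qed.
Lemma hom_sub X Y (f g : 'Hom(X, Y)) : is_hom f -> is_hom g -> is_hom (f - g).
Proof.
by move=> homf homg x a; rewrite !add_lfunE !opp_lfunE homf homg ractBl.
Qed.
Lemma hom_sum X Y I (r : seq I) (f : I -> 'Hom(X, Y)) :
  (forall i, is_hom (f i)) -> is_hom (\sum_(i <- r) f i).
Proof.
move=> homf; elim/big_rec: _ => [|i g _]; first exact: hom_0.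
exact/hom_add/homf.
Qed.

Lemma lker_trivialP X Y (f : 'Hom(X, Y)) :
  lker f = 0%VS <-> forall x, f x = 0 -> x = 0.
Proof.
split=> [kerf x fx0|injf].
  by apply/eqP; rewrite -memv0 -kerf memv_ker fx0.
apply/eqP; rewrite -subv0; apply/subvP => x; rewrite memv_ker => /eqP/injf->.
exact: mem0v.
Qed.

Lemma limg_fullP X Y (f : 'Hom(X, Y)) :
  limg f = fullv <-> forall y, exists x, f x = y.
Proof.
split=> [imf y|surf].
  by have: y \in limg f by [rewrite imf memvf]; case/memv_imgP => x _ ->; exists x.
apply/eqP; rewrite eqEsubv subvf /=; apply/subvP => y _.
by have [x <-] := surf y; apply/memv_img/memvf.
Qed.

Lemma limg_lkerP X Y Z (f : 'Hom(X, Y)) (g : 'Hom(Y, Z)) :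
  limg f = lker g <-> forall y, g y = 0 <-> exists x, y = f x.
Proof.
split=> [ex y|ex].
  split=> [gy|[x ->]].
    have: y \in limg f by rewrite ex memv_ker gy.
    by case/memv_imgP => x _ ->; exists x.
  by apply/eqP; rewrite -memv_ker -ex memv_img ?memvf.
apply/vspaceP => y; rewrite memv_ker; apply/idP/eqP.
  by case/memv_imgP => x _ ->; apply/ex; exists x.
by move/ex => [x ->]; apply/memv_img/memvf.
Qed.

Lemma short_exactP X Y Z (f : 'Hom(X, Y)) (g : 'Hom(Y, Z)) :
  short_exact f g <->
  [/\ is_hom f, is_hom g, forall x, f x = 0 -> x = 0,
      forall y, g y = 0 <-> exists x, y = f x & forall z, exists y, g y = z].
Proof.
by split=> -[? ? /lker_trivialP ? /limg_lkerP ? /limg_fullP ?].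
Qed.

Lemma hom_factor M Q Y (p : 'Hom(M, Q)) (f : 'Hom(M, Y)) :
    is_hom p -> is_hom f -> (forall q, exists x, p x = q) ->
    (forall x, p x = 0 -> f x = 0) ->
  exists h : 'Hom(Q, Y), is_hom h /\ forall x, h (p x) = f x.
Proof.
move=> homp homf surp kerp.
have [||||h [homh hE]] := @hom_of_rel Q Y (fun q y => exists2 x, q = p x & y = f x).
- by move=> c _ _ _ _ [x -> ->] [x' -> ->]; exists (c *: x + x'); rewrite lfL.
- by move=> _ _ a [x -> ->]; exists (x ** a); rewrite ?homp ?homf.
- by move=> q; have [x <-] := surp q; exists (f x), x.
- by move=> _ [x /esym/kerp ? ->].
by exists h; split=> // x; apply/esym/hE; exists x.
Qed.

Lemma hom_lift N M Y (i : 'Hom(N, M)) (f : 'Hom(Y, M)) :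
    is_hom i -> is_hom f -> (forall x, i x = 0 -> x = 0) ->
    (forall y, exists x, f y = i x) ->
  exists h : 'Hom(Y, N), is_hom h /\ forall y, i (h y) = f y.
Proof.
move=> homi homf inji imf.
have [||||h [homh hE]] := @hom_of_rel Y N (fun y x => f y = i x).
- by move=> c y x y' x' e e'; rewrite !lfL /= e e'.
- by move=> y x a; rewrite homi homf => ->.
- by [].
- by move=> x; rewrite lf0 => /esym/inji.
by exists h; split=> // y; have [x fy] := imf y; rewrite -(hE _ _ fy) fy.
Qed.

Definition is_sub M (Q : M -> Prop) : Prop :=
  subspace_pred Q /\ forall x a, Q x -> Q (x ** a).

Lemma sub0 M (Q : M -> Prop) : is_sub Q -> Q 0. Proof. by case=> -[]. Qed.
Lemma subD M (Q : M -> Prop) x y : is_sub Q -> Q x -> Q y -> Q (x + y).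
Proof. by case=> -[_ QD] _ Qx Qy; rewrite -(scale1r x); apply: QD. Qed.
Lemma subZ M (Q : M -> Prop) c x : is_sub Q -> Q x -> Q (c *: x).
Proof. by case=> -[Q0 QD] _ Qx; rewrite -(addr0 (_ *: _)); apply: QD. Qed.
Lemma sub_act M (Q : M -> Prop) x a : is_sub Q -> Q x -> Q (x ** a).
Proof. by case=> _; apply. Qed.
Lemma sub_sum M (Q : M -> Prop) I (r : seq I) (F : I -> M) :
  is_sub Q -> (forall i, Q (F i)) -> Q (\sum_(i <- r) F i).
Proof.
move=> sQ QF; elim/big_rec: _ => [|i x _]; first exact: sub0.
exact: subD.
Qed.

Lemma sub_ker M N (f : 'Hom(M, N)) : is_hom f -> is_sub (fun x => f x = 0).
Proof.
move=> homf; split; first split=> [|c x y fx fy]; rewrite ?lf0 //.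
  by rewrite lfL fx fy scaler0 addr0.
by move=> x a fx; rewrite homf fx ract0l.
Qed.

Lemma sub_im M N (f : 'Hom(M, N)) : is_hom f -> is_sub (fun y => exists x, y = f x).
Proof.
move=> homf; split; first split=> [|c _ _ [x ->] [y ->]].
- by exists 0; rewrite lf0.
- by exists (c *: x + y); rewrite lfL.
by move=> _ a [x ->]; exists (x ** a); rewrite homf.
Qed.

Definition sub_mod M (U : {vspace M}) (subU : is_submodule U) : rmod A.
Proof.
apply: (@RMod k A (subvs_of U) (fun x a => Subvs (subU (vsval x) a (subvsP x)))).
- by move=> a c x y; apply: val_inj; rewrite /= ractDl ractZl.
- by move=> x c a b; apply: val_inj; rewrite /= ractDr ractZr.
- by move=> x; apply: val_inj; rewrite /= ract1.
- by move=> x a b; apply: val_inj; rewrite /= ractM.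
Defined.

Lemma submodule_exists M (Q : M -> Prop) : is_sub Q ->
  exists N (i : 'Hom(N, M)), [/\ is_hom i, forall x, i x = 0 -> x = 0
                              & forall x, Q x <-> exists y, x = i y].
Proof.
case=> /vspace_of_pred[U UQ] actQ.
have subU : is_submodule U by move=> x a /UQ Qx; apply/UQ/actQ.
have [|//|i [homi iE]] := @hom_of_fun (sub_mod subU) M vsval.
  by move=> c x y; rewrite linearP.
exists (sub_mod subU), i; split=> // [x|x].
  by rewrite iE => vx0; apply: val_inj; rewrite /= vx0.
rewrite -UQ; split=> [xU|[y ->]]; last by rewrite iE; apply: subvsP.
by exists (Subvs xU); rewrite iE.
Qed.

Lemma quotient_exists M (Q : M -> Prop) : is_sub Q ->
  exists N (p : 'Hom(M, N)), [/\ is_hom p, forall y, exists x, p x = y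
                              & forall x, p x = 0 <-> Q x].
Proof.
case=> /vspace_of_pred[U UQ] actQ.
have [W [p [surp kerp]]] := vspace_is_kernel U.
have actK x a : p x = 0 -> p (x ** a) = 0.
  by move/kerp/UQ/actQ => /(_ a)/UQ/kerp.
pose s := (p^-1)%VF; pose act y a := p (s y ** a).
have pK : cancel s p.
  move=> y; rewrite limg_lfunVK //; have [x <-] := surp y.
  exact/memv_img/memvf.
have actE x a : act (p x) a = p (x ** a).
  apply/eqP; rewrite -subr_eq0 -lfB -ractBl; apply/eqP/actK.
  by rewrite lfB pK subrr.
have lin1 a : linear (act^~ a).
  by move=> c x y; rewrite /act lfL ractDl ractZl lfL.
have lin2 x : linear (act x) by move=> c a b; rewrite /act ractDr ractZr lfL.
have act1 x : act x 1 = x by rewrite /act ract1 pK.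
have actM x a b : act x (a * b) = act (act x a) b.
  by rewrite {3}/act actE -ractM.
by exists (RMod lin1 lin2 act1 actM), p; split=> // x; rewrite kerp UQ.
Qed.

Lemma image_exists M N (f : 'Hom(M, N)) : is_hom f ->
  exists K (p : 'Hom(M, K)) (i : 'Hom(K, N)),
    [/\ is_hom p, is_hom i, forall y, exists x, p x = y,
        forall y, i y = 0 -> y = 0 & forall x, f x = i (p x)].
Proof.
move=> homf; have [K [i [homi inji imi]]] := submodule_exists (sub_im homf).
have [x|p [homp pE]] := @hom_lift _ _ _ i f homi homf inji.
  by apply/imi; exists x.
exists K, p, i; split=> // y.
have /imi[x iy] : exists z, i y = i z by exists y.
have [z fz] : exists z, i y = f z by apply/imi; exists y.
by exists z; apply/eqP; rewrite -subr_eq0; apply/eqP/inji; rewrite lfB pE fz subrr.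
Qed.

Definition pow_mod (n : nat) M : rmod A.
Proof.
apply: (@RMod k A {ffun 'I_n -> M} (fun x a => [ffun i => x i ** a])).
- by move=> a c x y; apply/ffunP => i; rewrite !ffunE ractDl ractZl.
- by move=> x c a b; apply/ffunP => i; rewrite !ffunE ractDr ractZr.
- by move=> x; apply/ffunP => i; rewrite !ffunE ract1.
- by move=> x a b; apply/ffunP => i; rewrite !ffunE ractM.
Defined.

Lemma pow_copair n X Y (h : 'I_n -> 'Hom(X, Y)) : (forall i, is_hom (h i)) ->
  exists H : 'Hom(pow_mod n X, Y), is_hom H /\
    forall z : {ffun 'I_n -> X}, H z = \sum_i h i (z i).
Proof.
move=> homh; apply: hom_of_fun => [c x y|x a].
  rewrite scaler_sumr -big_split; apply: eq_bigr => i _.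
  by rewrite !ffunE lfL.
by rewrite ract_suml; apply: eq_bigr => i _; rewrite ffunE homh.
Qed.

Lemma pow_pair n X Y (h : 'I_n -> 'Hom(Y, X)) : (forall i, is_hom (h i)) ->
  exists H : 'Hom(Y, pow_mod n X), is_hom H /\
    forall y, H y = [ffun i => h i y] :> {ffun 'I_n -> X}.
Proof.
move=> homh; apply: (@hom_of_fun Y (pow_mod n X)) => [c x y|x a].
  by apply/ffunP => i; rewrite !ffunE lfL.
by apply/ffunP => i; rewrite !ffunE homh.
Qed.

Lemma pow_proj n X i : exists H : 'Hom(pow_mod n X, X), is_hom H /\
  forall z : {ffun 'I_n -> X}, H z = z i.
Proof.
by apply: (@hom_of_fun (pow_mod n X)) => [c x y|x a]; rewrite !ffunE.
Qed.

Lemma pow_inj n X (j : 'I_n) : exists H : 'Hom(X, pow_mod n X), is_hom H /\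
  forall x, H x = [ffun i => if i == j then x else 0] :> {ffun 'I_n -> X}.
Proof.
apply: (@hom_of_fun X (pow_mod n X)) => [c x y|x a]; apply/ffunP => i;
  by rewrite !ffunE; case: eqP => // _; rewrite ?scaler0 ?addr0 ?ract0l.
Qed.

Lemma sum_proj1 X Y : exists H : 'Hom(sum_mod X Y, X), is_hom H /\
  forall z : X * Y, H z = z.1.
Proof. exact: (@hom_of_fun (sum_mod X Y)). Qed.
Lemma sum_proj2 X Y : exists H : 'Hom(sum_mod X Y, Y), is_hom H /\
  forall z : X * Y, H z = z.2.
Proof. exact: (@hom_of_fun (sum_mod X Y)). Qed.
Lemma sum_inj1 X Y : exists H : 'Hom(X, sum_mod X Y), is_hom H /\
  forall x, H x = (x, 0) :> X * Y.
Proof.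
apply: (@hom_of_fun X (sum_mod X Y)) => [c x y|x a]; congr pair => /=.
  by rewrite scaler0 addr0.
by rewrite ract0l.
Qed.
Lemma sum_inj2 X Y : exists H : 'Hom(Y, sum_mod X Y), is_hom H /\
  forall y, H y = (0, y) :> X * Y.
Proof.
apply: (@hom_of_fun Y (sum_mod X Y)) => [c x y|x a]; congr pair => /=.
  by rewrite scaler0 addr0.
by rewrite ract0l.
Qed.
Lemma sum_copair X Y Z (f : 'Hom(X, Z)) (g : 'Hom(Y, Z)) : is_hom f -> is_hom g ->
  exists H : 'Hom(sum_mod X Y, Z), is_hom H /\ forall z : X * Y, H z = f z.1 + g z.2.
Proof.
move=> homf homg; apply: (@hom_of_fun (sum_mod X Y)) => [c x y|x a] /=.
  by rewrite !lfL scalerDr addrACA.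
by rewrite homf homg ractDl.
Qed.
Lemma sum_pair X Y Z (f : 'Hom(Z, X)) (g : 'Hom(Z, Y)) : is_hom f -> is_hom g ->
  exists H : 'Hom(Z, sum_mod X Y), is_hom H /\ forall z, H z = (f z, g z) :> X * Y.
Proof.
move=> homf homg; apply: (@hom_of_fun Z (sum_mod X Y)) => [c x y|x a]; congr pair;
  by rewrite ?lfL ?homf ?homg.
Qed.

(** This is the free module of rank 1: 1 is mapped to x. *)
Lemma hom_from_regular M (x : M) : exists H : 'Hom(regular_mod A, M), is_hom H /\
  forall a : A, H a = x ** a.
Proof.
apply: (@hom_of_fun (regular_mod A) M) => [c a b|a b]; last exact: ractM.
by rewrite ractDr ractZr.
Qed.

Lemma is_zeroP M : is_zero M <-> forall x : M, x = 0.
Proof.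
rewrite /is_zero; split=> [dim0 x|z].
  have : x \in (fullv : {vspace M}) by rewrite memvf.
  by move/eqP: dim0; rewrite dimv_eq0 => /eqP->; rewrite memv0 => /eqP.
apply/eqP; rewrite dimv_eq0 -subv0; apply/subvP => x _; rewrite (z x); exact: mem0v.
Qed.

Lemma mod_iso_of M N (f : 'Hom(M, N)) (g : 'Hom(N, M)) :
  is_hom f -> cancel f g -> cancel g f -> mod_iso M N.
Proof.
move=> homf fK gK; exists f; split=> //.
  by apply/lker_trivialP => x fx; rewrite -(fK x) fx lf0.
by apply/limg_fullP => y; exists (g y).
Qed.

Lemma mod_isoP M N : mod_iso M N ->
  exists (f : 'Hom(M, N)) (g : 'Hom(N, M)),
    [/\ is_hom f, is_hom g, cancel f g & cancel g f].
Proof.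
move=> [f [homf /lker_trivialP injf /limg_fullP surf]].
have [|g [homg gE]] := @hom_lift M N N f \1%VF homf (@hom_id N) injf.
  by move=> y; have [x <-] := surf y; exists x; rewrite id_lfunE.
have gK : cancel g f by move=> y; rewrite gE id_lfunE.
exists f, g; split=> // x; apply/eqP; rewrite -subr_eq0; apply/eqP/injf.
by rewrite lfB gK subrr.
Qed.

End ModuleBasics.

(** * Torsion classes and functorial finiteness *)

Lemma bounded_has_max (P : nat -> Prop) n0 b :
  P n0 -> (forall n, P n -> (n <= b)%N) -> exists2 n, P n & forall m, P m -> (m <= n)%N.
Proof.
move=> Pn0 leb; have [||n /asboolP Pn maxn] := @ex_maxnP (fun n => `[<P n>]) b.
- by exists n0; apply/asboolP.
- by move=> n /asboolP/leb.
by exists n => // m Pm; apply/maxn/asboolP.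
Qed.

Section Torsion.
Variables (k : fieldType) (A : falgType k).
Implicit Types M N X Y Z T F Q K : rmod A.
Implicit Type C : rmod A -> Prop.

Definition tors C : Prop :=
  [/\ C zero_mod,
      forall M N (p : 'Hom(M, N)), is_hom p -> (forall y, exists x, p x = y) -> C M -> C N
    & forall X Y Z (f : 'Hom(X, Y)) (g : 'Hom(Y, Z)), short_exact f g -> C X -> C Z -> C Y].

Definition perp C Y : Prop :=
  forall X (h : 'Hom(X, Y)), C X -> is_hom h -> forall x, h x = 0.

Lemma tors_quot C M N (p : 'Hom(M, N)) :
  tors C -> is_hom p -> (forall y, exists x, p x = y) -> C M -> C N.
Proof. by case=> _ + _; apply. Qed.

Lemma tors_zero C M : tors C -> (forall x : M, x = 0) -> C M.
Proof.
move=> torsC z; have [C0 _ _] := torsC.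
by apply: (tors_quot torsC (@hom_0 k A zero_mod M)) => // y; exists 0; rewrite lf0 (z y).
Qed.

Lemma tors_iso C M N : tors C -> mod_iso M N -> C M -> C N.
Proof. by move=> torsC [f [homf _ /limg_fullP surf]]; apply: tors_quot surf. Qed.

Lemma sum_exact X Y : exists (i : 'Hom(X, sum_mod X Y)) (p : 'Hom(sum_mod X Y, Y)),
  short_exact i p.
Proof.
have [i [homi iE]] := sum_inj1 X Y; have [p [homp pE]] := sum_proj2 X Y.
exists i, p; apply/short_exactP; split=> // [x|[x y]|y].
- by rewrite iE => -[].
- rewrite pE /=; split=> [->|[x']]; first by exists x; rewrite iE.
  by rewrite iE => -[].
by exists (0, y); rewrite pE.
Qed.

Lemma tors_sum C X Y : tors C -> C X -> C Y -> C (sum_mod X Y).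
Proof. by case=> _ _ extC; have [i [p ex]] := sum_exact X Y; apply: extC ex. Qed.

Lemma perp_sub C Y Z (i : 'Hom(Z, Y)) :
  is_hom i -> (forall z, i z = 0 -> z = 0) -> perp C Y -> perp C Z.
Proof.
move=> homi inji perpY X h CX homh x; apply: inji; rewrite -comp_lfunE.
exact: (perpY X _ CX (hom_comp homi homh)).
Qed.

(** Among the homomorphisms to X from objects of C take one whose image has
    the largest dimension. By closure under sums this image contains all the
    others, and by closure under extensions the quotient by it receives no
    nonzero map from C. *)
Lemma torsion_seq C X : tors C ->
  exists T F (i : 'Hom(T, X)) (p : 'Hom(X, F)), [/\ C T, perp C F & short_exact i p].
Proof.
move=> torsC.
pose P (n : nat) := exists T (i : 'Hom(T, X)), [/\ C T, is_hom i & \dim (limg i) = n].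
have P0 : P (\dim (limg (0 : 'Hom(@zero_mod k A, X)))).
  by exists zero_mod, 0; split=> //; [case: torsC | apply: hom_0].
have [n Pn|_ [T [i [CT homi <-]]] imax] := @bounded_has_max P _ (\dim {:X}) P0.
  by have [T [i [_ _ <-]]] := Pn; apply/dimvS/subvf.
have absorb T' (i' : 'Hom(T', X)) : C T' -> is_hom i' -> forall x, i' x \in limg i.
  move=> CT' homi' x; have [j [homj jE]] := sum_copair homi homi'.
  have ij : limg i = limg j.
    apply/eqP; rewrite eqEdim; apply/andP; split.
      apply/subvP => _ /memv_imgP[y _ ->].
      have -> : i y = j (y, 0) by rewrite jE /= lf0 addr0.
      exact/memv_img/memvf.
    by apply: imax; exists (sum_mod T T'), j; split=> //; apply: tors_sum.
  have -> : i' x = j (0, x) by rewrite jE /= lf0 add0r.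
  by rewrite ij; apply/memv_img/memvf.
have [K [q [s [homq homs surq injs qs]]]] := image_exists homi.
have CK : C K by apply: tors_quot surq CT.
have [F [p [homp surp kerp]]] := quotient_exists (sub_im homs).
have exsp : short_exact s p by apply/short_exactP; split.
exists K, F, s, p; split=> // X' h CX' homh.
have [J [q' [j [homq' homj surq' injj q'j]]]] := image_exists homh.
have subY : is_sub (fun x => exists y, p x = j y).
  split; first split=> [|c x x' [y e] [y' e']]; first by exists 0; rewrite !lf0.
    by exists (c *: y + y'); rewrite !lfL e e'.
  by move=> x a [y e]; exists (y ** a); rewrite homp homj e.
have [Y [u [homu inju imu]]] := submodule_exists subY.
have [|v [homv vE]] := @hom_lift _ _ _ _ _ j (p \o u)%VF homj (hom_comp homp homu) injj.
  by move=> y; rewrite comp_lfunE; apply/imu; exists y.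
have [|w [homw wE]] := @hom_lift _ _ _ _ _ u s homu homs inju.
  move=> y; apply/imu; exists 0; rewrite lf0; apply/kerp; by exists y.
have CY : C Y.
  case: (torsC) => _ _ /(_ K Y J w v); apply=> //; last by apply: tors_quot surq' CX'.
  apply/short_exactP; split=> // [x wx|y|z].
  - by apply: injs; rewrite -wE wx lf0.
  - have vp : v y = 0 <-> p (u y) = 0.
      rewrite -comp_lfunE -vE; split=> [->|/injj//]; exact: lf0.
    rewrite vp kerp; split=> -[t e]; exists t.
      by apply/eqP; rewrite -subr_eq0; apply/eqP/inju; rewrite lfB wE e subrr.
    by rewrite e wE.
  have [x px] := surp (j z); have [y xE] : exists y, x = u y by apply/imu; exists z.
  exists y; apply/eqP; rewrite -subr_eq0; apply/eqP/injj.
  by rewrite lfB vE comp_lfunE -xE px subrr.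
move=> x; rewrite q'j.
have [t pt] := surp (j (q' x)); rewrite -pt; apply/kerp.
have [y ->] : exists y, t = u y by apply/imu; exists (q' x).
by have /memv_imgP[z _ ->] := absorb Y u CY homu y; exists (q z).
Qed.

(** A torsion class is the left orthogonal of its torsion-free class. Nearly
    all the memberships below are proved through this criterion. *)
Lemma tors_perp C M : tors C ->
    (forall Y (h : 'Hom(M, Y)), perp C Y -> is_hom h -> forall x, h x = 0) ->
  C M.
Proof.
move=> torsC zeroM; have [T [F [i [p [CT pF]]]]] := torsion_seq M torsC.
case/short_exactP => homi homp _ ex _.
by apply: tors_quot torsC homi _ CT => y; have /ex[x ->] := zeroM F p pF homp y; exists x.
Qed.

Lemma tors_ext C X Y Z (i : 'Hom(X, Y)) (p : 'Hom(Y, Z)) : tors C ->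
    is_hom i -> is_hom p -> (forall z, exists y, p y = z) ->
    (forall y, p y = 0 -> exists x, y = i x) -> C X -> C Z ->
  C Y.
Proof.
move=> torsC homi homp surp kerp CX CZ; apply: tors_perp => // W h pW homh x.
have [y /kerp[z ->]|g [homg gE]] := hom_factor homp homh surp.
  by rewrite -comp_lfunE; apply: pW => //; apply: hom_comp.
by rewrite -gE; apply: pW CZ _ _.
Qed.

Lemma tors_pow C n X : tors C -> C X -> C (pow_mod n X).
Proof.
move=> torsC CX; apply: tors_perp => // Y h pY homh x.
have -> : x = \sum_j [ffun i => if i == j then x i else 0] :> {ffun 'I_n -> X}.
  apply/ffunP => i; rewrite sum_ffunE (bigD1 i) //= ffunE eqxx big1 ?addr0 // => j.
  by rewrite ffunE eq_sym => /negPf->.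
rewrite lf_sum big1 // => j _; have [H [homH HE]] := pow_inj X j.
have -> : [ffun i => if i == j then x i else 0] = H (x j) :> {ffun 'I_n -> X}.
  by rewrite HE; apply/ffunP => i; rewrite !ffunE; case: eqP => // ->.
by rewrite -comp_lfunE; apply: pY => //; apply: hom_comp.
Qed.

Lemma torsion_classP C : is_torsion_class C <-> tors C.
Proof.
split=> [[F [[isoC C0 sumC dirC] _ homCF decF]]|torsC].
  have zeroF X : (exists T F' (i : 'Hom(T, X)) (p : 'Hom(X, F')),
      [/\ C T, F F', short_exact i p & forall x, p x = 0]) -> C X.
    move=> [T [F' [i [p [CT _ /short_exactP[homi _ inji ex _] p0]]]]].
    apply: isoC CT; exists i; split=> //; first exact/lker_trivialP.
    by apply/limg_fullP => y; have /ex[x ->] := p0 y; exists x.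
  split=> // [M N q homq surq CM|X Y Z f g /short_exactP[homf homg _ ex surg] CX CZ].
    have [T [F' [i [p [CT FF exN]]]]] := decF N; have [_ homp _ _ _] := exN.
    apply: zeroF; exists T, F', i, p; split=> // y; have [x <-] := surq y.
    by rewrite -comp_lfunE (homCF _ _ _ CM FF (hom_comp homp homq)) zero_lfunE.
  have [T [F' [i [p [CT FF exY]]]]] := decF Y; have [_ homp _ _ _] := exY.
  apply: zeroF; exists T, F', i, p; split=> // y.
  have [z /ex[x ->]|h [homh hE]] := hom_factor homg homp surg.
    by rewrite -comp_lfunE (homCF _ _ _ CX FF (hom_comp homp homf)) zero_lfunE.
  by rewrite -hE (homCF _ _ _ CZ FF homh) zero_lfunE.
exists (perp C); split.
- split=> [M N|||M N CMN].
  + exact: tors_iso.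
  + by case: torsC.
  + by move=> M N; apply: tors_sum.
  have [p [homp pE]] := sum_proj1 M N; have [q [homq qE]] := sum_proj2 M N.
  split; [apply: tors_quot homp _ CMN | apply: tors_quot homq _ CMN] => // z.
    by exists (z, 0); rewrite pE.
  by exists (0, z); rewrite qE.
- split=> [M N|X h _ _ x|M N pM pN X h CX homh x|M N pMN].
  + case/mod_isoP => f [g [homf homg fK gK]] pM.
    by apply: perp_sub homg _ pM => y gy; rewrite -(gK y) gy lf0.
  + by rewrite [LHS]thinmx0 [RHS]thinmx0.
  + have [p [homp pE]] := sum_proj1 M N; have [q [homq qE]] := sum_proj2 M N.
    apply: injective_projections => /=.
      by rewrite -pE -comp_lfunE (pM X) //; apply: hom_comp.
    by rewrite -qE -comp_lfunE (pN X) //; apply: hom_comp.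

  have [p [homp pE]] := sum_inj1 M N; have [q [homq qE]] := sum_inj2 M N.
  split; [apply: perp_sub homp _ pMN | apply: perp_sub homq _ pMN] => z.
    by rewrite pE => -[].
  by rewrite qE => -[].
- by move=> X Y f CX pY homf; apply/lfunP => x; rewrite zero_lfunE (pY X).
by move=> X; have [T [F [i [p [CT pF ex]]]]] := torsion_seq X torsC; exists T, F, i, p.
Qed.

(** Functorial finiteness of a torsion class amounts to generation by one of
    its objects. Right approximations are torsion submodules. Left
    approximations are obtained from an element v of an object of C that is
    mapped to any given element of any object of C: it is a left approximation
    of the regular module, and the other modules have push-outs of its powers. *)
Definition generated_by X Y : Prop :=
  forall y : Y, exists n (h : 'I_n -> 'Hom(X, Y)) (x : 'I_n -> X),
    (forall i, is_hom (h i)) /\ y = \sum_i h i (x i).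

(** With d the dimension of X, take the power X^d and the family of the basis
    vectors of X. *)
Lemma universal_element C X : tors C -> C X -> (forall Y, C Y -> generated_by X Y) ->
  exists X' (v : X'), C X' /\
    forall Y (y : Y), C Y -> exists h : 'Hom(X', Y), is_hom h /\ h v = y.
Proof.
move=> torsC CX genX; pose b := vbasis {:X}; pose d := \dim {:X}.
exists (pow_mod d X), [ffun i => b`_(i : 'I_d)]; split; first exact: tors_pow.
move=> Y y CY; have [n [h [x [homh ->]]]] := genX Y CY y.
pose g (i : 'I_d) := \sum_(j < n) (coord b i (x j) : k) *: h j.
have homg i : is_hom (g i) by apply: hom_sum => j; apply: hom_scale.
have [H [homH HE]] := pow_copair homg; exists H; split=> //.
rewrite HE; transitivity (\sum_(i < d) \sum_(j < n) (coord b i (x j) : k) *: h j b`_i).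
  by apply: eq_bigr => i _; rewrite ffunE sum_lfunE; apply: eq_bigr => j _; rewrite scale_lfunE.
rewrite exchange_big; apply: eq_bigr => j _ /=.
rewrite {2}(coord_vbasis (memvf (x j))) lf_sum; apply: eq_bigr => i _.
by rewrite lfZ.
Qed.

(** If M is generated by m_1, .., m_d, the approximation maps the m_i to the
    images of the copies of v in the quotient of X^d by the relations between
    the m_i. *)
Lemma left_approx_of_universal C X (v : X) M : tors C -> C X ->
    (forall Y (y : Y), C Y -> exists h : 'Hom(X, Y), is_hom h /\ h v = y) ->
  exists X' (f : 'Hom(M, X')), is_left_approx C f.
Proof.
move=> torsC CX univ; pose d := \dim {:M}; pose m (i : 'I_d) := (vbasis {:M})`_i.
pose comb (l : 'I_d -> A) : M := \sum_i m i ** l i.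
pose vec (l : 'I_d -> A) : pow_mod d X := [ffun i => v ** l i].
pose Rel (z : pow_mod d X) := exists2 l, z = vec l & comb l = 0.
have combL (c : k) l l' : comb (fun i => c *: l i + l' i) = c *: comb l + comb l'.
  rewrite /comb scaler_sumr -big_split; apply: eq_bigr => i _.
  by rewrite ractDr ractZr.
have vecL (c : k) l l' : vec (fun i => c *: l i + l' i) = c *: vec l + vec l'.
  by apply/ffunP => i; rewrite !ffunE ractDr ractZr.
have combM l a : comb (fun i => l i * a) = comb l ** a.
  by rewrite /comb ract_suml; apply: eq_bigr => i _; rewrite ractM.
have vecM l a : vec (fun i => l i * a) = vec l ** a.
  by apply/ffunP => i; rewrite !ffunE ractM.
have subRel : is_sub Rel.
  split; first split.
  - exists (fun=> 0); first by apply/ffunP => i; rewrite !ffunE ract0r.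
    by rewrite /comb big1 // => i _; rewrite ract0r.
  - move=> c _ _ [l -> l0] [l' -> l'0]; exists (fun i => c *: l i + l' i) => //.
    by rewrite combL l0 l'0 scaler0 addr0.
  move=> _ a [l -> l0]; exists (fun i => l i * a) => //.
  by rewrite combM l0 ract0l.
have [Q [p [homp surp kerp]]] := quotient_exists subRel.
have CQ : C Q by apply: tors_quot surp _ => //; apply: tors_pow.
have totM x : exists l, x = comb l.
  exists (fun i => (coord (vbasis {:M}) i x)%:A).
  rewrite {1}(coord_vbasis (memvf x)); apply: eq_bigr => i _.
  by rewrite ractZr ract1.
have [||||f [homf fE]] := @hom_of_rel _ _ M Q (fun x y => exists2 l, x = comb l & y = p (vec l)).
- move=> c _ _ _ _ [l -> ->] [l' -> ->].
  by exists (fun i => c *: l i + l' i); rewrite ?combL ?vecL ?lfL.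
- by move=> _ _ a [l -> ->]; exists (fun i => l i * a); rewrite ?combM ?vecM ?homp.
- by move=> x; have [l ->] := totM x; exists (p (vec l)), l.
- by move=> _ [l /esym l0 ->]; apply/kerp; exists l.
exists Q, f; split=> // Y g CY homg.
have /choice[h hP] : forall i : 'I_d, exists h : 'Hom(X, Y), is_hom h /\ h v = g (m i).
  by move=> i; apply: univ.
have [|H [homH HE]] := @pow_copair _ _ d X Y h; first by move=> i; case: (hP i).
have Hvec l : H (vec l) = g (comb l).
  rewrite HE lf_sum; apply: eq_bigr => i _; have [homhi hiv] := hP i.
  by rewrite ffunE homhi homg hiv.
have [_ /kerp[l -> l0]|h' [homh' h'E]] := hom_factor homp homH surp.
  by rewrite Hvec l0 lf0.
exists h'; split=> //; apply/lfunP => x; rewrite comp_lfunE.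
have [l xl] := totM x; rewrite -(fE x (p (vec l))) ?h'E ?Hvec -?xl //.
by exists l.
Qed.

Lemma functorially_finiteP C : tors C ->
  (functorially_finite C <->
   exists X, C X /\ forall Y, C Y -> generated_by X Y).
Proof.
move=> torsC; split=> [ffC|[X [CX genX]] M].
  have [[X [f [CX homf univ]]] _] := ffC (regular_mod A).
  exists X; split=> // Y CY y; have [g [homg gE]] := hom_from_regular y.
  have [h [homh gh]] := univ Y g CY homg.
  exists 1%N, (fun=> h), (fun=> f (1 : A)); split=> //.
  by rewrite big_ord1 -comp_lfunE -gh gE ract1.
split.
  have [X' [v [CX' univ]]] := universal_element torsC CX genX.
  exact: left_approx_of_universal torsC CX' univ.
have [T [F [i [p [CT pF /short_exactP[homi homp inji ex _]]]]]] := torsion_seq M torsC.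
exists T, i; split=> // Y g CY homg.
have [y|h [homh hE]] := hom_lift homi homg inji.
  by apply/ex; rewrite -comp_lfunE; apply: pF => //; apply: hom_comp.
by exists h; split=> //; apply/lfunP => y; rewrite comp_lfunE hE.
Qed.

End Torsion.

(** * Modules over a quotient division ring *)

Section Killed.
Variables (k : fieldType) (A : falgType k).
Implicit Types M N X Y Z T F Q K : rmod A.
Implicit Type C : rmod A -> Prop.

Lemma max_vspace M (P : {vspace M} -> Prop) U0 : P U0 ->
  exists2 U, P U & forall U', P U' -> (U <= U')%VS -> U' = U.
Proof.
move=> PU0; pose D n := exists2 U, P U & \dim U = n.
have [||_ [U PU <-] Umax] := @bounded_has_max D (\dim U0) (\dim {:M}).
- by exists U0.
- by move=> _ [U _ <-]; apply/dimvS/subvf.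
exists U => // U' PU' leUU'; apply/esym/eqP; rewrite eqEdim leUU' /=.
by apply: Umax; exists U'.
Qed.

Lemma submodule_adjoin M (U : {vspace M}) (n : M) : is_submodule U ->
  exists U' : {vspace M}, is_submodule U' /\
    forall x, x \in U' <-> exists u a, u \in U /\ x = u + n ** a.
Proof.
move=> subU.
have [|U' U'P] := @vspace_of_pred _ _ (fun x => exists u a, u \in U /\ x = u + n ** a).
  split; first by exists 0, 0; rewrite mem0v ract0r addr0.
  move=> c _ _ [u [a [uU ->]]] [u' [a' [u'U ->]]].
  exists (c *: u + u'), (c *: a + a'); rewrite memvD ?memvZ //; split=> //.
  by rewrite ractDr ractZr scalerDr addrACA.
exists U'; split=> // x b /U'P[u [a [uU ->]]]; apply/U'P.
by exists (u ** b), (a * b); rewrite ractDl ractM; split=> //; apply: subU.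
Qed.

Variable I : A -> Prop.
Hypothesis divI : forall a, I a \/ exists b, I (a * b - 1).

(** When I is a two-sided ideal the hypothesis says that A / I is a division
    ring, and these are the modules over it. *)
Definition killed M : Prop := forall (x : M) a, I a -> x ** a = 0.

Lemma killed_act M (x : M) a : killed M -> x ** a = 0 \/ exists b, x ** a ** b = x.
Proof.
move=> kM; have [/kM|[b /kM xb]] := divI a; first by left.
right; exists b; apply/eqP; rewrite -subr_eq0 -ractM; apply/eqP.
by rewrite -(xb x) ractBr ract1.
Qed.

(** If U is a submodule maximal among those avoiding m, then M / U is simple
    and generated by m, and the annihilator of m modulo U is exactly I; so m
    may be sent anywhere. *)
Lemma killed_hom M Q (m : M) (q : Q) : killed M -> killed Q -> m != 0 ->
  exists h : 'Hom(M, Q), is_hom h /\ h m = q.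
Proof.
move=> kM kQ m0.
have [|U [subU mU] maxU] := @max_vspace M (fun U => is_submodule U /\ m \notin U) 0%VS.
  by split; [move=> x a; rewrite !memv0 => /eqP->; rewrite ract0l|rewrite memv0].
have genU n : exists u a, u \in U /\ n = u + m ** a.
  have [nU|/negP nU] := pselect (n \in U).
    by exists n, 0; rewrite ract0r addr0.
  have [U' [subU' U'P]] := submodule_adjoin n subU.
  have [mU'|/negP mU'] := pselect (m \in U'); last first.
    case/negP: nU; rewrite -(maxU U'); first apply/U'P; first by exists 0, 1; rewrite mem0v ract1 add0r.
    - by split.
    by apply/subvP => x xU; apply/U'P; exists x, 0; rewrite ract0r addr0.
  have /U'P[u [a [uU mE]]] := mU'.
  have [na0|[b nab]] := killed_act n a kM.
    by move: mU; rewrite mE na0 addr0 uU.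
  exists (- u ** b), b; rewrite ractNl memvN subU //; split=> //.
  by rewrite mE ractDl nab addKr.
have annU a : m ** a \in U -> I a.
  move=> maU; have [//|[b ab1]] := divI a.
  case/negP: mU; have := subU _ b maU.
  by rewrite -ractM -[a * b](subrK 1) ractDr ract1 kM // add0r.
have [||||h [homh hE]] := @hom_of_rel _ _ M Q
    (fun n y => exists u a, [/\ u \in U, n = u + m ** a & y = q ** a]).
- move=> c _ _ _ _ [u [a [uU -> ->]]] [u' [a' [u'U -> ->]]].
  exists (c *: u + u'), (c *: a + a'); rewrite memvD ?memvZ //; split=> //.
    by rewrite ractDr ractZr scalerDr addrACA.
  by rewrite ractDr ractZr.
- move=> _ _ b [u [a [uU -> ->]]]; exists (u ** b), (a * b).
  by rewrite ractDl !ractM subU.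
- by move=> n; have [u [a [uU nE]]] := genU n; exists (q ** a), u, a.
- move=> _ [u [a [uU /esym/eqP + ->]]]; rewrite addr_eq0 => /eqP uE.
  by apply/kQ/annU; rewrite -memvN -uE.
exists h; split=> //; apply/esym/hE; exists 0, 1.
by rewrite mem0v add0r !ract1.
Qed.

(** All the nonzero modules killed by I have the same simple quotients and
    submodules. *)
Lemma killed_dichotomy C M Q (m : M) :
  tors C -> C M -> killed M -> m != 0 -> killed Q -> C Q.
Proof.
move=> torsC CM kM m0 kQ; apply: tors_perp => // Y h pY homh q.
have [g [homg gm]] := killed_hom q kM kQ m0.
by rewrite -gm -comp_lfunE; apply: pY CM (hom_comp homh homg) _.
Qed.

(** Semisimplicity: a submodule maximal among those meeting K trivially is a
    complement, because each cyclic submodule generated by n is generated by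
    any of its nonzero elements n a. *)
Lemma killed_retraction K M (i : 'Hom(K, M)) : killed M -> is_hom i ->
    (forall x, i x = 0 -> x = 0) ->
  exists r : 'Hom(M, K), is_hom r /\ forall x, r (i x) = x.
Proof.
move=> kM homi inji.
have [|U [subU capU] maxU] := @max_vspace M
    (fun U => is_submodule U /\ forall x, i x \in U -> x = 0) 0%VS.
  split=> [x a|x]; rewrite !memv0; first by move=> /eqP->; rewrite ract0l.
  by move=> /eqP/inji.
have genU n : exists x, n - i x \in U.
  apply: contrapT => /forallNP noU.
  have [U' [subU' U'P]] := submodule_adjoin n subU.
  case: (noU 0); rewrite lf0 subr0 -(maxU U').
  - by apply/U'P; exists 0, 1; rewrite mem0v ract1 add0r.
  - split=> // x /U'P[u [a [uU ixE]]].
    have [na0|[b nab]] := killed_act n a kM.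
      by apply: capU; rewrite ixE na0 addr0.
    case: (noU (x ** b)); rewrite homi ixE ractDl nab opprD addrCA subrr addr0.
    by rewrite memvN subU.
  by apply/subvP => x xU; apply/U'P; exists x, 0; rewrite ract0r addr0.
have [||||r [homr rE]] := @hom_of_rel _ _ M K (fun n x => n - i x \in U).
- move=> c n x n' x' nx nx'; rewrite lfL opprD addrACA -scalerBr.
  by rewrite memvD ?memvZ.
- by move=> n x a; rewrite homi -ractBl => /subU.
- exact: genU.
- by move=> x; rewrite sub0r memvN => /capU.
by exists r; split=> // x; apply/esym/rE; rewrite subrr mem0v.
Qed.

End Killed.

(** * Finite sums of elements of a given shape *)

Section Span.
Variables (k : fieldType) (A : falgType k).
Implicit Types M N X Y Z T F Q K : rmod A.

Inductive spanned M (S : M -> Prop) : M -> Prop :=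
| spanned0 : spanned S 0
| spannedD (c : k) x y : S x -> spanned S y -> spanned S (c *: x + y).

Lemma spanned_gen M (S : M -> Prop) x : S x -> spanned S x.
Proof. by move=> Sx; rewrite -[x]addr0 -[x]scale1r; apply/spannedD/spanned0. Qed.

Lemma spanned_add M (S : M -> Prop) x y : spanned S x -> spanned S y -> spanned S (x + y).
Proof.
elim=> [|c x' y' Sx' _ IH] Sy; first by rewrite add0r.
by rewrite -addrA; apply: spannedD => //; apply: IH.
Qed.

Lemma spanned_scale M (S : M -> Prop) c x : spanned S x -> spanned S (c *: x).
Proof.
elim=> [|c' x' y' Sx' _ IH]; first by rewrite scaler0; apply: spanned0.
by rewrite scalerDr scalerA; apply: spannedD.
Qed.

Lemma sub_spanned M (S : M -> Prop) :
  (forall x a, S x -> S (x ** a)) -> is_sub (spanned S).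
Proof.
move=> actS; split.
  split=> [|c x y Sx Sy]; first exact: spanned0.
  exact/spanned_add/Sy/spanned_scale.
move=> x a; elim=> [|c x' y' Sx' _ IH]; first by rewrite ract0l; apply: spanned0.
by rewrite ractDl ractZl; apply: spannedD => //; apply: actS.
Qed.

(** Spanning families can be tested after an injective map. *)
Lemma spanned_lift X Z (i : 'Hom(Z, X)) (S : X -> Prop) (S' : Z -> Prop) :
    (forall z, i z = 0 -> z = 0) -> (forall z, spanned S (i z)) ->
    (forall x, S x -> exists2 z, i z = x & spanned S' z) ->
  forall z, spanned S' z.
Proof.
move=> inji imi genS z; suff [z' iz' genz'] : exists2 z', i z' = i z & spanned S' z'.
  suff <- : z' = z by [].
  by apply/eqP; rewrite -subr_eq0; apply/eqP/inji; rewrite lfB iz' subrr.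
elim: {z}(i z) / (imi z) => [|d x w /genS[z <- genz] _ [z' <- genz']].
  by exists 0; [rewrite lf0 | apply: spanned0].
by exists (d *: z + z'); [rewrite lfL | apply/spanned_add/genz'/spanned_scale].
Qed.

Lemma spanned_hom M N (f : 'Hom(M, N)) (S : M -> Prop) (S' : N -> Prop) :
  (forall x, S x -> S' (f x)) -> forall x, spanned S x -> spanned S' (f x).
Proof.
move=> SS' x; elim=> [|c y z Sy _ IH]; first by rewrite lf0; apply: spanned0.
by rewrite lfL; apply: spannedD => //; apply: SS'.
Qed.

Lemma generated_by_spanned X Y :
  (forall y, spanned (fun y : Y => exists (h : 'Hom(X, Y)) x, is_hom h /\ y = h x) y) ->
  generated_by X Y.
Proof.
move=> sp y; elim: (sp y) => [|d _ z [h [x [homh ->]]] _ [n [hs [xs [homhs ->]]]]].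
  by exists 0%N, (fun=> 0), (fun=> 0); rewrite big_ord0; split=> [[]|].
exists n.+1, (fun i => if unlift ord0 i is Some j then hs j else d *: h),
  (fun i => if unlift ord0 i is Some j then xs j else x); split.
  by move=> i; case: (unlift ord0 i) => // ; apply: hom_scale.
rewrite big_ord_recl unlift_none scale_lfunE; congr (_ + _).
by apply: eq_bigr => i _; rewrite liftK.
Qed.

Lemma spanned_image X Y (h : 'Hom(X, Y)) x : is_hom h ->
  spanned (fun y : Y => exists (h : 'Hom(X, Y)) x, is_hom h /\ y = h x) (h x).
Proof. by move=> homh; apply: spanned_gen; exists h, x. Qed.

End Span.

(** * The Lambda side of an APR tilt *)

(** The submodule M a A, the trace in M of the projective module aA. *)
Definition a_gen (k : fieldType) (A : falgType k) (a : A) (M : rmod A) : M -> Prop :=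
  spanned (fun x => exists (m : M) l, x = m ** (a * l)).
Arguments a_gen {k A} a {M}.

Definition a_generated (k : fieldType) (A : falgType k) (a : A) (M : rmod A) : Prop :=
  forall x : M, a_gen a x.

(** The data of a 1-APR tilt in terms of elements. The algebra is eA + aA with
    eA simple and eAa = 0. In the almost split sequence 0 -> eA -> E -> P' ->
    0 the first map sends e to x0; the second one, followed by the inclusion
    of P' in T, is pi. The module T is the direct sum of P' and of the copy r0
    A of aA, and c is the projection of T to aA. The last three fields say
    that the maps from eA to aA extend to E, that Hom(P', A) = 0, which is
    where injective dimension at most 1 enters, and that E is torsionless. *)
Record apr_data (k : fieldType) (A : falgType k) (T E : rmod A) (e a : A)
    (x0 : E) (r0 : T) (pi : 'Hom(E, T)) (c : 'Hom(T, regular_mod A)) : Prop := AprData {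
  apr_ea : e + a = 1;
  apr_ee : e * e = e;
  apr_eAa : forall l, e * l * a = 0;
  apr_simple : forall l, e * l != 0 -> exists m, e * l * m = e;
  apr_homc : is_hom c;
  apr_r0 : r0 ** a = r0;
  apr_cr0 : c r0 = a;
  apr_ac : forall t, a * (c t : A) = c t;
  apr_hompi : is_hom pi;
  apr_cpi : forall t, c t = 0 <-> exists y, t = pi y;
  apr_kerpi : forall y, pi y = 0 <-> exists l, y = x0 ** l;
  apr_x0e : x0 ** e = x0;
  apr_x0 : x0 != 0;
  apr_proj : is_projective E;
  apr_gen : a_generated a E;
  apr_extend : forall l, exists v : 'Hom(E, regular_mod A),
    is_hom v /\ v x0 = a * l * e :> A;
  apr_vanish : forall h : 'Hom(E, regular_mod A), is_hom h -> h x0 = 0 -> forall y, h y = 0;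
  apr_separate : forall y, (forall h : 'Hom(E, regular_mod A), is_hom h -> h y = 0) -> y = 0
}.

Section LambdaSide.
Variables (k : fieldType) (A : falgType k) (T E : rmod A) (e a : A).
Variables (x0 : E) (r0 : T) (pi : 'Hom(E, T)) (c : 'Hom(T, regular_mod A)).
Hypothesis apr : apr_data e a x0 r0 pi c.
Implicit Types M N X Y Z F Q K : rmod A.

Let ea : e + a = 1 := apr_ea apr.
Let ee : e * e = e := apr_ee apr.
Let homc : is_hom c := apr_homc apr.
Let hompi : is_hom pi := apr_hompi apr.

Let aE : a = 1 - e. Proof. by rewrite -ea addrAC subrr add0r. Qed.

Lemma apr_ae : a * e = 0.
Proof. by rewrite aE mulrBl mul1r ee subrr. Qed.
Lemma apr_aa : a * a = a.
Proof. by rewrite {2}aE mulrBr mulr1 apr_ae subr0. Qed.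
Lemma apr_la l : l * a = a * l * a.
Proof. by rewrite -{1}(mul1r l) -ea !mulrDl (apr_eAa apr) add0r. Qed.
Lemma ract_ea M (x : M) : x = x ** e + x ** a.
Proof. by rewrite -ractDr ea ract1. Qed.
Lemma ract_la M (x : M) l : x ** l ** a = x ** a ** l ** a.
Proof. by rewrite -!ractM mulrA -apr_la. Qed.

Lemma sub_a_gen M : is_sub (@a_gen k A a M).
Proof.
by apply: sub_spanned => _ l [m [l' ->]]; exists m, (l' * l); rewrite -ractM mulrA.
Qed.

Lemma a_gen_act M (x : M) : a_gen a (x ** a).
Proof. by apply: spanned_gen; exists x, 1; rewrite mulr1. Qed.

Lemma a_gen_hom M N (f : 'Hom(M, N)) (x : M) : is_hom f -> a_gen a x -> a_gen a (f x).
Proof.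
by move=> homf; apply: spanned_hom => _ [m [l ->]]; exists (f m), l; rewrite homf.
Qed.

Lemma a_generated_quot M N (p : 'Hom(M, N)) :
  is_hom p -> (forall y, exists x, p x = y) -> a_generated a M -> a_generated a N.
Proof. by move=> homp surp genM y; have [x <-] := surp y; apply: a_gen_hom. Qed.

Lemma a_generated_zero M : a_generated a M -> (forall x : M, x ** a = 0) ->
  forall x : M, x = 0.
Proof.
move=> genM Ma x; elim: (genM x) => // d _ y [m [l ->]] _ ->.
by rewrite ractM Ma ract0l scaler0 addr0.
Qed.

Lemma hom_eq_gen M N (f g : 'Hom(M, N)) : is_hom f -> is_hom g -> a_generated a M ->
  (forall x, f (x ** a) = g (x ** a)) -> forall x, f x = g x.
Proof.
move=> homf homg genM fg x; elim: (genM x) => [|d _ y [m [l ->]] _ fgy].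
  by rewrite !lf0.
by rewrite !lfL fgy !ractM homf homg fg.
Qed.

(** The maps from eA to aA extend to E, hence so do the maps from eA to the
    modules generated by aA: they are sums of maps that factor through aA. *)
Lemma extend_from_x0 M (m : M) : a_gen a m -> exists h : 'Hom(E, M), is_hom h /\ h x0 = m ** e.
Proof.
elim=> [|d _ y [n [l ->]] _ [h [homh hE]]].
  by exists 0; split; [apply: hom_0 | rewrite zero_lfunE ract0l].
have [v [homv vE]] := apr_extend apr l; have [g [homg gE]] := hom_from_regular n.
exists (d *: (g \o v)%VF + h); split; first exact/hom_add/homh/hom_scale/hom_comp.
by rewrite add_lfunE scale_lfunE comp_lfunE hE vE gE ractDl ractZl ractM.
Qed.

(** The homomorphism that is zero on P' and sends the generator r0 of the
    other summand of T to m a. *)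
Definition brk M (m : M) : 'Hom(T, M) :=
  ((linfun (ract m : A -> M) : 'Hom(regular_mod A, M)) \o c)%VF.

Lemma brkE M (m : M) t : brk m t = m ** c t.
Proof. by rewrite comp_lfunE lfunE. Qed.
Lemma hom_brk M (m : M) : is_hom (brk m).
Proof. by move=> t l; rewrite !brkE homc -ractM. Qed.
Lemma T_decompose t : exists y, t = r0 ** c t + pi y.
Proof.
have [|y yE] := proj1 (apr_cpi apr (t - r0 ** c t)).
  by rewrite lfB homc (apr_cr0 apr) /= (apr_ac apr) subrr.
by exists y; rewrite -yE addrC subrK.
Qed.

Lemma T_hom_eq M (f g : 'Hom(T, M)) : is_hom f -> is_hom g ->
  f r0 = g r0 -> (forall y, f (pi y) = g (pi y)) -> forall t, f t = g t.
Proof.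
move=> homf homg fg0 fgpi t; have [y tE] := T_decompose t.
by rewrite tE !lfD homf homg fg0 fgpi.
Qed.

(** A homomorphism from T is given by an element of M a, the image of r0, and
    by a homomorphism from E that vanishes on eA. *)
Lemma T_hom_exists M (m : M) (g : 'Hom(E, M)) : m ** a = m -> is_hom g -> g x0 = 0 ->
  exists f : 'Hom(T, M), [/\ is_hom f, f r0 = m & forall y, f (pi y) = g y].
Proof.
move=> ma homg g0.
have [||||f [homf fE]] := @hom_of_rel _ _ T M
    (fun t z => exists l y, t = r0 ** l + pi y /\ z = m ** l + g y).
- move=> d _ _ _ _ [l [y [-> ->]]] [l' [y' [-> ->]]].
  exists (d *: l + l'), (d *: y + y').
  by split; rewrite lfL ractDr ractZr scalerDr addrACA.
- move=> _ _ b [l [y [-> ->]]]; exists (l * b), (y ** b).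
  by rewrite hompi homg !ractDl !ractM.
- move=> t; have [y tE] := T_decompose t.
  by exists (m ** c t + g y), (c t), y.
- move=> _ [l [y [/esym rl0 ->]]].
  have al0 : a * l = 0.
    have := congr1 c rl0; rewrite lfD homc (apr_cr0 apr) lf0.
    by rewrite (_ : c (pi y) = 0) ?addr0 //; apply/(apr_cpi apr); exists y.
  have ml0 : m ** l = 0 by rewrite -ma -ractM al0 ract0r.
  have : pi y = 0 by rewrite -rl0 -(apr_r0 apr) -ractM al0 ract0r add0r.
  by case/(apr_kerpi apr) => l' ->; rewrite ml0 homg g0 ract0l addr0.
exists f; split=> // [|y]; apply/esym/fE.
  by exists 1, 0; rewrite !lf0 !ract1 !addr0.
by exists 0, y; rewrite !ract0r !add0r.
Qed.

Lemma T_gen : a_generated a T.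
Proof.
move=> t; have [y ->] := T_decompose t; apply: subD; first exact: sub_a_gen.
  by rewrite -(apr_ac apr); apply: spanned_gen; exists r0, (c t).
exact/a_gen_hom/(apr_gen apr).
Qed.

(** This is the vanishing of Ext^1(T, K): on the copy of aA a map lifts
    freely, and on P' a lift to E is corrected so that it vanishes at x0. *)
Lemma T_lift X Q K (i : 'Hom(K, X)) (q : 'Hom(X, Q)) (f : 'Hom(T, Q)) :
    is_hom i -> is_hom q -> (forall y, exists x, q x = y) ->
    (forall x, q x = 0 <-> exists z, x = i z) -> a_generated a K -> is_hom f ->
  exists f' : 'Hom(T, X), is_hom f' /\ forall t, q (f' t) = f t.
Proof.
move=> homi homq surq kerq genK homf.
have [x qx] := surq (f r0).
have fpi : is_hom (f \o pi)%VF by apply: hom_comp.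
have [g [homg /lfunP gE]] := apr_proj apr homq (proj2 (limg_fullP q) surq) fpi.
have pix0 : pi x0 = 0 by apply/(apr_kerpi apr); exists 1; rewrite ract1.
have [z zE] : exists z, g x0 = i z.
  by apply/kerq; have := gE x0; rewrite !comp_lfunE pix0 lf0.
have [h [homh hE]] := extend_from_x0 (genK z).
have [|||f' [homf' f'r f'pi]] := @T_hom_exists X (x ** a) (g - (i \o h)%VF).
- by rewrite -ractM apr_aa.
- exact/hom_sub/hom_comp.
- rewrite add_lfunE opp_lfunE comp_lfunE hE homi -zE -homg.
  by rewrite (apr_x0e apr) subrr.
exists f'; split=> // t; rewrite -comp_lfunE; apply: T_hom_eq => // [|/=|y].
- exact: hom_comp.
- by rewrite comp_lfunE f'r homq qx -homf (apr_r0 apr).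
rewrite comp_lfunE f'pi add_lfunE opp_lfunE lfB comp_lfunE.
rewrite (_ : q (i _) = 0) ?subr0; last by apply/kerq; exists (h y).
by have := gE y; rewrite !comp_lfunE.
Qed.

(** The kernel is a sum of copies of eA. A map from eA to it extends to a map
    E -> X, which induces a map from P' to Q; if the latter lifts, the lift
    agrees with the extension on E, since there is no map from E to the
    kernel, and so it vanishes at x0. In other words 0 -> eA -> E -> P' -> 0
    does not split and Ext^1(T, eA) is not zero. *)
Lemma T_lift_inj X Q (q : 'Hom(X, Q)) :
    is_hom q -> a_generated a X -> (forall x, q x = 0 -> x ** a = 0) ->
    (forall f : 'Hom(T, Q), is_hom f ->
       exists f' : 'Hom(T, X), is_hom f' /\ forall t, q (f' t) = f t) ->
  forall x, q x = 0 -> x = 0.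
Proof.
move=> homq genX kera liftq x qx.
have xe : x ** e = x by rewrite {2}(ract_ea x) (kera _ qx) addr0.
have [h [homh hx0]] := extend_from_x0 (genX x).
have pix0 : pi x0 = 0 by apply/(apr_kerpi apr); exists 1; rewrite ract1.
have [|||f [homf fr fpi]] := @T_hom_exists Q 0 (q \o h)%VF; rewrite ?ract0l //.
- exact: hom_comp.
- by rewrite comp_lfunE hx0 xe.
have [f' [homf' f'E]] := liftq f homf.
rewrite -xe -hx0 -(@lf0 _ _ _ f') -pix0 -comp_lfunE.
apply: (hom_eq_gen homh (hom_comp homf' hompi) (apr_gen apr)) => y.
have := @kera (h y - f' (pi y)); rewrite lfB f'E fpi comp_lfunE subrr.
move/(_ erefl)/eqP; rewrite ractBl subr_eq0 -homh -homf' -hompi => /eqP->.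
by rewrite comp_lfunE.
Qed.

End LambdaSide.

(** * The functor Hom(T, -) to modules over the endomorphism algebra *)

Section HomFunctor.
Variables (k : fieldType) (A B : falgType k) (T : rmod A) (phi : 'Hom(B, 'End(T))).
Hypothesis phi_inj : lker phi = 0%VS.
Hypothesis phi_im : limg phi = homs T T.
Hypothesis phi_1 : phi 1 = \1%VF.
Hypothesis phi_M : forall b b', phi (b * b') = (phi b \o phi b')%VF.
Implicit Types M Y : rmod A.

Lemma hom_phi b : is_hom (phi b).
Proof. by apply/homsP; rewrite -phi_im; apply/memv_img/memvf. Qed.

Definition bend (f : 'End(T)) : B := (phi^-1)%VF f.

Lemma phi_bend f : is_hom f -> phi (bend f) = f.
Proof. by move=> homf; rewrite limg_lfunVK // phi_im; apply/homsP. Qed.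

Lemma phi_eq b b' : (forall t, phi b t = phi b' t) -> b = b'.
Proof. by move=> eqbb'; have /eqP/lker0P inj := phi_inj; apply/inj/lfunP. Qed.

Definition hom_act M (f : subvs_of (homs T M)) (b : B) : subvs_of (homs T M) :=
  vsproj (homs T M) (vsval f \o phi b)%VF.

Lemma hom_actE M (f : subvs_of (homs T M)) b : vsval (hom_act f b) = (vsval f \o phi b)%VF.
Proof.
rewrite vsprojK //; apply/homsP/hom_comp; last exact: hom_phi.
exact/homsP/subvsP.
Qed.

Definition hom_mod M : rmod B.
Proof.
apply: (@RMod k B (subvs_of (homs T M)) (@hom_act M)).
- by move=> b d f g; apply/val_inj; rewrite /= !hom_actE comp_lfunDl comp_lfunZl.
- move=> f d b b'; apply/val_inj; rewrite /= !hom_actE lfL.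
  by rewrite comp_lfunDr comp_lfunZr.
- by move=> f; apply/val_inj; rewrite /= hom_actE phi_1 comp_lfun1r.
- by move=> f b b'; apply/val_inj; rewrite /= !hom_actE phi_M comp_lfunA.
Defined.

Definition hval M (f : hom_mod M) : 'Hom(T, M) := vsval (f : subvs_of (homs T M)).

Lemma hom_hval M (f : hom_mod M) : is_hom (hval f).
Proof. exact/homsP/subvsP. Qed.
Lemma hval_act M (f : hom_mod M) b t : hval (f ** b) t = hval f (phi b t).
Proof. by rewrite /hval hom_actE comp_lfunE. Qed.
Lemma hval_eq M (f g : hom_mod M) : (forall t, hval f t = hval g t) -> f = g.
Proof. by move=> /lfunP fg; apply: val_inj. Qed.
Lemma hvalL M (d : k) (f g : hom_mod M) t : hval (d *: f + g) t = d *: hval f t + hval g t.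
Proof. by rewrite /hval linearP /= add_lfunE scale_lfunE. Qed.
Lemma hval0 M t : hval (0 : hom_mod M) t = 0.
Proof. by rewrite /hval linear0 zero_lfunE. Qed.
Lemma hvalD M (f g : hom_mod M) t : hval (f + g) t = hval f t + hval g t.
Proof. by rewrite -[f]scale1r hvalL !scale1r. Qed.
Lemma hval_sum M n (f : 'I_n -> hom_mod M) t :
  hval (\sum_i f i) t = \sum_i hval (f i) t.
Proof.
elim/big_rec2: _ => [|i y f' _ <-]; first exact: hval0.
exact: hvalD.
Qed.

Lemma hval_exists M (f : 'Hom(T, M)) : is_hom f -> exists g : hom_mod M, hval g = f.
Proof.
move=> /homsP fh; exists (Subvs fh); by [].
Qed.

Lemma hom_mod_map M Y (h : 'Hom(M, Y)) : is_hom h ->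
  exists H : 'Hom(hom_mod M, hom_mod Y), is_hom H /\ forall f t, hval (H f) t = h (hval f t).
Proof.
move=> homh.
have /choice[H HE] : forall f : hom_mod M, exists g : hom_mod Y, forall t, hval g t = h (hval f t).
  move=> f; have [g gE] := hval_exists (hom_comp homh (hom_hval f)).
  by exists g => t; rewrite gE comp_lfunE.
have [||G [homG GE]] := @hom_of_fun k B (hom_mod M) (hom_mod Y) H.
- by move=> d f g; apply: hval_eq => t; rewrite hvalL !HE hvalL lfL.
- by move=> f b; apply: hval_eq => t; rewrite hval_act !HE hval_act.
by exists G; split=> // f t; rewrite GE.
Qed.

End HomFunctor.

(** * Comparing modules over Lambda and over Gamma *)

(* Simplification would otherwise unfold the action on Hom(T, M). *)
Arguments ract : simpl never.
Arguments rmod_sort : simpl never.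

Definition sub_poset (Z : poset) (Q : Z -> Prop) : poset.
Proof.
apply: (@Poset {z : Z | Q z} (fun x y => ple (proj1_sig x) (proj1_sig y))) => [x|x y z|[x Qx] [y Qy] /=].
- exact: ple_refl.
- exact: ple_trans.
by move=> le1 le2; apply: eq_exist; apply: ple_anti.
Defined.

Lemma poset_iso_of_embedding (Z Z' : poset) (h : Z' -> Z) :
    (forall x y, ple x y <-> ple (h x) (h y)) -> (forall z, exists x, h x = z) ->
  poset_iso Z Z'.
Proof.
move=> hP /choice[g gK].
have hinj x y : h x = h y -> x = y.
  by move=> hxy; apply: ple_anti; apply/hP; rewrite hxy; apply: ple_refl.
exists g; split; first by exists h => x; [apply: gK | apply/hinj/gK].
by move=> x y; rewrite hP !gK.
Qed.

Lemma fftors_tors (k : fieldType) (A : falgType k) (C : fftors A) : tors C.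
Proof. by apply/torsion_classP; case: (fftorsP C). Qed.
Lemma fftors_ff (k : fieldType) (A : falgType k) (C : fftors A) : functorially_finite C.
Proof. by case: (fftorsP C). Qed.
Definition mk_fftors (k : fieldType) (A : falgType k) (C : rmod A -> Prop)
    (torsC : tors C) (ffC : functorially_finite C) : fftors A :=
  FFTors (conj (proj2 (torsion_classP C) torsC) ffC).

Section Tilt.
Variables (k : fieldType) (A B : falgType k) (T E : rmod A) (e a : A).
Variables (x0 : E) (r0 : T) (pi : 'Hom(E, T)) (c : 'Hom(T, regular_mod A)).
Hypothesis apr : apr_data e a x0 r0 pi c.
Variable phi : 'Hom(B, 'End(T)).
Hypothesis phi_inj : lker phi = 0%VS.
Hypothesis phi_im : limg phi = homs T T.
Hypothesis phi_1 : phi 1 = \1%VF.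
Hypothesis phi_M : forall b b', phi (b * b') = (phi b \o phi b')%VF.
Implicit Types M X Y Z : rmod A.
Implicit Types N Q : rmod B.

Local Notation G := (hom_mod phi_im phi_1 phi_M).

Lemma G_exists M (f : 'Hom(T, M)) : is_hom f -> exists g : G M, hval g = f.
Proof. exact: hval_exists. Qed.

Definition tbrk (t : T) : B := bend phi (brk c t).
(** The idempotent of Gamma that projects T to the copy of aA along P'. *)
Definition eps : B := tbrk r0.

Lemma phi_tbrk t t' : phi (tbrk t) t' = t ** c t'.
Proof. by rewrite phi_bend ?brkE //; apply: (hom_brk apr). Qed.

Lemma c_r0 l : c (r0 ** l) = a * l.
Proof. by rewrite (apr_homc apr) (apr_cr0 apr). Qed.

Lemma tbrk_eps t : tbrk t * eps = tbrk t.
Proof.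
apply: (phi_eq phi_inj) => t'; rewrite phi_M comp_lfunE !phi_tbrk c_r0.
by rewrite (apr_ac apr).
Qed.

Lemma eps_idem : eps * eps = eps.
Proof. exact: tbrk_eps. Qed.

(** There are no nonzero maps from P' to aA, so that one of the off-diagonal
    blocks of Gamma vanishes. *)
Lemma eps_l b : eps * b * eps = eps * b.
Proof.
apply: (phi_eq phi_inj) => t; rewrite !phi_M !comp_lfunE !phi_tbrk.
have [y tE] := T_decompose apr t; rewrite {2}tE lfD (lfD c).
suff -> : c (phi b (pi y)) = 0 by rewrite addr0.
rewrite -!comp_lfunE; apply: (apr_vanish apr).
  exact: hom_comp (hom_comp (apr_homc apr) (hom_phi phi_im b)) (apr_hompi apr).
rewrite !comp_lfunE (_ : pi x0 = 0) ?lf0 //.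
by apply/(apr_kerpi apr); exists 1; rewrite ract1.
Qed.

Lemma act_eps_eps N (n : N) b : n ** eps ** b ** eps = n ** eps ** b.
Proof. by rewrite -!ractM mulrA eps_l. Qed.

Lemma hval_tbrk M (f : G M) t t' : hval (f ** tbrk t) t' = hval f t ** c t'.
Proof. by rewrite hval_act phi_tbrk hom_hval. Qed.

Lemma hval_tbrk_r0 M (f : G M) t : hval (f ** tbrk t) r0 = hval f t ** a.
Proof. by rewrite hval_tbrk (apr_cr0 apr). Qed.

(** The eps-part of Hom(T, M) is Hom(aA, M) = M a. *)
Lemma eps_hval_eq M (f g : G M) : f ** eps = f -> g ** eps = g ->
  hval f r0 = hval g r0 -> f = g.
Proof.
move=> <- <-; rewrite !hval_tbrk_r0 => fg.
apply: hval_eq => t; rewrite !hval_tbrk -[c t](apr_ac apr).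
by rewrite !ractM fg.
Qed.

Lemma hval_r0_a M (f : G M) : hval f r0 ** a = hval f r0.
Proof. by rewrite -(hom_hval f) (apr_r0 apr). Qed.

Lemma gbrk_exists M (m : M) : exists g : G M,
  [/\ g ** eps = g, hval g r0 = m ** a & forall t, hval g t = m ** c t].
Proof.
have [g gE] := G_exists (hom_brk apr m).
have gc t : hval g t = m ** c t by rewrite gE brkE.
exists g; split=> //; last by rewrite gc (apr_cr0 apr).
by apply: hval_eq => t; rewrite hval_tbrk !gc -ractM (apr_cr0 apr) (apr_ac apr).
Qed.

(** These modules are the sums of copies of the simple injective module
    Ext^1(T, P). *)
Definition stype N : Prop := forall n : N, n ** eps = 0.
Definition eps_ideal (b : B) : Prop := b * eps = b.

Lemma eps_ideal_pi b : (forall y, phi b (pi y) = 0) -> eps_ideal b.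
Proof.
move=> bpi; apply: (phi_eq phi_inj) => t; rewrite phi_M comp_lfunE.
have [y {2}->] := T_decompose apr t.
by rewrite lfD bpi addr0 phi_tbrk.
Qed.

Lemma stype_killed N : stype N <-> killed eps_ideal N.
Proof.
split=> [sN n b <-|kN n]; last exact/kN/eps_idem.
by rewrite ractM sN.
Qed.

(** End(P') is a division ring: an endomorphism g of P' lifts to E and so
    induces an endomorphism of the simple module eA. If this one is zero then
    the lift vanishes, as it factors through P'. Otherwise it is invertible,
    and an extension of its inverse to E induces an inverse of g. *)
Lemma eps_ideal_div b : eps_ideal b \/ exists b', eps_ideal (b * b' - 1).
Proof.
have homb := hom_phi phi_im b.
have pix0 : pi x0 = 0 by apply/(apr_kerpi apr); exists 1; rewrite ract1.
have cpi y : c (pi y) = 0 by apply/(apr_cpi apr); exists y.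
have cbpi y : c (phi b (pi y)) = 0.
  rewrite -!comp_lfunE; apply: (apr_vanish apr); last by rewrite !comp_lfunE pix0 !lf0.
  exact: hom_comp (hom_comp (apr_homc apr) homb) (apr_hompi apr).
have [P' [p [i [homp homi surp inji pip]]]] := image_exists (apr_hompi apr).
have [|h [homh hE]] := @hom_lift _ _ _ _ _ i (phi b \o pi)%VF homi
  (hom_comp homb (apr_hompi apr)) inji.
  move=> y; rewrite comp_lfunE; have /(apr_cpi apr)[y' ->] := cbpi y.
  by exists (p y').
have [g [homg /lfunP gE]] := apr_proj apr homp (proj2 (limg_fullP p) surp) homh.
have pig y : pi (g y) = phi b (pi y).
  by rewrite pip -[p _]comp_lfunE -gE hE comp_lfunE.
have [l gl] : exists l, g x0 = x0 ** l by apply/(apr_kerpi apr); rewrite pig pix0 lf0.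
have gl' : g x0 = x0 ** (e * l * e).
  by rewrite -[in LHS](apr_x0e apr) homg gl -{1}(apr_x0e apr) -!ractM mulrA.
have [el0|el_n0] := eqVneq (e * l * e) 0.
  left; apply: eps_ideal_pi => y; rewrite -pig.
  suff -> : g y = 0 by rewrite lf0.
  apply: (apr_separate apr) => h' homh'; rewrite -comp_lfunE.
  apply: (apr_vanish apr); first exact: hom_comp.
  by rewrite comp_lfunE gl' el0 ract0r lf0.
right; have [|m em] := apr_simple apr (l := l * e); first by rewrite mulrA.
have [g' [homg' g'E]] := extend_from_x0 apr (apr_gen apr (x0 ** m)).
have gg' y : g (g' y) = y.
  apply/eqP; rewrite -subr_eq0; apply/eqP/(apr_separate apr) => h' homh'.
  have -> : h' (g (g' y) - y) = (h' \o ((g \o g') - \1))%VF y.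
    by rewrite comp_lfunE add_lfunE opp_lfunE comp_lfunE id_lfunE.
  apply: (apr_vanish apr).
    exact: hom_comp homh' (hom_sub (hom_comp homg homg') (@hom_id _ _ _)).
  rewrite comp_lfunE add_lfunE opp_lfunE comp_lfunE id_lfunE g'E !homg gl'.
  rewrite -!ractM mulrA (_ : e * l * e * m = e) -?mulrA ?em //.
    by rewrite (apr_ee apr) (apr_x0e apr) subrr lf0.
  by rewrite !mulrA in em *.
have [|||f [homf fr fpi]] := @T_hom_exists _ _ _ _ _ _ _ _ _ _ apr T 0 (pi \o g')%VF.
- by rewrite ract0l.
- exact: hom_comp (apr_hompi apr) homg'.
- rewrite comp_lfunE g'E !(apr_hompi apr) pix0 !ract0l //.
exists (bend phi f); apply: eps_ideal_pi => y.
rewrite lfB add_lfunE opp_lfunE phi_M phi_1 comp_lfunE phi_bend // id_lfunE.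
by rewrite fpi comp_lfunE -pig gg' subrr.
Qed.

(** Modules of the form Hom(T, Y) have no submodule killed by eps, because T
    is generated by aA. *)
Lemma eps_hom_zero N Y (u : 'Hom(N, G Y)) : is_hom u ->
  (forall n, u (n ** eps) = 0) -> forall n, u n = 0.
Proof.
move=> homu ueps n; apply: hval_eq => t; rewrite hval0 -[RHS](@zero_lfunE _ T Y t).
apply: (hom_eq_gen (hom_hval (u n)) (@hom_0 _ _ T Y) (T_gen apr)) => {}t.
by rewrite zero_lfunE hom_hval -hval_tbrk_r0 -homu -tbrk_eps ractM ueps hval0.
Qed.

(** By eps_l the eps-part N eps is a submodule of N, and N / N eps is killed
    by eps. *)
Definition eps_space N : {vspace N} := limg (linfun (@ractl k B N eps)).

Lemma mem_eps_space N (n : N) : n \in eps_space N <-> n ** eps = n.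
Proof.
split=> [/memv_imgP[n' _ ->]|<-].
  by rewrite lfunE /= /ractl -ractM eps_idem.
have -> : n ** eps = linfun (@ractl k B N eps) n by rewrite lfunE.
exact/memv_img/memvf.
Qed.

Fact eps_submodule N : is_submodule (eps_space N).
Proof. by move=> n b /mem_eps_space<-; apply/mem_eps_space/act_eps_eps. Qed.

Definition eps_mod N : rmod B := sub_mod (@eps_submodule N).
Definition eps_emb N : 'Hom(eps_mod N, N) := linfun (vsval : subvs_of (eps_space N) -> N).

Lemma eps_embE N (n : eps_mod N) : eps_emb N n = vsval n.
Proof. by rewrite lfunE. Qed.
Lemma hom_eps_emb N : is_hom (eps_emb N).
Proof. by move=> n b; rewrite !eps_embE. Qed.
Lemma eps_emb_inj N (n : eps_mod N) : eps_emb N n = 0 -> n = 0.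
Proof. by rewrite eps_embE => n0; apply: val_inj; rewrite /= n0. Qed.
Lemma eps_emb_eps N (n : eps_mod N) : eps_emb N n ** eps = eps_emb N n.
Proof. by apply/mem_eps_space; rewrite eps_embE; apply: subvsP. Qed.
Lemma eps_emb_exists N (n : N) : n ** eps = n -> exists n', eps_emb N n' = n.
Proof. by move/mem_eps_space => nU; exists (Subvs nU); rewrite eps_embE. Qed.
Lemma eps_mod_eps N (n : eps_mod N) : n ** eps = n.
Proof.
apply/eqP; rewrite -subr_eq0; apply/eqP/eps_emb_inj.
by rewrite lfB hom_eps_emb eps_emb_eps subrr.
Qed.

Lemma eps_mod_map N Q (f : 'Hom(N, Q)) : is_hom f ->
  exists g : 'Hom(eps_mod N, eps_mod Q), is_hom g /\
    forall n, eps_emb Q (g n) = f (eps_emb N n).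
Proof.
move=> homf; have [|g [homg gE]] := hom_lift (@hom_eps_emb Q)
    (hom_comp homf (@hom_eps_emb N)) (@eps_emb_inj Q).
  move=> n; have [|n' n'E] := @eps_emb_exists Q (f (eps_emb N n)).
    by rewrite -homf eps_emb_eps.
  by exists n'; rewrite comp_lfunE.
by exists g; split=> // n; rewrite gE comp_lfunE.
Qed.

(** Since aA is projective, a map from aA to the span of the values u n t
    lifts to a power of T, and so comes from the eps-part of N. *)
Lemma eval_span_eps N Y (u : 'Hom(N, G Y)) (y : Y) : is_hom u ->
    spanned (fun z => exists n t, z = hval (u n) t) y ->
  exists n, n ** eps = n /\ hval (u n) r0 = y ** a.
Proof.
move=> homu; elim=> [|d _ z [n [t ->]] _ [n' [n'e n'E]]].
  by exists 0; rewrite !ract0l lf0 hval0.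
exists (d *: (n ** tbrk t) + n'); split.
  by rewrite ractDl ractZl n'e -ractM tbrk_eps.
by rewrite lfL hvalL n'E homu hval_tbrk_r0 ractDl ractZl.
Qed.

(** The pairs (f t, u f t) span a submodule Z of M + Y. The kernel of Z -> M
    has no a-part, and all the maps from T to M lift to Z; by T_lift_inj the
    kernel is zero, so Z is the graph of a homomorphism. *)
Lemma G_full M Y (u : 'Hom(G M, G Y)) : a_generated a M -> is_hom u ->
  exists h : 'Hom(M, Y), is_hom h /\ forall f t, hval (u f) t = h (hval f t).
Proof.
move=> genM homu.
pose S (z : sum_mod M Y) := exists f t, z = (hval f t, hval (u f) t).
have subG : is_sub (spanned S).
  apply: sub_spanned => _ l [f [t ->]]; exists f, (t ** l).
  by rewrite !hom_hval.
have graph_a z : spanned S z -> exists f : G M,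
    [/\ f ** eps = f, hval f r0 = z.1 ** a & hval (u f) r0 = z.2 ** a].
  elim=> [|d _ z' [f [t ->]] _ [g [geps g1 g2]]] /=.
    by exists 0; split; rewrite ?lf0 ?hval0 ?ract0l //=; rewrite [RHS]ract0l.
  exists (d *: (f ** tbrk t) + g); split.
  - by rewrite ractDl ractZl geps -ractM tbrk_eps.
  - by rewrite hvalL g1 hval_tbrk_r0 ractDl ractZl.
  by rewrite lfL homu hvalL g2 hval_tbrk_r0 ractDl ractZl.
have [Z [i [homi inji imi]]] := submodule_exists subG.
have [p [homp pE]] := sum_proj1 M Y; pose q := (p \o i)%VF.
have homq : is_hom q by apply: hom_comp.
have lift_S (f : G M) : exists g : 'Hom(T, Z), is_hom g /\
    forall t, i (g t) = (hval f t, hval (u f) t).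
  have [j [homj jE]] := sum_pair (hom_hval f) (hom_hval (u f)).
  have [t|g [homg gE]] := hom_lift homi homj inji.
    by apply/imi; rewrite jE; apply: spanned_gen; exists f, t.
  by exists g; split=> // t; rewrite gE jE.
have genZ : a_generated a Z.
  apply: (@spanned_lift _ _ _ _ i S _ inji) => [z|_ [f [t ->]]]; first by apply/imi; exists z.
  by have [g [homg gE]] := lift_S f; exists (g t) => //; apply/a_gen_hom/(T_gen apr).
have kerq z : q z = 0 -> z ** a = 0.
  rewrite comp_lfunE pE => z1; have /imi/graph_a : exists z', i z = i z' by exists z.
  rewrite z1 ract0l => -[f [feps f1 f2]].
  have f0 : f = 0 by apply: eps_hval_eq; rewrite ?ract0l ?hval0.
  apply: inji; rewrite homi; move: z1 f2; case: (i z) => z1 z2 /= ->.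
  rewrite f0 lf0 hval0 => /esym z2a.
  by congr pair; rewrite ?ract0l.
have injq : forall z, q z = 0 -> z = 0.
  apply: (T_lift_inj apr homq genZ kerq) => f homf.
  have [g gE] := G_exists homf; have [f' [homf' f'E]] := lift_S g.
  by exists f'; split=> // t; rewrite comp_lfunE f'E pE /= gE.
have [||||h [homh hE]] := @hom_of_rel _ _ M Y (fun m y => spanned S (m, y)).
- move=> d m y m' y' Smy Sm'y'.
  exact: (subD subG (subZ d subG Smy) Sm'y').
- by move=> m y l; move=> Smy; exact: (sub_act l subG Smy).
- move=> m; elim: (genM m) => [|d _ m' [n [l ->]] _ [y Sy]].
    by exists 0; apply: spanned0.
  have [g [_ _ gc]] := gbrk_exists n.
  exists (d *: hval (u g) (r0 ** l) + y).
  have -> : n ** (a * l) = hval g (r0 ** l) by rewrite gc c_r0.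
  have Sg : S (hval g (r0 ** l), hval (u g) (r0 ** l)) by exists g, (r0 ** l).
  exact: (spannedD d Sg Sy).
- move=> y Sy; have /imi[z zE] := Sy.
  have z0 : z = 0 by apply: injq; rewrite comp_lfunE -zE pE.
  by move: zE; rewrite z0 lf0 => -[].
exists h; split=> // f t; apply: hE; apply: spanned_gen.
by exists f, t.
Qed.

(** As Y e = 0, an element y of Y is y a, which is a map from aA to Y. The
    homomorphism h sends m to the image under u of the map from aA given by m
    a. *)
Lemma G_full_eps M Y (u : 'Hom(eps_mod (G M), G Y)) :
    (forall y : Y, y ** e = 0) -> is_hom u ->
  exists h : 'Hom(M, Y), is_hom h /\
    forall f t, hval (u f) t = h (hval (eps_emb _ f) t).
Proof.
move=> Ye homu.
have Ya (y : Y) : y ** a = y by rewrite {2}(ract_ea apr y) Ye add0r.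
have eps_eq (f g : eps_mod (G M)) :
    hval (eps_emb _ f) r0 = hval (eps_emb _ g) r0 -> f = g.
  move=> fg; apply/eqP; rewrite -subr_eq0; apply/eqP/eps_emb_inj.
  rewrite lfB; apply/eqP; rewrite subr_eq0; apply/eqP/eps_hval_eq => //;
    exact: eps_emb_eps.
have /choice[s sE] : forall m : M, exists f, hval (eps_emb (G M) f) r0 = m ** a.
  move=> m; have [g [/eps_emb_exists[f <-] g0 _]] := gbrk_exists m.
  by exists f.
have sb f t : s (hval (eps_emb _ f) t) = f ** tbrk t.
  by apply: eps_eq; rewrite sE hom_eps_emb hval_tbrk_r0.
have [||h [homh hE]] := @hom_of_fun _ _ M Y (fun m => hval (u (s m)) r0).
- move=> d m m'; rewrite -hvalL -lfL; congr (hval (u _) _); apply: eps_eq.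
  by rewrite lfL hvalL !sE ractDl ractZl.
- move=> m l; rewrite -hom_hval -[RHS]Ya -hval_tbrk_r0 -homu.
  congr (hval (u _) _); apply: eps_eq.
  by rewrite sE hom_eps_emb hval_tbrk_r0 hom_hval sE (ract_la apr).
exists h; split=> // f t; rewrite hE sb homu hval_tbrk_r0 Ya //.
Qed.

Lemma a_generated_pow d X : a_generated a X -> a_generated a (pow_mod d X).
Proof.
move=> genX z.
have -> : z = \sum_j [ffun i => if i == j then z i else 0] :> {ffun 'I_d -> X}.
  apply/ffunP => i; rewrite sum_ffunE (bigD1 i) //= ffunE eqxx big1 ?addr0 // => j.
  by rewrite ffunE eq_sym => /negPf->.
apply: (sub_sum _ (@sub_a_gen _ _ a _)) => j; have [H [homH HE]] := pow_inj X j.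
have -> : [ffun i => if i == j then z i else 0] = H (z j) :> {ffun 'I_d -> X}.
  by rewrite HE; apply/ffunP => i; rewrite !ffunE; case: eqP => // ->.
exact: a_gen_hom.
Qed.

(** If n_1, .., n_d generate N, let M be the cokernel of the action on T^d of
    the relations between them: this is the tensor product of N with T. The
    span K of the images of the relations is generated by aA, so the maps from
    T lift along T^d -> M and N -> Hom(T, M) is onto. The maps from aA to K
    lift further, to relations, so its kernel has no eps-part. *)
Lemma G_presentation N : exists M (f : 'Hom(N, G M)),
  [/\ a_generated a M, is_hom f, forall g, exists n, f n = g
    & forall n, f n = 0 -> n ** eps = 0].
Proof.
pose d := \dim {:N}; pose gen (i : 'I_d) := (vbasis {:N})`_i.
pose comb (b : 'I_d -> B) : N := \sum_i gen i ** b i.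
pose vec (b : 'I_d -> B) (t : T) : pow_mod d T := [ffun i => phi (b i) t].
have combL (z : k) b b' : comb (fun i => z *: b i + b' i) = z *: comb b + comb b'.
  rewrite /comb scaler_sumr -big_split; apply: eq_bigr => i _.
  by rewrite ractDr ractZr.
have vecL (z : k) b b' t : vec (fun i => z *: b i + b' i) t = z *: vec b t + vec b' t.
  by apply/ffunP => i; rewrite !ffunE lfL add_lfunE scale_lfunE.
have combM b b' : comb (fun i => b i * b') = comb b ** b'.
  by rewrite /comb ract_suml; apply: eq_bigr => i _; rewrite ractM.
have vecM b b' t : vec (fun i => b i * b') t = vec b (phi b' t).
  by apply/ffunP => i; rewrite !ffunE phi_M comp_lfunE.
have homvec b : exists v : 'Hom(T, pow_mod d T), is_hom v /\ forall t, v t = vec b t.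
  exact: (pow_pair (fun i => hom_phi phi_im (b i))).
have totN n : exists b, n = comb b.
  exists (fun i => (coord (vbasis {:N}) i n)%:A).
  rewrite {1}(coord_vbasis (memvf n)); apply: eq_bigr => i _.
  by rewrite ractZr ract1.
pose S (z : pow_mod d T) := exists b t, comb b = 0 /\ z = vec b t.
have subK : is_sub (spanned S).
  apply: sub_spanned => _ l [b [t [b0 ->]]]; exists b, (t ** l); split=> //.
  by apply/ffunP => i; rewrite !ffunE (hom_phi phi_im).
have [K [i [homi inji imi]]] := submodule_exists subK.
have genK : a_generated a K.
  apply: (@spanned_lift _ _ _ _ i S _ inji) => [z|_ [b [t [b0 ->]]]]; first by apply/imi; exists z.
  have [v [homv vE]] := homvec b.
  have [t'|g [homg gE]] := hom_lift homi homv inji.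
    by apply/imi; rewrite vE; apply: spanned_gen; exists b, t'.
  by exists (g t); [rewrite gE vE | apply/a_gen_hom/(T_gen apr)].
have [M [q [homq surq kerq]]] := quotient_exists subK.
have [||||f [homf fE]] := @hom_of_rel _ _ N (G M)
    (fun n g => exists b, n = comb b /\ forall t, hval g t = q (vec b t)).
- move=> z n g n' g' [b [-> gE]] [b' [-> g'E]]; exists (fun i => z *: b i + b' i).
  by split=> [|t]; rewrite ?combL // hvalL gE g'E vecL lfL.
- move=> n g b' [b [-> gE]]; exists (fun i => b i * b').
  by split=> [|t]; rewrite ?combM // hval_act gE vecM.
- move=> n; have [b ->] := totN n; have [v [homv vE]] := homvec b.
  have [g gE] := G_exists (hom_comp homq homv).
  by exists g, b; split=> // t; rewrite gE comp_lfunE vE.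
- move=> g [b [/esym b0 gE]]; apply: hval_eq => t; rewrite gE hval0.
  by apply/kerq/spanned_gen; exists b, t.
exists M, f; split=> //.
- exact: (a_generated_quot homq surq (a_generated_pow (T_gen apr))).
- move=> g; have kerq' x : q x = 0 <-> exists z, x = i z by rewrite kerq imi.
  have [f' [homf' f'E]] := T_lift apr homi homq surq kerq' genK (hom_hval g).
  have /choice[b bE] : forall j : 'I_d, exists b, forall t, phi b t = (f' t : {ffun 'I_d -> T}) j.
    move=> j; have [P [homP PE]] := @pow_proj _ _ d T j.
    exists (bend phi (P \o f')%VF) => t.
    by rewrite phi_bend ?comp_lfunE ?PE //; apply: hom_comp.
  exists (comb b); apply/esym/fE; exists b; split=> // t.
  by rewrite -f'E; congr (q _); apply/ffunP => j; rewrite ffunE bE.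
move=> n fn; have [b nE] := totN n; have [v [homv vE]] := homvec b.
have Sv : spanned S (vec b r0).
  apply/kerq; have [g gE] := G_exists (hom_comp homq homv).
  have : g = f n.
    by apply: fE; exists b; split=> // t; rewrite gE comp_lfunE vE.
  by rewrite fn => g0; rewrite -vE -comp_lfunE -gE g0 hval0.
have [b' [b'0 b'eps b'E]] : exists b', [/\ comb b' = 0, forall i, b' i * eps = b' i
    & forall i, phi (b' i) r0 = (vec b r0 : {ffun 'I_d -> T}) i ** a].
  elim: Sv => [|s _ w [b1 [t [b10 ->]]] _ [b2 [b20 b2eps b2E]]].
    exists (fun=> 0); split=> [|j|j]; rewrite ?mul0r //.
      by rewrite /comb big1 // => j _; rewrite ract0r.
    by rewrite lf0 zero_lfunE ffunE ract0l.
  exists (fun i => s *: (b1 i * tbrk t) + b2 i); split=> [|j|j].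
  - by rewrite combL combM b10 b20 ract0l scaler0 addr0.
  - by rewrite mulrDl -scalerAl -mulrA tbrk_eps b2eps.
  rewrite lfL add_lfunE scale_lfunE b2E phi_M comp_lfunE phi_tbrk (apr_cr0 apr).
  by rewrite !ffunE ractDl ractZl (hom_phi phi_im).
rewrite nE -combM -b'0; apply: eq_bigr => j _; congr (_ ** _).
rewrite -b'eps; apply: (phi_eq phi_inj) => t.
rewrite !phi_M !comp_lfunE !phi_tbrk !(hom_phi phi_im) b'E ffunE.
by rewrite -(hom_phi phi_im (b j) r0 a) (apr_r0 apr).
Qed.

(** * Transporting torsion classes *)

Implicit Type C : rmod A -> Prop.
Implicit Types D U : rmod B -> Prop.

Definition evals N Y (u : 'Hom(N, G Y)) (y : Y) : Prop := exists n t, y = hval (u n) t.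

Lemma G_map M Y (h : 'Hom(M, Y)) : is_hom h ->
  exists H : 'Hom(G M, G Y), is_hom H /\ forall f t, hval (H f) t = h (hval f t).
Proof. exact: hom_mod_map. Qed.

Lemma hom_zero_of_evals M Y (h : 'Hom(M, Y)) : a_generated a M ->
  (forall (f : G M) t, h (hval f t) = 0) -> forall m, h m = 0.
Proof.
move=> genM h0 m; elim: (genM m) => [|d _ m' [n [l ->]] _ IH]; first by rewrite lf0.
have [g [_ _ gc]] := gbrk_exists n.
by rewrite lfL IH addr0 -c_r0 -gc h0 scaler0.
Qed.

Lemma evals_quot M Y (p : 'Hom(M, Y)) (P : 'Hom(G M, G Y)) : a_generated a M ->
    (forall f t, hval (P f) t = p (hval f t)) ->
  forall m, spanned (evals P) (p m).
Proof.
move=> genM PE m; elim: (genM m) => [|d _ m' [n [l ->]] _ IH].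
  by rewrite lf0; apply: spanned0.
rewrite lfL; apply: spannedD => //.
have [g [_ _ gc]] := gbrk_exists n.
by exists g, (r0 ** l); rewrite PE gc c_r0.
Qed.

Lemma eval_full N Y (u : 'Hom(N, G Y)) : is_hom u -> (forall y, spanned (evals u) y) ->
  forall g, exists n, n ** eps = n /\ u n = g ** eps.
Proof.
move=> homu full g; have [n [neps nE]] := eval_span_eps homu (full (hval g r0)).
exists n; split=> //; apply: eps_hval_eq.
- by rewrite -homu neps.
- by rewrite -ractM eps_idem.
by rewrite nE hval_tbrk_r0.
Qed.

(** The image M of the map adjoint to u, from the tensor product of N with T
    to Y. *)
Lemma eval_image N Y (u : 'Hom(N, G Y)) : is_hom u ->
  exists M (i : 'Hom(M, Y)) (u' : 'Hom(N, G M)),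
    [/\ is_hom i /\ (forall m, i m = 0 -> m = 0), is_hom u',
        forall n t, hval (u n) t = i (hval (u' n) t), a_generated a M
      & forall m, spanned (evals u') m].
Proof.
move=> homu.
have subM : is_sub (spanned (evals u)).
  by apply: sub_spanned => _ l [n [t ->]]; exists n, (t ** l); rewrite hom_hval.
have [M [i [homi inji imi]]] := submodule_exists subM.
have [I [homI IE]] := G_map homi.
have injI f : I f = 0 -> f = 0.
  by move=> If; apply: hval_eq => t; rewrite hval0; apply: inji; rewrite -IE If hval0.
have liftI n : exists f, u n = I f.
  have [t|f [homf fE]] := hom_lift homi (hom_hval (u n)) inji.
    by apply/imi/spanned_gen; exists n, t.
  have [g gE] := G_exists homf; exists g.
  by apply: hval_eq => t; rewrite IE gE fE.
have [u' [homu' u'E]] := hom_lift homI homu injI liftI.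
have uE n t : hval (u n) t = i (hval (u' n) t) by rewrite -u'E IE.
exists M, i, u'; split=> //.
  apply: (@spanned_lift _ _ _ _ i (evals u) _ inji) => [z|_ [n [t ->]]].
    by apply/imi; exists z.
  by exists (hval (u' n) t); [rewrite uE | apply/a_gen_hom/(T_gen apr)/hom_hval].
apply: (@spanned_lift _ _ _ _ i (evals u) _ inji) => [z|_ [n [t ->]]].
  by apply/imi; exists z.
by exists (hval (u' n) t); [rewrite uE | apply: spanned_gen; exists n, t].
Qed.

Definition has_stype D : Prop := forall N, stype N -> D N.

(** The cokernel of f is killed by eps. *)
Lemma tors_stype_coker D N Q (f : 'Hom(N, Q)) : tors D -> has_stype D ->
  is_hom f -> (forall q, exists n, f n = q ** eps) -> D N -> D Q.
Proof.
move=> torsD stD homf cokf DN.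
have [R [p [homp surp kerp]]] := quotient_exists (sub_im homf).
apply: (tors_ext torsD homf homp surp) => [y /kerp//|//|].
apply: stD => r; have [q <-] := surp r; rewrite -homp; apply/kerp.
by have [n <-] := cokf q; exists n.
Qed.

Lemma tors_stype_ker D N Q (f : 'Hom(N, Q)) : tors D -> has_stype D ->
    is_hom f -> (forall q, exists n, f n = q) -> (forall n, f n = 0 -> n ** eps = 0) ->
  D Q -> D N.
Proof.
move=> torsD stD homf surf kerf DQ.
have [K [i [homi inji imi]]] := submodule_exists (sub_ker homf).
apply: (tors_ext torsD homi homf surf) => // [y /imi//|].
apply: stD => z; apply: inji; rewrite homi; apply: kerf.
by apply/imi; exists z.
Qed.

Lemma G_left_exact X Y Z (f : 'Hom(X, Y)) (g : 'Hom(Y, Z))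
    (F : 'Hom(G X, G Y)) (H : 'Hom(G Y, G Z)) : short_exact f g ->
    (forall u t, hval (F u) t = f (hval u t)) -> (forall u t, hval (H u) t = g (hval u t)) ->
  forall u, H u = 0 -> exists v, u = F v.
Proof.
move=> /short_exactP[homf homg injf ex _] FE HE u Hu.
have [t|v [homv vE]] := hom_lift homf (hom_hval u) injf.
  by apply/ex; rewrite -HE Hu hval0.
have [v' v'E] := G_exists homv; exists v'.
by apply: hval_eq => t; rewrite FE v'E vE.
Qed.

(** ** From torsion classes of Lambda to torsion classes of Gamma *)

(** By adjunction, this says that the tensor product of N with T belongs to C. *)
Definition psi C N : Prop :=
  forall Y (u : 'Hom(N, G Y)), perp C Y -> is_hom u -> forall n, u n = 0.

Lemma tors_psi C : tors (psi C).
Proof.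
split=> [Y u _ _ n|N Q p homp surp pN Y u pY homu q|X N Q f g].
- by rewrite (_ : n = 0) ?lf0 // [LHS]thinmx0 [RHS]thinmx0.
- have [n <-] := surp q; rewrite -comp_lfunE.
  exact: (pN Y _ pY (hom_comp homu homp)).
case/short_exactP => homf homg _ ex surg pX pQ Y u pY homu n.
have [z /ex[x ->]|h [homh hE]] := hom_factor homg homu surg.
  by rewrite -comp_lfunE; apply: (pX Y _ pY (hom_comp homu homf)).
by rewrite -hE (pQ Y h).
Qed.

Lemma psi_stype C : has_stype (psi C).
Proof.
by move=> N sN Y u _ homu; apply: eps_hom_zero => // n; rewrite sN lf0.
Qed.

(** A map from M to a torsion-free module Y induces a map from N to Hom(T, Y). *)
Lemma psi_quot C N M (f : 'Hom(N, G M)) : tors C -> a_generated a M ->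
  is_hom f -> (forall g, exists n, f n = g) -> psi C N -> C M.
Proof.
move=> torsC genM homf surf pN; apply: tors_perp => // Y h pY homh.
apply: hom_zero_of_evals => // g t; have [H [homH HE]] := G_map homh.
rewrite -HE; have [n <-] := surf g; rewrite -comp_lfunE.
by rewrite (pN Y _ pY (hom_comp homH homf)) hval0.
Qed.

Lemma psi_G C M : tors C -> a_generated a M -> psi C (G M) <-> C M.
Proof.
move=> torsC genM; split=> [|CM Y u pY homu f].
  by apply: (psi_quot (f := \1%VF)) => // [|g]; [apply: hom_id | exists g; rewrite id_lfunE].
have [h [homh hE]] := G_full genM homu.
by apply: hval_eq => t; rewrite hE hval0 (pY M h).
Qed.

Lemma psi_presentation C N : tors C -> psi C N -> exists M (f : 'Hom(N, G M)),
  [/\ C M, a_generated a M, is_hom f, forall g, exists n, f n = g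
    & forall n, f n = 0 -> n ** eps = 0].
Proof.
move=> torsC pN; have [M [f [genM homf surf kerf]]] := G_presentation N.
by exists M, f; split=> //; apply: psi_quot homf surf pN.
Qed.

(** ** Torsion classes of a-generated modules *)

(** The functor Hom(T, -) is an equivalence from the modules generated by aA
    to the Gamma-modules without summand killed by eps; so C |-> psi C and D
    |-> psi_inv D are inverse bijections between the torsion classes C made of
    the former and the torsion classes D that contain all the modules killed
    by eps. *)
Definition psi_inv D M : Prop := a_generated a M /\ D (G M).

Lemma tors_psi_inv D : tors D -> has_stype D -> tors (psi_inv D).
Proof.
move=> torsD stD; split.
- split; first by move=> x; rewrite (_ : x = 0) ?[LHS]thinmx0 ?[RHS]thinmx0 //; apply: spanned0.
  apply: tors_zero => // f; apply: hval_eq => t.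
  by rewrite [LHS]thinmx0 [RHS]thinmx0.
- move=> M Y p homp surp [genM DM]; split; first exact: a_generated_quot surp genM.
  have [P [homP PE]] := G_map homp.
  apply: (tors_stype_coker torsD stD homP) DM => g.
  have [|n [_ nE]] := @eval_full _ _ P homP _ g; last by exists n.
  by move=> y; have [m <-] := surp y; apply: evals_quot.
move=> X Y Z f g ex [genX DX] [genZ DZ].
have [homf homg injf exY surg] := proj1 (short_exactP f g) ex.
split.
  move=> y; have [y' geny' gy'] : exists2 y', a_gen a y' & g y' = g y.
    elim: {y}(g y) / (genZ (g y)) => [|d _ z [n [l ->]] _ [y' geny' <-]].
      by exists 0; [apply: spanned0 | rewrite lf0].
    have [n' <-] := surg n; exists (d *: (n' ** (a * l)) + y'); last by rewrite lfL homg.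
    by apply: spannedD => //; exists n', l.
  have [x yE] : exists x, y - y' = f x by apply/exY; rewrite lfB gy' subrr.
  rewrite -(subrK y' y) yE; apply: spanned_add => //.
  exact/a_gen_hom.
have [F [homF FE]] := G_map homf; have [H [homH HE]] := G_map homg.
apply: (tors_ext torsD homF homH) => //; last exact: G_left_exact ex FE HE.
move=> u; have [v [homv vE]] := T_lift apr homf homg surg exY genX (hom_hval u).
have [v' v'E] := G_exists homv; exists v'.
by apply: hval_eq => t; rewrite HE v'E vE.
Qed.

(** If N is in D, so is Hom(T, M) for the image M of any map from N to Hom(T,
    Y), as the cokernel of N -> Hom(T, M) is killed by eps; hence M is zero if
    Y is torsion-free. Conversely N is an extension of some Hom(T, M) by a
    module killed by eps. *)
Lemma psi_psi_inv D N : tors D -> has_stype D -> psi (psi_inv D) N <-> D N.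
Proof.
move=> torsD stD; have torsC := tors_psi_inv torsD stD.
split=> [pN|DN Y u pY homu n].
  have [M [f [[_ DM] _ homf surf kerf]]] := psi_presentation torsC pN.
  exact: tors_stype_ker surf kerf DM.
have [M [i [u' [[homi _] homu' uE genM full]]]] := eval_image homu.
have CM : psi_inv D M.
  split=> //; apply: (tors_stype_coker torsD stD homu') DN => g.
  by have [n' [_ n'E]] := eval_full homu' full g; exists n'.
by apply: hval_eq => t; rewrite uE hval0 (pY M i).
Qed.

(** ** Torsion classes containing the simple projective module *)

(** The modules M with M a = 0 are the quotients of powers of the simple
    projective module eA, so this says that C contains eA. *)
Definition has_ptype C : Prop := forall M, (forall m : M, m ** a = 0) -> C M.
(** These are the torsion classes without nonzero module killed by eps. Their
    objects are the modules over the algebra End(R), a quotient both of Gamma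
    and of Lambda, where R is aA; they correspond to the torsion classes of
    Lambda that contain eA, by phi_class and phi_inv. *)
Definition eps_fixed U : Prop := forall N, U N -> forall n : N, n ** eps = n.

(** The submodule of the elements killed by a belongs to C. *)
Lemma ptype_perp C Y : has_ptype C -> perp C Y -> forall y : Y, y ** e = 0.
Proof.
move=> pC pY y.
have subZ : is_sub (fun y : Y => y ** a = 0).
  split; first split=> [|d z z' za z'a]; first exact: ract0l.
    by rewrite ractDl ractZl za z'a scaler0 addr0.
  by move=> z l za; rewrite (ract_la apr) za !ract0l.
have [Z [i [homi inji imi]]] := submodule_exists subZ.
have CZ : C Z by apply: pC => z; apply: inji; rewrite homi; apply/imi; exists z.
have [z ->] : exists z, y ** e = i z.
  apply/imi; rewrite -ractM.
  by have := apr_eAa apr 1; rewrite mulr1 => ->; rewrite ract0r.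
exact: pY CZ homi z.
Qed.

Lemma psi_eps_G C M : has_ptype C -> C M -> psi C (eps_mod (G M)).
Proof.
move=> pC CM Y u pY homu f; have [h [homh hE]] := G_full_eps (ptype_perp pC pY) homu.
by apply: hval_eq => t; rewrite hE hval0 (pY M h).
Qed.

Lemma eps_gbrk M (m : M) : exists f : eps_mod (G M), hval (eps_emb _ f) r0 = m ** a.
Proof.
by have [g [/eps_emb_exists[f <-] g0 _]] := gbrk_exists m; exists f.
Qed.

Lemma psi_eps_GP C M : tors C -> has_ptype C -> psi C (eps_mod (G M)) <-> C M.
Proof.
move=> torsC pC; split=> [pM|]; last exact: psi_eps_G.
apply: tors_perp => // Y h pY homh m; have [H [homH HE]] := G_map homh.
rewrite (ract_ea apr m) lfD homh (ptype_perp pC pY) add0r.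
have [f <-] := eps_gbrk m; rewrite -HE -[H _]comp_lfunE.
by rewrite (pM Y _ pY (hom_comp homH (@hom_eps_emb _))) hval0.
Qed.

(** If M is the tensor product of N with T, the one of N eps with T is an
    extension of M by a sum of copies of eA. *)
Lemma psi_eps_mod C N : tors C -> has_ptype C -> psi C (eps_mod N) <-> psi C N.
Proof.
move=> torsC pC; split=> [pN Y u pY homu|pN].
  apply: eps_hom_zero => // n.
  have [|n' <-] := @eps_emb_exists N (n ** eps); first by rewrite -ractM eps_idem.
  by rewrite -comp_lfunE; apply: (pN Y _ pY (hom_comp homu (@hom_eps_emb N))).
have [M [f [CM _ homf surf kerf]]] := psi_presentation torsC pN.
have [F [homF FE]] := eps_mod_map homf.
have [||F' [homF' F'E]] := @hom_lift _ _ _ _ _ F \1%VF homF (@hom_id _ _ _).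
- move=> x Fx; apply: eps_emb_inj; rewrite -eps_emb_eps; apply: kerf.
  by rewrite -FE Fx lf0.
- move=> g; have [n fn] := surf (eps_emb _ g).
  have [|n' n'E] := @eps_emb_exists N (n ** eps); first by rewrite -ractM eps_idem.
  exists n'; rewrite id_lfunE; apply/eqP; rewrite -subr_eq0; apply/eqP/eps_emb_inj.
  by rewrite lfB FE n'E homf fn eps_emb_eps subrr.
apply: (tors_quot (@tors_psi C) homF' _ (psi_eps_G pC CM)) => x.
exists (F x); apply/eqP; rewrite -subr_eq0; apply/eqP/eps_emb_inj.
rewrite lfB -[X in X - _]eps_emb_eps -[X in _ - X]eps_emb_eps.
rewrite -ractBl; apply: kerf; rewrite -lfB -FE lfB F'E id_lfunE subrr.
by rewrite lf0.
Qed.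

Definition phi_class C N : Prop := (forall n : N, n ** eps = n) /\ psi C N.

Lemma tors_eps_fixed D : tors D -> tors (fun N => (forall n : N, n ** eps = n) /\ D N).
Proof.
move=> [D0 quotD extD]; split.
- by split=> // n; rewrite [LHS]thinmx0 [RHS]thinmx0.
- move=> N Q p homp surp [fixN DN]; split; last exact: quotD surp DN.
  by move=> q; have [n <-] := surp q; rewrite -homp fixN.
move=> X N Q f g ex [fixX DX] [fixQ DQ]; split; last exact: extD ex DX DQ.
have [homf homg injf exN surg] := proj1 (short_exactP f g) ex.
move=> n; have [x nE] : exists x, n ** eps - n = f x.
  by apply/exN; rewrite lfB homg fixQ subrr.
have : f x ** eps = 0 by rewrite -nE ractBl -ractM eps_idem subrr.
by rewrite -homf fixX -nE => /eqP; rewrite subr_eq0 => /eqP.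
Qed.

Lemma tors_phi C : tors (phi_class C).
Proof. exact/tors_eps_fixed/tors_psi. Qed.

Definition phi_inv U M : Prop := U (eps_mod (G M)).

Lemma eps_mod_surj N Q (f : 'Hom(N, Q)) (g : 'Hom(eps_mod N, eps_mod Q)) :
    is_hom f -> (forall n, eps_emb Q (g n) = f (eps_emb N n)) ->
    (forall q, exists n, f n = q ** eps) ->
  forall q, exists n, g n = q.
Proof.
move=> homf gE surf q; have [n fn] := surf (eps_emb Q q).
have [|n' n'E] := @eps_emb_exists N (n ** eps); first by rewrite -ractM eps_idem.
exists n'; apply/eqP; rewrite -subr_eq0; apply/eqP/eps_emb_inj.
by rewrite lfB gE n'E homf fn !eps_emb_eps subrr.
Qed.

Lemma G_eps_surj M Y (p : 'Hom(M, Y)) (P : 'Hom(G M, G Y)) :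
    is_hom p -> is_hom P -> (forall f t, hval (P f) t = p (hval f t)) ->
    (forall y, exists x, p x = y) ->
  forall g, exists f, P f = g ** eps.
Proof.
move=> homp homP PE surp g; have [m pm] := surp (hval g r0).
have [f [feps f0 _]] := gbrk_exists m; exists f; apply: eps_hval_eq.
- by rewrite -homP feps.
- by rewrite -ractM eps_idem.
by rewrite PE f0 homp pm hval_tbrk_r0.
Qed.

Lemma eps_mod_exact N' N Q (f : 'Hom(N', N)) (h : 'Hom(N, Q))
    (F : 'Hom(eps_mod N', eps_mod N)) (H : 'Hom(eps_mod N, eps_mod Q)) :
    is_hom f -> (forall n, eps_emb _ (F n) = f (eps_emb _ n)) ->
    (forall n, eps_emb _ (H n) = h (eps_emb _ n)) ->
    (forall n, h n = 0 -> exists x, n = f x) ->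
  forall n, H n = 0 -> exists x, n = F x.
Proof.
move=> homf FE HE ex n Hn; have [|x nx] := ex (eps_emb _ n); first by rewrite -HE Hn lf0.
have [|x' x'E] := @eps_emb_exists N' (x ** eps); first by rewrite -ractM eps_idem.
exists x'; apply/eqP; rewrite -subr_eq0; apply/eqP/eps_emb_inj.
by rewrite lfB FE x'E homf -nx eps_emb_eps subrr.
Qed.

Lemma tors_phi_inv U : tors U -> tors (phi_inv U).
Proof.
move=> torsU; split.
- apply: (tors_zero torsU) => f; apply: eps_emb_inj; apply: hval_eq => t.
  by rewrite [LHS]thinmx0 [RHS]thinmx0.
- move=> M Y p homp surp UM; have [P [homP PE]] := G_map homp.
  have [Q [homQ QE]] := eps_mod_map homP.
  apply: tors_quot torsU homQ _ UM.
  exact/(eps_mod_surj homP QE)/(G_eps_surj homp homP PE surp).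
move=> X Y Z f g ex UX UZ.
have [homf homg injf exY surg] := proj1 (short_exactP f g) ex.
have [F [homF FE]] := G_map homf; have [H [homH HE]] := G_map homg.
have [F' [homF' F'E]] := eps_mod_map homF; have [H' [homH' H'E]] := eps_mod_map homH.
apply: (tors_ext torsU homF' homH') => //.
  exact/(eps_mod_surj homH H'E)/(G_eps_surj homg homH HE surg).
exact: (eps_mod_exact homF F'E H'E (G_left_exact ex FE HE)).
Qed.

Lemma phi_inv_ptype U : tors U -> has_ptype (phi_inv U).
Proof.
move=> torsU M Ma; apply: (tors_zero torsU) => f; apply: eps_emb_inj.
apply: eps_hval_eq; rewrite ?eps_emb_eps ?ract0l //.
by rewrite hval0 -hval_r0_a Ma.
Qed.

(** The objects N of U have no quotient and no submodule killed by eps, so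
    they have the form Hom(T, M) up to isomorphism. *)
Lemma phi_phi_inv U N : tors U -> eps_fixed U -> phi_class (phi_inv U) N <-> U N.
Proof.
move=> torsU fixU; have torsC := tors_phi_inv torsU; split=> [[fixN pN]|UN].
  have [M [f [UM _ homf surf kerf]]] := psi_presentation torsC pN.
  have injf n : f n = 0 -> n = 0 by move/kerf; rewrite fixN.
  have [x|g [homg gE]] := hom_lift homf (@hom_eps_emb (G M)) injf.
    by have [n <-] := surf (eps_emb _ x); exists n.
  apply: (tors_quot torsU homg _ UM) => n.
  have [|x xE] := @eps_emb_exists (G M) (f n); first by rewrite -homf fixN.
  by exists x; apply/eqP; rewrite -subr_eq0; apply/eqP/injf; rewrite lfB gE xE subrr.
have fixN := fixU N UN; split=> // Y u pY homu n.
have [M [i [u' [[homi _] homu' uE genM full]]]] := eval_image homu.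
have CM : phi_inv U M.
  have [n'|g [homg gE]] := hom_lift (@hom_eps_emb (G M)) homu' (@eps_emb_inj (G M)).
    have [|x xE] := @eps_emb_exists (G M) (u' n'); first by rewrite -homu' fixN.
    by exists x.
  apply: (tors_quot torsU homg _ UN) => x.
  have [n' [_ n'E]] := eval_full homu' full (eps_emb _ x).
  exists n'; apply/eqP; rewrite -subr_eq0; apply/eqP/eps_emb_inj.
  by rewrite lfB gE n'E eps_emb_eps subrr.
by apply: hval_eq => t; rewrite uE hval0 (pY M i).
Qed.

(** ** The order-preserving map of the flip-flop *)

(** The smallest torsion class that contains U and the modules killed by eps,
    as N is an extension of such a module by N eps. *)
Definition eps_ext U N : Prop := U (eps_mod N).

Lemma tors_eps_ext U : tors U -> tors (eps_ext U).
Proof.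
move=> torsU; split.
- by apply: (tors_zero torsU) => f; apply: eps_emb_inj; rewrite [LHS]thinmx0 [RHS]thinmx0.
- move=> N Q p homp surp UN; have [P [homP PE]] := eps_mod_map homp.
  apply: (tors_quot torsU homP _ UN).
  by apply: (eps_mod_surj homp PE) => q; apply: surp.
move=> X N Q f g /short_exactP[homf homg injf ex surg] UX UQ.
have [F [homF FE]] := eps_mod_map homf; have [H [homH HE]] := eps_mod_map homg.
apply: (tors_ext torsU homF homH) => //.
  by apply: (eps_mod_surj homg HE) => q; apply: surg.
by apply: (eps_mod_exact homf FE HE) => n /ex.
Qed.

Lemma eps_ext_stype U : tors U -> has_stype (eps_ext U).
Proof.
by move=> torsU N sN; apply: (tors_zero torsU) => n; apply: eps_emb_inj; rewrite -eps_emb_eps sN.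
Qed.

Lemma eps_ext_le U D : tors D -> has_stype D -> eps_fixed U -> tors U ->
  (forall N, eps_ext U N -> D N) <-> (forall N, U N -> D N).
Proof.
move=> torsD stD fixU torsU; split=> UD N UN.
  apply: UD; have fixN := fixU N UN.
  have [n|g [homg gE]] := hom_lift (@hom_eps_emb N) (@hom_id _ _ N) (@eps_emb_inj N).
    by have [x xE] := eps_emb_exists (fixN n); exists x; rewrite id_lfunE.
  apply: (tors_quot torsU homg _ UN) => x; exists (eps_emb N x).
  apply/eqP; rewrite -subr_eq0; apply/eqP/eps_emb_inj.
  by rewrite lfB gE id_lfunE subrr.
apply: (tors_stype_coker torsD stD (@hom_eps_emb N)); last exact: UD UN.
by move=> n; apply: eps_emb_exists; rewrite -ractM eps_idem.
Qed.

(** If N is in D and N eps is not N, then the nonzero module N / N eps is in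
    D. *)
Lemma gamma_dichotomy D : tors D -> has_stype D \/ eps_fixed D.
Proof.
move=> torsD; have [fixD|/existsNP[N]] := pselect (eps_fixed D); first by right.
move=> /not_implyP[DN /existsNP[n /eqP n_eps]]; left => Q sQ.
have [R [p [homp surp kerp]]] := quotient_exists (sub_im (@hom_eps_emb N)).
have p0 q : p (q ** eps) = 0.
  apply/kerp; have [|x xE] := @eps_emb_exists N (q ** eps); first by rewrite -ractM eps_idem.
  by exists x.
have pn : p n != 0.
  by apply: contra n_eps => /eqP/kerp[x ->]; rewrite eps_emb_eps.
apply: (killed_dichotomy eps_ideal_div torsD _ _ pn); last exact/stype_killed.
  exact: tors_quot homp surp DN.
by apply/stype_killed => r; have [q <-] := surp r; rewrite -homp p0.
Qed.

(** If M is in C and is not generated by aA, then C contains the nonzero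
    module M / M a A, which is a sum of copies of eA. *)
Lemma lambda_dichotomy C : tors C -> has_ptype C \/ forall M, C M -> a_generated a M.
Proof.
move=> torsC; have [genC|/existsNP[M]] := pselect (forall M, C M -> a_generated a M); first by right.
move=> /not_implyP[CM /existsNP[m m_gen]]; left => Q Qa.
have [R [p [homp surp kerp]]] := quotient_exists (@sub_a_gen _ _ a M).
have divI l : e * l = 0 \/ exists l', e * (l * l' - 1) = 0.
  have [el|/(apr_simple apr)[l' el']] := eqVneq (e * l) 0; first by left.
  by right; exists l'; rewrite mulrBr mulrA el' mulr1 subrr.
have killI (X : rmod A) : (forall x : X, x ** a = 0) -> killed (fun l => e * l = 0) X.
  by move=> Xa x l el; rewrite (ract_ea apr x) Xa addr0 -ractM el ract0r.
apply: (killed_dichotomy divI torsC (tors_quot torsC homp surp CM) _ (m := p m)).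
- by apply: killI => r; have [x <-] := surp r; rewrite -homp; apply/kerp/a_gen_act.
- by apply/eqP => /kerp.
exact: killI.
Qed.

Lemma simple_projective_exists : exists (P : rmod A) (i : 'Hom(P, regular_mod A)),
  [/\ is_hom i, forall x : P, x ** a = 0 & exists x, i x = e].
Proof.
have subP : is_sub (fun l : regular_mod A => exists l', l = e * l' :> A).
  split; first split=> [|d _ _ [l ->] [l' ->]]; first by exists 0; rewrite mulr0.
    by exists (d *: l + l'); rewrite mulrDr scalerAr.
  by move=> _ b [l ->]; exists (l * b); rewrite mulrA.
have [P [i [homi inji imi]]] := submodule_exists subP.
exists P, i; split=> // [x|].
  apply: inji; rewrite homi; have /imi[l ->] : exists x', i x = i x' by exists x.
  exact: (apr_eAa apr l).
have [x ex] : exists x, e = i x by apply/imi; exists 1; rewrite mulr1.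
by exists x.
Qed.

Lemma lambda_exclusive C : has_ptype C -> (forall M, C M -> a_generated a M) -> False.
Proof.
move=> pC genC; have [P [i [homi Pa [x ix]]]] := simple_projective_exists.
have P0 := a_generated_zero (genC _ (pC _ Pa)) Pa.
case/eqP: (apr_x0 apr); rewrite -(apr_x0e apr) -ix (P0 x) lf0.
exact: ract0r.
Qed.

(** The quotient of Gamma by the ideal of the maps that vanish on P' is killed
    by eps, and it is not zero since P' is not. *)
Lemma gamma_exclusive D : has_stype D -> eps_fixed D -> False.
Proof.
move=> stD fixD.
have subI : is_sub (fun b : regular_mod B => eps_ideal b).
  rewrite /eps_ideal; split; first split=> [|d b b' be b'e]; first by rewrite mul0r.
    by rewrite mulrDl -scalerAl be b'e.
  move=> b b' be; change ((b : B) * b' * eps = (b : B) * b').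
  by rewrite -{1}be -!mulrA (mulrA eps) eps_l mulrA be.
have [S [p [homp surp kerp]]] := quotient_exists subI.
have sS : stype S.
  by move=> s; have [b <-] := surp s; rewrite -homp; apply/kerp; rewrite /eps_ideal -mulrA eps_idem.
have S0 : p (1 : B) = 0 by rewrite -(fixD S (stD S sS) (p (1 : B))) sS.
have /kerp := S0; rewrite /eps_ideal mul1r => eps1.
case/negP: (apr_x0 apr); apply/eqP.
suff E0 : forall y : E, y = 0 by [].
apply: (a_generated_zero (apr_gen apr)) => y.
have : pi (y ** a) = 0.
  have := phi_tbrk r0 (pi (y ** a)); rewrite -/eps eps1 phi_1 id_lfunE => ->.
  rewrite (_ : c _ = 0) ?ract0r //; apply/(apr_cpi apr).
  by exists (y ** a).
case/(apr_kerpi apr) => l yl.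
by rewrite -[a](apr_aa apr) ractM yl -(apr_x0e apr) -!ractM mulrA (apr_eAa apr) ract0r.
Qed.

(** ** Functorial finiteness is preserved *)

(** The universal element is that of the push-out along Gamma eps -> Gamma of
    a left approximation of Gamma eps. *)
Lemma ff_eps_ext U : tors U -> eps_fixed U -> functorially_finite U ->
  functorially_finite (eps_ext U).
Proof.
move=> torsU fixU ffU; apply/(functorially_finiteP (tors_eps_ext torsU)).
have [[V [v [UV homv univ]]] _] := ffU (eps_mod (regular_mod B)).
have subR : is_sub (fun z : sum_mod (regular_mod B) V =>
    exists b, z = (eps_emb (regular_mod B) b, - v b)).
  split; first split=> [|d _ _ [b ->] [b' ->]].
  - by exists 0; rewrite !lf0 oppr0.
  - by exists (d *: b + b'); rewrite !lfL opprD -scalerN.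
  by move=> _ l [b ->]; exists (b ** l); rewrite homv hom_eps_emb -ractNl.
have [X [p [homp surp kerp]]] := quotient_exists subR.
have [j1 [homj1 j1E]] := sum_inj1 (regular_mod B) V.
have [j2 [homj2 j2E]] := sum_inj2 (regular_mod B) V.
have homj : is_hom (p \o j2)%VF by apply: hom_comp.
have pemb b : p (j1 (eps_emb _ b)) = p (j2 (v b)).
  apply/eqP; rewrite -subr_eq0 -lfB; apply/eqP/kerp; exists b.
  by rewrite j1E j2E; congr pair; rewrite /= ?subr0 ?sub0r.
have XU : eps_ext U X.
  have [u|g [homg gE]] := hom_lift (@hom_eps_emb X) homj (@eps_emb_inj X).
    have [|x xE] := @eps_emb_exists X ((p \o j2)%VF u); first by rewrite -homj fixU.
    by exists x.
  apply: (tors_quot torsU homg _ UV) => x; have [[b u] pbu] := surp (eps_emb X x).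
  have [|b' b'E] := @eps_emb_exists (regular_mod B) (b * eps).
    by rewrite -[LHS]/(b * eps * eps) -mulrA eps_idem.
  exists (v b' + u); apply/eqP; rewrite -subr_eq0; apply/eqP/eps_emb_inj.
  rewrite lfB gE comp_lfunE lfD lfD -pemb b'E -[in X in _ - X]eps_emb_eps -pbu -homp -lfD.
  rewrite -lfB (_ : _ - _ = 0) ?lf0 // j1E j2E.
  have -> : ((b, u) : sum_mod (regular_mod B) V) ** eps = (b * eps, u).
    by congr pair; apply: fixU.
  apply/eqP; rewrite subr_eq0; apply/eqP.
  by apply: injective_projections; rewrite /= ?addr0 ?add0r.
exists X; split=> // N UN; apply: generated_by_spanned => n.
have [nu [homnu nuE]] := hom_from_regular n; have [nu' [homnu' nu'E]] := eps_mod_map homnu.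
have [w [homw /lfunP wE]] := univ _ nu' UN homnu'.
have [H [homH HE]] := sum_copair homnu (hom_comp (@hom_eps_emb N) homw).
have [z /kerp[b ->]|h [homh hE]] := hom_factor homp homH surp.
  by rewrite HE /= lfN comp_lfunE -[w _]comp_lfunE -wE nu'E subrr.
have <- : h (p (j1 (1 : B))) = n.
  by rewrite hE HE j1E /= lf0 addr0 nuE ract1.
exact: spanned_image.
Qed.

(** If X generates C then Hom(aA, X) generates phi_class C, because aA is
    projective. *)
Lemma ff_phi C : tors C -> has_ptype C -> functorially_finite C ->
  functorially_finite (phi_class C).
Proof.
move=> torsC pC /(functorially_finiteP torsC)[X [CX genX]].
apply/(functorially_finiteP (tors_phi C)); exists (eps_mod (G X)).
split; first by split; [apply: eps_mod_eps | apply: psi_eps_G].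
move=> N [fixN pN] n.
have [M [f [CM _ homf surf kerf]]] := psi_presentation torsC pN.
have injf n' : f n' = 0 -> n' = 0 by move/kerf; rewrite fixN.
have [d [h [x [homh hx]]]] := genX M CM (hval (f n) r0).
have /choice[s sE] : forall i, exists s, hval (eps_emb (G X) s) r0 = x i ** a.
  by move=> i; apply: eps_gbrk.
have /choice[H HE] : forall i, exists H : 'Hom(G X, G M),
    is_hom H /\ forall f t, hval (H f) t = h i (hval f t).
  by move=> i; apply: G_map.
have /choice[K KE] : forall i, exists K : 'Hom(eps_mod (G X), N),
    is_hom K /\ forall z, f (K z) = H i (eps_emb _ z).
  move=> i; have [homH _] := HE i.
  have [z|K [homK KE]] := hom_lift homf (hom_comp homH (@hom_eps_emb (G X))) injf.
    by have [n' <-] := surf ((H i \o eps_emb _)%VF z); exists n'.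
  by exists K; split=> // z; rewrite KE comp_lfunE.
exists d, K, s; split=> [i|]; first by case: (KE i).
apply/eqP; rewrite -subr_eq0; apply/eqP/injf; rewrite lfB lf_sum.
apply/eqP; rewrite subr_eq0; apply/eqP/eps_hval_eq.
- by rewrite -homf fixN.
- rewrite ract_suml; apply: eq_bigr => i _; have [_ ->] := KE i.
  by have [homH _] := HE i; rewrite -homH eps_emb_eps.
rewrite hval_sum -hval_r0_a hx ract_suml; apply: eq_bigr => i _.
by have [_ ->] := KE i; have [_ ->] := HE i; rewrite sE homh.
Qed.

(** If V generates U and V is Hom(T, X), then X generates the submodules M a
    A, and eA generates the rest. *)
Lemma ff_phi_inv U : tors U -> eps_fixed U -> functorially_finite U ->
  functorially_finite (phi_inv U).
Proof.
move=> torsU fixU /(functorially_finiteP torsU)[V [UV genV]].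
have torsC := tors_phi_inv torsU; apply/(functorially_finiteP torsC).
have [fixV pV] := proj2 (phi_phi_inv V torsU fixU) UV.
have [X [f [CX genX homf surf kerf]]] := psi_presentation torsC pV.
have injf v : f v = 0 -> v = 0 by move/kerf; rewrite fixV.
have [P [i [homi Pa [x ix]]]] := simple_projective_exists.
have [p1 [homp1 p1E]] := sum_proj1 X P; have [p2 [homp2 p2E]] := sum_proj2 X P.
exists (sum_mod X P); split; first by apply: tors_sum => //; apply: phi_inv_ptype.
move=> M CM; apply: generated_by_spanned => m.
rewrite (ract_ea apr m); apply: spanned_add.
  have [h [homh hE]] := hom_from_regular m.
  have -> : m ** e = (h \o i \o p2)%VF (0, x) by rewrite !comp_lfunE p2E ix hE.
  exact/spanned_image/hom_comp/homp2/hom_comp.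
have [z <-] := eps_gbrk m; have [d [h [v [homh ->]]]] := genV _ CM z.
rewrite lf_sum hval_sum; elim/big_rec: _ => [|j y _]; first exact: spanned0.
apply: spanned_add.
have [||g [homg gE]] := @hom_factor _ _ _ _ _ f (eps_emb _ \o h j)%VF homf _ surf.
- exact: hom_comp (@hom_eps_emb (G M)) (homh j).
- by move=> v' /injf->; rewrite lf0.
have [u [homu uE]] := G_full genX homg.
have -> : hval (eps_emb _ (h j (v j))) r0 = (u \o p1)%VF (hval (f (v j)) r0, 0).
  by rewrite comp_lfunE p1E -uE gE comp_lfunE.
exact/spanned_image/hom_comp.
Qed.

(** A module N of psi C is an extension of some Hom(T, M), with M in C, by a
    module killed by eps. It splits by semisimplicity of the latter, and a
    left approximation of T in C takes care of Hom(T, M). *)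
Lemma ff_psi C : tors C -> (forall M, C M -> a_generated a M) -> functorially_finite C ->
  functorially_finite (psi C).
Proof.
move=> torsC genC ffC; apply/(functorially_finiteP (tors_psi C)).
have [[X [al [CX homal univ]]] _] := ffC T; have [alG alGE] := G_exists homal.
have subI : is_sub (fun b : regular_mod B => exists b', b = b' * eps :> B).
  split; first split=> [|d _ _ [b ->] [b' ->]]; first by exists 0; rewrite mul0r.
    by exists (d *: b + b'); rewrite mulrDl scalerAl.
  move=> _ b' [b ->]; exists (b * eps * b').
  by change (b * eps * b' = b * eps * b' * eps); rewrite -!mulrA (mulrA eps) eps_l.
have [S [q [homq surq kerq]]] := quotient_exists subI.
have sS : stype S.
  by move=> s; have [b <-] := surq s; rewrite -homq; apply/kerq; exists b.
have [p1 [homp1 p1E]] := sum_proj1 (G X) S; have [p2 [homp2 p2E]] := sum_proj2 (G X) S.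
exists (sum_mod (G X) S); split.
  apply: (tors_sum (tors_psi C)); last exact: psi_stype.
  by apply/psi_G => //; apply: genC.
move=> N pN; apply: generated_by_spanned => n.
have [M [f [CM _ homf surf kerf]]] := psi_presentation torsC pN.
have [K [i [homi inji imi]]] := submodule_exists (sub_ker homf).
have [R [r [homr surr kerr]]] := quotient_exists (sub_im (@hom_eps_emb N)).
have iK x : f (i x) = 0 by apply/imi; exists x.
have sK : stype K by move=> x; apply: inji; rewrite homi; apply: kerf.
have sR : stype R.
  move=> y; have [n' <-] := surr y; rewrite -homr; apply/kerr.
  have [|x xE] := @eps_emb_exists N (n' ** eps); first by rewrite -ractM eps_idem.
  by exists x.
have [|||rho [homrho rhoE]] := @killed_retraction _ _ _ eps_ideal_div K R (r \o i)%VF.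
- exact/stype_killed.
- exact: hom_comp.
- move=> x; rewrite comp_lfunE => /kerr[y iy]; apply: inji.
  by rewrite iy -eps_emb_eps -iy; apply: kerf.
pose s := (\1 - (i \o rho \o r))%VF.
have homs' : is_hom s by apply: hom_sub (@hom_id _ _ N) (hom_comp (hom_comp homi homrho) homr).
have sE n' : s n' = n' - i (rho (r n')) by rewrite add_lfunE opp_lfunE id_lfunE !comp_lfunE.
have [n' fn'|h [homh hE]] := hom_factor homf homs' surf.
  have [x ->] : exists x, n' = i x by apply/imi.
  by rewrite sE -[r _]comp_lfunE rhoE subrr.
rewrite -(subrK (i (rho (r n))) n) -sE -hE; apply: spanned_add.
  have [u [homu /lfunP uE]] := univ M _ CM (hom_hval (f n)).
  have [H [homH HE]] := G_map homu.
  have <- : H alG = f n by apply: hval_eq => t; rewrite HE alGE uE comp_lfunE.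
  have -> : h (H alG) = (h \o H \o p1)%VF (alG, 0) by rewrite !comp_lfunE p1E.
  exact/spanned_image/hom_comp/homp1/hom_comp.
have [g [homg gE]] := hom_from_regular (rho (r n)).
have [b /kerq[b' ->]|g' [homg' g'E]] := hom_factor homq homg surq.
  by rewrite gE ractM sK.
have -> : i (rho (r n)) = (i \o g' \o p2)%VF (0, q (1 : B)).
  by rewrite !comp_lfunE p2E g'E gE ract1.
exact/spanned_image/hom_comp/homp2/hom_comp.
Qed.

(** A left approximation of Hom(T, T) in D induces one of T in psi_inv D; this
    suffices because the objects of psi_inv D are generated by aA, a summand
    of T. *)
Lemma ff_psi_inv D : tors D -> has_stype D -> functorially_finite D ->
  functorially_finite (psi_inv D).
Proof.
move=> torsD stD ffD; apply/(functorially_finiteP (tors_psi_inv torsD stD)).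
have [[Y [al [DY homal univ]]] _] := ffD (G T).
have [X [f [genX homf surf kerf]]] := G_presentation Y.
have DX : D (G X) by apply: tors_quot torsD homf surf DY.
have [h [homh hE]] := G_full (T_gen apr) (hom_comp homf homal).
have [K [i [homi inji imi]]] := submodule_exists (sub_ker homf).
exists X; split=> // M [genM DM]; apply: generated_by_spanned => m.
apply: (spanned_lift (i := \1%VF) (S := fun x : M => exists (m : M) l, x = m ** (a * l))).
- by move=> x; rewrite id_lfunE.
- by move=> x; rewrite id_lfunE; apply: genM.
move=> _ [m' [l ->]]; exists (m' ** (a * l)); first by rewrite id_lfunE.
have [H [homH HE]] := G_map (hom_brk apr m').
have [w [homw /lfunP wE]] := univ _ H DM homH.
have [y fy|w' [homw' w'E]] := hom_factor homf homw surf.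
  have [x ->] : exists x, y = i x by apply/imi.
  rewrite -comp_lfunE; apply: eps_hom_zero (hom_comp homw homi) _ x => x'.
  rewrite (_ : x' ** eps = 0) ?lf0 //; apply: inji; rewrite homi; apply: kerf.
  by apply/imi; exists x'.
have [u [homu uE]] := G_full genX homw'.
have [idT idTE] := G_exists (@hom_id _ _ T).
have -> : m' ** (a * l) = u (h (r0 ** l)).
  transitivity (hval (H idT) (r0 ** l)).
    by rewrite HE idTE id_lfunE brkE c_r0.
  by rewrite wE comp_lfunE -w'E uE -[f _]comp_lfunE hE idTE id_lfunE.
exact: spanned_image.
Qed.

(** * The flip-flop *)

(** Larger torsion classes have smaller torsion-free classes. *)
Lemma psi_mono C C' : (forall M, C M -> C' M) -> forall N, psi C N -> psi C' N.
Proof.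
move=> CC' N pN Y u pY; apply: pN => X h CX; exact/pY/CC'.
Qed.

Definition gamma_fixed : poset :=
  sub_poset (fun U : fftors_poset B => eps_fixed (fftors_mem U)).
Definition gamma_stype : poset :=
  sub_poset (fun D : fftors_poset B => has_stype (fftors_mem D)).

Definition flip_map (U : gamma_fixed) : gamma_stype :=
  let: exist U fixU := U in
  exist _ (mk_fftors (tors_eps_ext (fftors_tors U))
             (ff_eps_ext (fftors_tors U) fixU (fftors_ff U)))
    (eps_ext_stype (fftors_tors U)).

Lemma flip_map_mono : order_preserving flip_map.
Proof. by move=> [U fixU] [U' fixU'] /= le N; apply: le. Qed.

Definition gamma_of (z : flip_plus flip_map_mono) : fftors_poset B :=
  match z with inl U => proj1_sig U | inr D => proj1_sig D end.

(** A torsion class U of the first kind is contained in one, D, of the second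
    kind exactly when eps_ext U is, by minimality of eps_ext U. *)
Lemma gamma_flip_plus : poset_iso (fftors_poset B) (flip_plus flip_map_mono).
Proof.
apply: (@poset_iso_of_embedding _ _ gamma_of) => [[[U fixU]|[D stD]] [[U' fixU']|[D' stD']]|D] //=.
- exact: eps_ext_le (fftors_tors D') stD' fixU (fftors_tors U).
- split=> // le; apply: (@gamma_exclusive U') => // N /stD; exact: le.
have [stD|fixD] := gamma_dichotomy (fftors_tors D).
  by exists (inr (exist _ D stD)).
by exists (inl (exist _ D fixD)).
Qed.

Definition lambda_of (z : flip_minus flip_map_mono) : fftors_poset A :=
  match z with
  | inl (exist U fixU) => mk_fftors (tors_phi_inv (fftors_tors U))
      (ff_phi_inv (fftors_tors U) fixU (fftors_ff U))
  | inr (exist D stD) => mk_fftors (tors_psi_inv (fftors_tors D) stD)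
      (ff_psi_inv (fftors_tors D) stD (fftors_ff D))
  end.

(** The torsion classes containing eA are never contained in the others. The
    remaining relation, that psi_inv D is contained in phi_inv U exactly when
    D is contained in eps_ext U, holds because psi (phi_inv U) = eps_ext U, by
    psi_eps_mod. *)
Lemma lambda_flip_minus : poset_iso (fftors_poset A) (flip_minus flip_map_mono).
Proof.
apply: (@poset_iso_of_embedding _ _ lambda_of) => [[[U fixU]|[D stD]] [[U' fixU']|[D' stD']]|C] /=.
- have [tU tU'] := (fftors_tors U, fftors_tors U').
  split=> [le M UM|le N /(phi_phi_inv N tU fixU)[fixN pN]]; first exact: le.
  by apply/(phi_phi_inv N tU' fixU'); split=> //; apply: psi_mono pN.
- split=> // le; apply: lambda_exclusive (phi_inv_ptype (fftors_tors U)) _ => M /le.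
  by case.
- have [tD tU'] := (fftors_tors D, fftors_tors U').
  split=> [le M [_ DM]|le N /(psi_psi_inv N tD stD) pN]; first exact: le DM.
  apply/(phi_phi_inv (eps_mod N) tU' fixU'); split; first exact: eps_mod_eps.
  apply/(psi_eps_mod N (tors_phi_inv tU') (phi_inv_ptype tU')).
  exact: psi_mono pN.
- have [tD tD'] := (fftors_tors D, fftors_tors D').
  split=> [le M [genM DM]|le N /(psi_psi_inv N tD stD) pN]; first by split=> //; apply: le.
  by apply/(psi_psi_inv N tD' stD'); apply: psi_mono pN.
have tC := fftors_tors C.
have [pC|genC] := lambda_dichotomy tC.
  have fixU : eps_fixed (phi_class C) by move=> N [].
  exists (inl (exist _ (mk_fftors (tors_phi C) (ff_phi tC pC (fftors_ff C))) fixU)).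
  apply: fftors_le_anti => M /=.
    by case=> _ /(psi_eps_GP M tC pC).
  by move=> CM; split; [apply: eps_mod_eps | apply/psi_eps_GP].
exists (inr (exist _ (mk_fftors (tors_psi C) (ff_psi tC genC (fftors_ff C))) (@psi_stype C))).
apply: fftors_le_anti => M /=; first by case=> genM /(psi_G tC genM).
move=> CM; have genM := genC M CM; split=> //.
exact: proj2 (psi_G tC genM) CM.
Qed.

Lemma apr_flip_flop : related_by_flip_flop (fftors_poset A) (fftors_poset B).
Proof.
exists gamma_fixed, gamma_stype, flip_map, flip_map_mono; right.
by split; [apply: lambda_flip_minus | apply: gamma_flip_plus].
Qed.
End Tilt.

(** * Simple projective modules over a basic algebra *)

Section SimpleProjective.
Variables (k : fieldType) (A : falgType k).
Implicit Types M N X Y P R : rmod A.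

Lemma simple_generated P (x y : P) : is_simple P -> x != 0 -> exists b, x ** b = y.
Proof.
move=> [_ simP] x0.
have [|U UP] := @vspace_of_pred _ _ (fun y : P => exists b, x ** b = y).
  split; first by exists 0; rewrite ract0r.
  by move=> c _ _ [b <-] [b' <-]; exists (c *: b + b'); rewrite ractDr ractZr.
have subU : is_submodule U.
  by move=> z d /UP[b <-]; apply/UP; exists (b * d); rewrite ractM.
case: (simP U subU) => U0; last by apply/UP; rewrite U0 memvf.
have : x \in U by apply/UP; exists 1; rewrite ract1.
by rewrite U0 memv0 (negPf x0).
Qed.

Lemma simple_nonzero P : is_simple P -> exists x : P, x != 0.
Proof.
move=> [/is_zeroP/existsNP[x /eqP x0] _]; by exists x.
Qed.

Lemma simple_hom_surj X P (f : 'Hom(X, P)) x : is_simple P -> is_hom f -> f x != 0 ->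
  forall y, exists z, f z = y.
Proof.
by move=> simP homf fx y; have [b <-] := simple_generated y simP fx; exists (x ** b).
Qed.

Lemma simple_hom_inj X P (f : 'Hom(P, X)) x : is_simple P -> is_hom f -> f x != 0 ->
  forall y, f y = 0 -> y = 0.
Proof.
move=> simP homf fx y fy; apply/eqP; apply: contraNT fx => y0.
by have [b <-] := simple_generated x simP y0; rewrite homf fy ract0l.
Qed.

Lemma mod_iso_bij X Y (f : 'Hom(X, Y)) : is_hom f -> (forall x, f x = 0 -> x = 0) ->
  (forall y, exists x, f x = y) -> mod_iso X Y.
Proof. by move=> homf injf surf; exists f; split=> //; [apply/lker_trivialP | apply/limg_fullP]. Qed.

(** The nonzero map f is onto because P is simple, and it splits because P is
    projective. *)
Lemma indecomposable_hom_inj X P (f : 'Hom(X, P)) x : is_simple P -> is_projective P ->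
  is_indecomposable X -> is_hom f -> f x != 0 -> forall y, f y = 0 -> y = 0.
Proof.
move=> simP projP [_ indX] homf fx.
have surf := simple_hom_surj simP homf fx.
have [s [homs /lfunP fs]] := projP _ _ f \1%VF homf (proj2 (limg_fullP f) surf) (@hom_id _ _ P).
have fsE y : f (s y) = y by rewrite -comp_lfunE -fs id_lfunE.
have [K [i [homi inji imi]]] := submodule_exists (sub_ker homf).
have fi z : f (i z) = 0 by apply/imi; exists z.
have [j [homj jE]] := sum_copair homs homi.
have isoX : mod_iso X (sum_mod P K).
  have [|g [h [homg homh gK hK]]] := @mod_isoP _ _ (sum_mod P K) X; last first.
    exact: mod_iso_of homh hK gK.
  apply: mod_iso_bij homj _ _ => [[p z]|y].
    rewrite jE /= => pz; have p0 : p = 0.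
      by rewrite -(fsE p) -[s p](addrK (i z)) pz sub0r lfN fi oppr0.
    by move: pz; rewrite p0 lf0 add0r => /inji->.
  have /imi[z yz] : f (y - s (f y)) = 0 by rewrite lfB fsE subrr.
  by exists (f y, z); rewrite jE /= -yz addrC subrK.
move=> y fy; case: (indX P K isoX) => /is_zeroP z0.
  by case/eqP: fx; apply: z0.
by have /imi[z ->] := fy; rewrite (z0 z) lf0.
Qed.

Lemma hom_big_zero n (F : 'I_n -> rmod A) P :
    (forall i (w : 'Hom(F i, P)), is_hom w -> forall x, w x = 0) ->
  forall f : 'Hom(\big[@sum_mod k A/zero_mod]_(i < n) F i, P), is_hom f -> forall x, f x = 0.
Proof.
elim: n F => [|n IHn] F F0.
  by rewrite big_ord0 => f homf x; rewrite (_ : x = 0) ?lf0 // [LHS]thinmx0 [RHS]thinmx0.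
rewrite big_ord_recl; set M := (X in sum_mod _ X) => f homf [x y].
have [i [homi iE]] := sum_inj1 (F ord0) M; have [j [homj jE]] := sum_inj2 (F ord0) M.
have -> : (x, y) = i x + j y :> sum_mod (F ord0) M.
  by rewrite iE jE; apply: injective_projections; rewrite /= ?addr0 ?add0r.
rewrite lfD -comp_lfunE (F0 ord0) ?add0r; last exact: hom_comp.
rewrite -comp_lfunE; apply: (IHn (fun i => F (lift ord0 i))); last exact: hom_comp.
by move=> i' w homw; apply: F0.
Qed.

(** If a summand maps nontrivially to P then it is isomorphic to P, so there
    is at most one such summand and P has division endomorphism ring. *)
Lemma hom_big_multiple n (F : 'I_n -> rmod A) P :
    is_simple P -> is_projective P -> (forall i, is_indecomposable (F i)) ->
    (forall i j, mod_iso (F i) (F j) -> i = j) ->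
  forall f g : 'Hom(\big[@sum_mod k A/zero_mod]_(i < n) F i, P), is_hom f -> is_hom g ->
    (exists x, f x != 0) -> exists d : 'Hom(P, P), forall x, g x = d (f x).
Proof.
move=> simP projP; elim: n F => [|n IHn] F indF isoF.
  rewrite big_ord0 => f g _ _ [x /eqP[]].
  by rewrite (_ : x = 0) ?lf0 // [LHS]thinmx0 [RHS]thinmx0.
rewrite big_ord_recl; set M := (X in sum_mod _ X) => f g homf homg fn0.
have [i [homi iE]] := sum_inj1 (F ord0) M; have [j [homj jE]] := sum_inj2 (F ord0) M.
have zE z : z = i z.1 + j z.2 :> sum_mod (F ord0) M.
  by rewrite iE jE; case: z => x y; apply: injective_projections; rewrite /= ?addr0 ?add0r.
have homfi : is_hom (f \o i)%VF by apply: hom_comp.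
have homfj : is_hom (f \o j)%VF by apply: hom_comp.
have homgi : is_hom (g \o i)%VF by apply: hom_comp.
have homgj : is_hom (g \o j)%VF by apply: hom_comp.
have [noF0|] := pselect (forall w : 'Hom(F ord0, P), is_hom w -> forall x, w x = 0).
  have fi x : f (i x) = 0 by rewrite -comp_lfunE noF0.
  have gi x : g (i x) = 0 by rewrite -comp_lfunE noF0.
  have [|||||d dE] := IHn (fun i => F (lift ord0 i)) _ _ (f \o j)%VF (g \o j)%VF => //.
  - by move=> i' j' /isoF/lift_inj.
  - have [z] := fn0; rewrite {1}(zE z) lfD fi add0r => fz.
    by exists z.2; rewrite comp_lfunE.
  exists d => z; rewrite (zE z) !lfD fi gi lf0 !add0r; have := dE z.2.
  by rewrite !comp_lfunE.
move=> /existsNP[w /not_implyP[homw /existsNP[x /eqP wx]]].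
have injw := indecomposable_hom_inj simP projP (indF ord0) homw wx.
have surw := simple_hom_surj simP homw wx.
have zeroM h : is_hom h -> forall y : M, (h : 'Hom(M, P)) y = 0.
  apply: hom_big_zero => i' w' homw' y; apply/eqP; apply: contraT => w'y.
  have injw' := indecomposable_hom_inj simP projP (indF (lift ord0 i')) homw' w'y.
  have surw' := simple_hom_surj simP homw' w'y.
  have [|v [homv vE]] := hom_lift homw homw' injw.
    by move=> y'; have [x' <-] := surw (w' y'); exists x'.
  have iso : mod_iso (F (lift ord0 i')) (F ord0).
    apply: mod_iso_bij homv _ _ => [y' vy'|x']; first by apply: injw'; rewrite -vE vy' lf0.
    have [y' y'E] := surw' (w x'); exists y'; apply/eqP; rewrite -subr_eq0.
    by apply/eqP/injw; rewrite lfB vE y'E subrr.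
  by have := isoF _ _ iso; move/eqP; rewrite eq_sym (negPf (neq_lift _ _)).
have fj y : f (j y) = 0 by rewrite -comp_lfunE zeroM.
have gj y : g (j y) = 0 by rewrite -comp_lfunE zeroM.
have [y fiy] : exists y, (f \o i)%VF y != 0.
  by have [z] := fn0; rewrite {1}(zE z) lfD fj addr0 => fz; exists z.1; rewrite comp_lfunE.
have injf := indecomposable_hom_inj simP projP (indF ord0) homfi fiy.
have surf := simple_hom_surj simP homfi fiy.
have [x' /injf->|d [homd dE]] := hom_factor homfi homgi surf; first by rewrite lf0.
exists d => z; rewrite (zE z) !lfD fj gj lf0 !addr0; have := dE z.1.
by rewrite !comp_lfunE => ->.
Qed.

(** Both projections A -> P and A -> R -> P would be nonzero; the second one
    is then a multiple of the first one, which vanishes on R. *)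
Lemma basic_no_hom P R : is_basic A -> is_simple P -> is_projective P ->
    mod_iso (regular_mod A) (sum_mod P R) ->
  forall f : 'Hom(R, P), is_hom f -> forall x, f x = 0.
Proof.
move=> [n [F [indF isoF isoA]]] simP projP isoPR f homf x.
have [t [t' [homt homt' tK t'K]]] := mod_isoP isoPR.
have [s [s' [homs homs' sK s'K]]] := mod_isoP isoA.
have [p1 [homp1 p1E]] := sum_proj1 P R; have [p2 [homp2 p2E]] := sum_proj2 P R.
have homp : is_hom (p1 \o t \o s')%VF by apply/hom_comp/homs'/hom_comp.
have homq : is_hom (f \o p2 \o t \o s')%VF.
  by apply/hom_comp/homs'/hom_comp/homt/hom_comp.
have [p pn0] := simple_nonzero simP.
have [|d dE] := hom_big_multiple simP projP indF isoF homp homq.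
  by exists (s (t' (p, 0))); rewrite !comp_lfunE sK t'K p1E.
have := dE (s (t' (0, x))); rewrite !comp_lfunE !sK !t'K p1E p2E /= => ->.
exact: lf0.
Qed.

End SimpleProjective.

(** * Left modules and duality *)

Section LeftModules.
Variables (k : fieldType) (A : falgType k).
Implicit Types M N X Y : rmod A^c.
Implicit Types I P : rmod A.

(* Spelled with multiplication in A rather than in its converse, so that it
   is a left action. *)
Definition lact M (b : A) (x : M) : M := @ract k A^c M x b.

Lemma lactM M b b' (x : M) : lact (b * b') x = lact b (lact b' x).
Proof. exact: (@ractM k A^c M x b' b). Qed.
Lemma lact1 M (x : M) : lact 1 x = x.
Proof. exact: (@ract1 k A^c M x). Qed.
Lemma lactDl M b b' (x : M) : lact (b + b') x = lact b x + lact b' x.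
Proof. exact: (@ractDr k A^c M x b b'). Qed.
Lemma lactZl M c b (x : M) : lact (c *: b) x = c *: lact b x.
Proof. exact: (@ractZr k A^c M x c b). Qed.
Lemma lact0r M b : lact b (0 : M) = 0.
Proof. exact: ract0l. Qed.
Lemma lact0l M (x : M) : lact 0 x = 0.
Proof. exact: (@ract0r k A^c M x). Qed.
Lemma lact_hom M N (f : 'Hom(M, N)) b x : is_hom f -> f (lact b x) = lact b (f x).
Proof. by move=> homf; apply: homf. Qed.

Lemma dual_lact P (xi : dual_mod P) b (x : P) :
  (lact b xi : 'Hom(P, k^o)) x = (xi : 'Hom(P, k^o)) (x ** b).
Proof. by rewrite /lact /= comp_lfunE lfunE. Qed.

(** Reflexivity of P, for families of functionals compatible with the actions. *)
Lemma dual_represent P (Y : rmod A) (F : Y -> 'Hom('Hom(P, k^o), k^o)) :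
    (forall (c : k) y y' xi, F (c *: y + y') xi = c *: F y xi + F y' xi) ->
    (forall y b (xi : dual_mod P), F (y ** b) xi = F y (lact b xi)) ->
  exists r : 'Hom(Y, P), is_hom r /\ forall y (xi : 'Hom(P, k^o)), xi (r y) = F y xi.
Proof.
move=> linF actF.
have [||||r [homr rE]] := @hom_of_rel _ _ Y P (fun y x => forall xi : 'Hom(P, k^o), F y xi = xi x).
- by move=> c y x y' x' yx y'x' xi; rewrite linF yx y'x' lfL.
- by move=> y x b yx xi; rewrite actF yx -dual_lact.
- by move=> y; apply: dual_reflexive.
- move=> x x0; apply/eqP; apply: contraT => /dual_separates[xi].
  rewrite -x0; have := linF (-1) 0 0 xi; rewrite scaler0 addr0.
  by rewrite scaleN1r addNr => ->; rewrite eqxx.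
exists r; split=> // y xi; have [x xE] := dual_reflexive (F y).
by rewrite -(rE y x xE) xE.
Qed.

Definition ldual X : rmod A.
Proof.
apply: (@RMod k A 'Hom(X, k^o) (fun z b => (z \o linfun (@ractl k A^c X b))%VF)).
- by move=> a c f g; rewrite comp_lfunDl comp_lfunZl.
- move=> f c a b; apply/lfunP => x.
  rewrite !(add_lfunE, scale_lfunE, comp_lfunE, lfunE) /=.
  by rewrite -lfL; congr (f _); rewrite -[LHS]/(lact _ x) lactDl lactZl.
- by move=> f; apply/lfunP => x; rewrite comp_lfunE lfunE -[X in f X]/(lact 1 x) lact1.
- move=> f a b; apply/lfunP => x.
  rewrite !(comp_lfunE, lfunE) /=; congr (f _).
  by rewrite -[LHS]/(lact (a * b) x) lactM.
Defined.

Lemma ldual_act X (z : ldual X) b (x : X) :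
  (z ** b : 'Hom(X, k^o)) x = (z : 'Hom(X, k^o)) (lact b x).
Proof. by rewrite /= comp_lfunE lfunE. Qed.

(** Transpose the lifting problem with the duality, extend to the injective
    module, and transpose back. *)
Lemma dual_injective_projective I : is_injective I -> is_projective (dual_mod I).
Proof.
move=> injI X Y g F homg /limg_fullP surg homF.
have [||gt [homgt gtE]] := @hom_of_fun _ _ (ldual Y) (ldual X) (fun z => (z \o g)%VF).
- by move=> c z z'; rewrite comp_lfunDl comp_lfunZl.
- move=> z b; apply/lfunP => x; rewrite comp_lfunE.
  by rewrite [LHS]ldual_act [RHS]ldual_act comp_lfunE lact_hom.
have [||Ft [homFt FtE]] := @dual_represent I (ldual Y) (fun z => (z \o F)%VF).
- by move=> c z z' xi; rewrite !comp_lfunE add_lfunE scale_lfunE.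
- by move=> z b xi; rewrite [LHS]comp_lfunE [RHS]comp_lfunE [LHS]ldual_act -(lact_hom b xi homF).
have [|H [homH /lfunP HE]] := injI _ _ gt Ft homgt _ homFt.
  apply/lker_trivialP => z; rewrite gtE => zg0; apply/lfunP => y; have [x <-] := surg y.
  by rewrite -comp_lfunE zg0 !zero_lfunE.
have [||||h [homh hE]] := @hom_of_rel _ _ (dual_mod I) X
    (fun th x => forall z : ldual X, (z : 'Hom(X, k^o)) x = (th : 'Hom(I, k^o)) (H z)).
- by move=> c th x th' x' thx th'x' z; rewrite lfL add_lfunE scale_lfunE thx th'x'.
- move=> th x b thx z; have := dual_lact th b (H z); rewrite /lact => ->.
  by rewrite -homH -thx ldual_act.
- by move=> th; have [x xE] := dual_reflexive ((th : 'Hom(I, k^o)) \o H)%VF;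
    exists x => z; rewrite -xE comp_lfunE.
- move=> x x0; apply/eqP; apply: contraT => /dual_separates[z].
  by rewrite x0 zero_lfunE eqxx.
exists h; split=> //; apply/lfunP => th; rewrite comp_lfunE.
apply/eqP; rewrite -subr_eq0; apply: contraT => /dual_separates[z].
have hth (z' : ldual X) : (z' : 'Hom(X, k^o)) (h th) = (th : 'Hom(I, k^o)) (H z').
  have [x xE] := dual_reflexive ((th : 'Hom(I, k^o)) \o H)%VF.
  by rewrite -(hE th x) => [|z'']; rewrite -xE comp_lfunE.
rewrite lfB; have <- : (gt z : 'Hom(X, k^o)) (h th) = z (g (h th)).
  by rewrite gtE comp_lfunE.
rewrite hth; have := HE z; rewrite comp_lfunE => <-; rewrite FtE comp_lfunE subrr.
by rewrite eqxx.
Qed.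

(** Composing the functionals on Y with g gives homomorphisms Y -> S. Those
    from a functional that extends xi h to Y restrict on X to d h, for a
    nonzero endomorphism d of S that does not depend on X and Y; and d is
    invertible. *)
Lemma simple_injective (S : rmod A) (g : 'Hom(dual_mod S, regular_mod A^c))
    (xi : 'Hom(S, k^o)) (u : S) :
    is_simple S -> is_hom g -> xi (u ** (g xi : A)) != 0 -> is_injective S.
Proof.
move=> simS homg xig.
have gact b (z : dual_mod S) : g (lact b z) = b * (g z : A) :> A by rewrite lact_hom.
have rep (Y : rmod A) (eta : 'Hom(Y, k^o)) : exists r : 'Hom(Y, S),
    is_hom r /\ forall y (z : 'Hom(S, k^o)), z (r y) = eta (y ** (g z : A)).
  have /choice[F FE] : forall y : Y, exists F : 'Hom('Hom(S, k^o), k^o),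
      F =1 fun z => eta (y ** (g z : A)).
    move=> y; apply: lfun_of_linear => c z z'.
    by rewrite (lfL g) ractDr ractZr lfL.
  have [||r [homr rE]] := @dual_represent S Y F.
  - by move=> c y y' z; rewrite !FE ractDl ractZl lfL.
  - by move=> y b z; rewrite !FE gact ractM.
  by exists r; split=> // y z; rewrite rE FE.
have [d [homd dE]] := rep S xi.
have du : d u != 0 by apply: contra xig => /eqP du; rewrite -dE du lf0.
have [x|d' [homd' d'E]] := hom_lift homd (@hom_id _ _ S) (simple_hom_inj simS homd du).
  by have [y <-] := simple_hom_surj simS homd du x; exists y; rewrite id_lfunE.
have d'K x : d' (d x) = x.
  apply/eqP; rewrite -subr_eq0; apply/eqP/(simple_hom_inj simS homd du).
  by rewrite lfB d'E id_lfunE subrr.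
move=> X Y i h homi /eqP keri homh.
have [r [homr rE]] := rep Y (xi \o h \o i^-1)%VF.
exists (d' \o r)%VF; split; first exact: hom_comp.
apply/lfunP => x; rewrite !comp_lfunE -[LHS]d'K; congr (d' _).
apply/eqP; rewrite -subr_eq0; apply: contraT => /dual_separates[z].
by rewrite lfB dE rE -homi !comp_lfunE lker0_lfunK // homh subrr eqxx.
Qed.

Lemma lproj_split X Y (g : 'Hom(X, Y)) : is_projective Y -> is_hom g ->
  (forall y, exists x, g x = y) -> exists s : 'Hom(Y, X), is_hom s /\ forall y, g (s y) = y.
Proof.
move=> projY homg /limg_fullP surg.
have [s [homs /lfunP sE]] := projY _ _ g \1%VF homg surg (@hom_id _ _ Y).
by exists s; split=> // y; have := sE y; rewrite comp_lfunE id_lfunE.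
Qed.

(** The dual of the injective resolution of S is a projective resolution of DS
    of length 1. Comparison with the minimal presentation shows that the
    kernel of p0 is a retract of a projective module, so that p1 splits onto
    it, and the kernel of p1 is superfluous. *)
Lemma min_presentation_inj (S : rmod A) (P1 P0 : rmod A^c)
    (p1 : 'Hom(P1, P0)) (p0 : 'Hom(P0, dual_mod S)) :
  inj_dim_le 1 S -> @min_proj_presentation k A^c (dual_mod S) P1 P0 p1 p0 ->
  forall x, p1 x = 0 -> x = 0.
Proof.
move=> [I [C [f [g [injI /short_exactP[homf homg injf exI surg] injC]]]]].
move=> [[projP1 projP0] [homp1 homp0] [imp1 /limg_fullP surp0] sup0 sup1].
have imp1P y : p0 y = 0 <-> exists x, y = p1 x.
  exact: (proj1 (limg_lkerP p1 p0) imp1 y).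
have [||ft [homft ftE]] := @hom_of_fun _ _ (dual_mod I) (dual_mod S) (fun z => (z \o f)%VF).
- by move=> c z z'; rewrite comp_lfunDl comp_lfunZl.
- move=> z b; apply/lfunP => x.
  by rewrite comp_lfunE [LHS]dual_lact [RHS]dual_lact comp_lfunE homf.
have [||gt [homgt gtE]] := @hom_of_fun _ _ (dual_mod C) (dual_mod I) (fun z => (z \o g)%VF).
- by move=> c z z'; rewrite comp_lfunDl comp_lfunZl.
- move=> z b; apply/lfunP => x.
  by rewrite comp_lfunE [LHS]dual_lact [RHS]dual_lact comp_lfunE homg.
have surft z : exists th, ft th = z.
  exists ((z : 'Hom(S, k^o)) \o f^-1)%VF; rewrite ftE; apply/lfunP => x.
  by rewrite !comp_lfunE lker0_lfunK //; apply/eqP/lker_trivialP.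
have ftgt z : ft (gt z) = 0.
  rewrite ftE gtE; apply/lfunP => x; rewrite !comp_lfunE zero_lfunE.
  by rewrite (_ : g (f x) = 0) ?lf0 //; apply/exI; exists x.
have kerft th : ft th = 0 -> exists z, th = gt z.
  rewrite ftE => thf.
  have [z zE] : exists z : 'Hom(C, k^o), forall y, z (g y) = (th : 'Hom(I, k^o)) y.
    have [|||z zE] := @lfun_of_rel _ C k^o (fun q t => exists2 y, q = g y & t = (th : 'Hom(I, k^o)) y).
    - by move=> c _ _ _ _ [y -> ->] [y' -> ->]; exists (c *: y + y'); rewrite lfL.
    - by move=> q; have [y <-] := surg q; exists ((th : 'Hom(I, k^o)) y), y.
    - by move=> _ [y /esym/exI[x ->] ->]; rewrite -comp_lfunE thf zero_lfunE.
    by exists z => y; apply/esym/zE; exists y.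
  by exists z; rewrite gtE; apply/lfunP => y; rewrite comp_lfunE zE.
have [al [homal /lfunP alE]] := projP0 _ _ ft p0 homft (proj2 (limg_fullP ft) surft) homp0.
have [be [hombe /lfunP beE]] := dual_injective_projective injI homp0
   (proj2 (limg_fullP p0) surp0) homft.
have ftal x : ft (al x) = p0 x by have := alE x; rewrite comp_lfunE.
have p0be x : p0 (be x) = ft x by have := beE x; rewrite comp_lfunE.
pose ep := (be \o al)%VF; have homep : is_hom ep by apply: hom_comp.
have imep : limg ep = fullv.
  apply: sup0 => [_ b /memv_imgP[x _ ->]|].
    by rewrite -homep; apply/memv_img/memvf.
  apply/eqP; rewrite eqEsubv subvf; apply/subvP => x _.
  rewrite -(subrK (ep x) x); apply: memv_add; last exact/memv_img/memvf.
  by rewrite memv_ker lfB comp_lfunE p0be ftal subrr.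
have kerep : lker ep = 0%VS.
  apply/eqP; rewrite -dimv_eq0; have := limg_ker_dim ep fullv.
  by rewrite imep capfv => /eqP; rewrite -[X in _ == X]add0n eqn_add2r.
have [ga [homga gaE]] := hom_lift homep (@hom_id _ _ P0) (proj1 (lker_trivialP ep) kerep)
  (fun y => let: ex_intro x xE := proj1 (limg_fullP ep) imep y in
            ex_intro _ x (etrans (id_lfunE y) (esym xE))).
have gaK x : ga (ep x) = x.
  apply/eqP; rewrite -subr_eq0; apply/eqP/(proj1 (lker_trivialP ep) kerep).
  by rewrite lfB gaE id_lfunE subrr.
have p0ga x : p0 (ga x) = p0 x.
  have <- : p0 (ep (ga x)) = p0 (ga x) by rewrite comp_lfunE p0be ftal.
  by rewrite gaE id_lfunE.
have [Om [i [homi inji imi]]] := submodule_exists (sub_ker homp0).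
have [x|p1' [homp1' p1'E]] := hom_lift homi homp1 inji.
  by apply/imi/imp1P; exists x.
have surp1' y : exists x, p1' x = y.
  have [x xE] : exists x, i y = p1 x by apply/imp1P/imi; exists y.
  by exists x; apply/eqP; rewrite -subr_eq0; apply/eqP/inji; rewrite lfB p1'E xE subrr.
have homcomp : is_hom (ga \o be \o gt)%VF by apply/hom_comp/homgt/hom_comp.
have [z|rho [homrho rhoE]] := hom_lift homi homcomp inji.
  by apply/imi; rewrite !comp_lfunE p0ga p0be ftgt.
have injgt z : gt z = 0 -> z = 0.
  rewrite gtE => zg0; apply/lfunP => y; have [x <-] := surg y.
  by rewrite -comp_lfunE zg0 !zero_lfunE.
have [y|si [homsi siE]] := hom_lift homgt (hom_comp homal homi) injgt.
  by apply: kerft; rewrite comp_lfunE ftal; apply/imi; exists y.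
have [rho' [homrho' /lfunP rho'E]] := dual_injective_projective injC homp1'
  (proj2 (limg_fullP p1') surp1') homrho.
have split y : p1' (rho' (si y)) = y.
  have := rho'E (si y); rewrite comp_lfunE => <-.
  apply/eqP; rewrite -subr_eq0; apply/eqP/inji.
  by rewrite lfB rhoE !comp_lfunE siE comp_lfunE -[be _]comp_lfunE gaK subrr.
pose s := (rho' \o si)%VF; have homs : is_hom s by apply: hom_comp.
have ims : limg s = fullv.
  apply: sup1 => [_ b /memv_imgP[x _ ->]|].
    by rewrite -homs; apply/memv_img/memvf.
  apply/eqP; rewrite eqEsubv subvf; apply/subvP => x _.
  rewrite -(subrK (s (p1' x)) x); apply: memv_add; last exact/memv_img/memvf.
  by rewrite memv_ker -p1'E lfB comp_lfunE split subrr lf0.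
move=> x p1x; have /memv_imgP[y _ xE] : x \in limg s by rewrite ims memvf.
have : p1' x = 0 by apply: inji; rewrite p1'E.
by rewrite xE comp_lfunE split => ->; rewrite !lf0.
Qed.

End LeftModules.

(** * The almost split sequence starting at the simple projective module *)

Section Star.
Variables (k : fieldType) (A : falgType k).
Implicit Types M : rmod A^c.

Definition star_val M (f : star_mod M) (x : M) : A := vsval (f : subvs_of (star_space M)) x.

Lemma star_val_act M (f : star_mod M) b x : star_val (f ** b) x = star_val f x * b.
Proof. exact: star_actE. Qed.
Lemma star_val_lact M (f : star_mod M) b x : star_val f (lact b x) = b * star_val f x.
Proof.
have /(@homsP k A^c M (regular_mod A^c)) homf := subvsP (f : subvs_of (star_space M)).
exact: homf.
Qed.
Lemma star_val_eq M (f g : star_mod M) : (forall x, star_val f x = star_val g x) -> f = g.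
Proof. by move=> fg; apply: val_inj; apply/lfunP => x; apply: fg. Qed.
Lemma star_valL M (c : k) (f g : star_mod M) x :
  star_val (c *: f + g) x = c *: star_val f x + star_val g x.
Proof. by rewrite /star_val linearP /= add_lfunE scale_lfunE. Qed.
Lemma star_valB M (f : star_mod M) x y : star_val f (x - y) = star_val f x - star_val f y.
Proof. exact: lfB. Qed.
Lemma star_val0 M (f : star_mod M) : star_val f 0 = 0.
Proof. exact: lf0. Qed.
Lemma star_val_sumr M (f : star_mod M) n (x : 'I_n -> M) :
  star_val f (\sum_i x i) = \sum_i star_val f (x i).
Proof. exact: lf_sum. Qed.
Lemma star_val_suml M n (f : 'I_n -> star_mod M) x :
  star_val (\sum_i f i) x = \sum_i star_val (f i) x.
Proof. by rewrite /star_val linear_sum sum_lfunE. Qed.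
Lemma star_val0l M x : star_val (0 : star_mod M) x = 0.
Proof. by rewrite /star_val linear0 zero_lfunE. Qed.

Lemma star_exists M (f : 'Hom(M, regular_mod A^c)) : is_hom f ->
  exists g : star_mod M, forall x, star_val g x = f x.
Proof. by move=> /homsP fh; exists (Subvs fh). Qed.

Lemma star_eval M (z : M) : exists v : 'Hom(star_mod M, regular_mod A),
  is_hom v /\ forall f, v f = star_val f z.
Proof.
apply: (@hom_of_fun _ _ (star_mod M) (regular_mod A)) => [c f g|f b].
  exact: star_valL.
exact: star_val_act.
Qed.

(** The dual basis of a projective module makes its dual projective and
    reflexive. *)
Lemma dual_basis M : is_projective M -> exists n (f : 'I_n -> star_mod M) (z : 'I_n -> M),
  forall x, x = \sum_i lact (star_val (f i) x) (z i).
Proof.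
move=> projM; pose n := \dim {:M}; pose z (i : 'I_n) : M := (vbasis {:M})`_i.
have /choice[h hE] : forall i, exists h : 'Hom(regular_mod A^c, M),
    is_hom h /\ forall b : A, h b = lact b (z i).
  by move=> i; have [h [homh hE]] := hom_from_regular (z i); exists h.
have [|H [homH HE]] := pow_copair (h := h); first by move=> i; case: (hE i).
have [y|s [homs sE]] := lproj_split projM homH.
  exists [ffun i => (coord (vbasis {:M}) i y)%:A : A^c]; rewrite HE.
  rewrite [RHS](coord_vbasis (memvf y)); apply: eq_bigr => i _.
  by rewrite ffunE; have [_ ->] := hE i; rewrite lactZl lact1.
have /choice[f fE] : forall i, exists f : star_mod M,
    forall x, star_val f x = (s x : {ffun 'I_n -> A^c}) i.
  move=> i; have [p [homp pE]] := @pow_proj _ _ n (regular_mod A^c) i.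
  have [g gE] := star_exists (hom_comp homp homs).
  by exists g => x; rewrite gE comp_lfunE pE.
exists n, f, z => x; rewrite -[LHS]sE HE; apply: eq_bigr => i _.
by rewrite fE; have [_ ->] := hE i.
Qed.

Section DualBasis.
Variables (M : rmod A^c) (n : nat) (f : 'I_n -> star_mod M) (z : 'I_n -> M).
Hypothesis basis : forall x, x = \sum_i lact (star_val (f i) x) (z i).

Lemma star_basis (g : star_mod M) : g = \sum_i f i ** star_val g (z i).
Proof.
apply: star_val_eq => x; rewrite {1}(basis x) star_val_sumr star_val_suml.
by apply: eq_bigr => i _; rewrite star_val_lact star_val_act.
Qed.

Lemma star_separates (x : M) : (forall g : star_mod M, star_val g x = 0) -> x = 0.
Proof. by move=> x0; rewrite (basis x) big1 // => i _; rewrite x0 lact0l. Qed.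

Lemma star_projective : is_projective (star_mod M).
Proof.
move=> X Y g h homg /limg_fullP surg homh.
have /choice[m mE] : forall i, exists m, g m = h (f i) by move=> i; apply: surg.
have [||l [homl lE]] := @hom_of_fun _ _ (star_mod M) X
    (fun q => \sum_i m i ** star_val q (z i)).
- move=> c q q'; rewrite scaler_sumr -big_split; apply: eq_bigr => i _.
  by rewrite star_valL ractDr ractZr.
- by move=> q b; rewrite ract_suml; apply: eq_bigr => i _; rewrite star_val_act ractM.
exists l; split=> //; apply/lfunP => q; rewrite comp_lfunE lE {1}(star_basis q) !lf_sum.
by apply: eq_bigr => i _; rewrite homg homh mE.
Qed.

Lemma star_reflexive (h : 'Hom(star_mod M, regular_mod A)) : is_hom h ->
  exists x, forall q, h q = star_val q x.
Proof.
move=> homh; exists (\sum_i lact (h (f i) : A) (z i)) => q.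
rewrite {1}(star_basis q) lf_sum star_val_sumr; apply: eq_bigr => i _.
by rewrite homh star_val_lact.
Qed.

End DualBasis.
End Star.

Section AlmostSplit.
Variables (k : fieldType) (A : falgType k).
Implicit Types P R T : rmod A.

(** The almost split sequence is obtained by applying the duality Hom_A(-, A)
    to the minimal presentation P1 -> P0 -> DP -> 0. It is exact on the left
    because P is not injective, and all the maps E -> A, where E is the dual
    of P1, are evaluations at elements of P1. *)
Lemma apr_data_exists T : is_basic A -> is_APR_tilting T ->
  exists (E : rmod A) (e a : A) (x0 : E) (r0 : T) (pi : 'Hom(E, T))
    (c : 'Hom(T, regular_mod A)), apr_data e a x0 r0 pi c.
Proof.
move=> basicA [P [R [P' [[simP projP] [idim noninj] isoA tauP isoT]]]].
have homRP := basic_no_hom basicA simP projP isoA.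
have [t [t' [homt homt' tK t'K]]] := mod_isoP isoA.
have [s [s' [homs homs' sK s'K]]] := mod_isoP isoT.
have [i1 [homi1 i1E]] := sum_inj1 P R; have [i2 [homi2 i2E]] := sum_inj2 P R.
have [q1 [homq1 q1E]] := sum_proj1 P R; have [q2 [homq2 q2E]] := sum_proj2 P R.
(* e and a are the components of 1 under A = P + R; u = e and w = a, seen in
   P and R, generate these modules *)
pose u : P := q1 (t (1 : A)); pose w : R := q2 (t (1 : A)).
pose j1 : 'Hom(P, regular_mod A) := (t' \o i1)%VF.
pose j2 : 'Hom(R, regular_mod A) := (t' \o i2)%VF.
have homj1 : is_hom j1 by apply: hom_comp.
have homj2 : is_hom j2 by apply: hom_comp.
have j1E x : t (j1 x) = (x, 0) by rewrite comp_lfunE t'K i1E.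
have j2E x : t (j2 x) = (0, x) by rewrite comp_lfunE t'K i2E.
have tE (b : A) : t b = (u ** b, w ** b).
  have -> : t b = t (1 : A) ** b by rewrite -homt; congr (t _); apply/esym/mul1r.
  by rewrite /u /w q1E q2E.
have tinj (b b' : A) : t b = t b' -> b = b' by move/(congr1 t'); rewrite !tK.
pose e : A := j1 u; pose a : A := j2 w.
have te : t e = (u, 0) by rewrite j1E.
have ta : t a = (0, w) by rewrite j2E.
have ue : u ** e = u by have := te; rewrite tE => -[].
have we : w ** e = 0 by have := te; rewrite tE => -[].
have ua : u ** a = 0 by have := ta; rewrite tE => -[].
have wa : w ** a = w by have := ta; rewrite tE => -[].
have tel l : t (e * l : A) = (u ** l, 0) by rewrite tE !ractM ue we ract0l.
have tal l : t (a * l : A) = (0, w ** l) by rewrite tE !ractM ua wa ract0l.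
have ea : e + a = 1.
  apply: tinj; rewrite lfD te ta tE !ract1.
  by apply: injective_projections; rewrite /= ?addr0 ?add0r.
have ee : e * e = e by apply: tinj; rewrite tel te ue.
have eAa l : e * l * a = 0.
  apply: tinj; rewrite -mulrA tel lf0 ractM.
  have [h [homh hE]] := hom_from_regular (u ** l).
  have -> : u ** l ** a = (h \o j2)%VF w by rewrite comp_lfunE hE.
  by rewrite homRP //; apply: hom_comp.
have u0 : u != 0.
  have [x x0] := simple_nonzero simP; apply: contra x0 => /eqP u0.
  have := j1E x; rewrite tE u0 ract0l => -[<-].
  by rewrite eqxx.
have e0 : e != 0 by apply: contra u0 => /eqP e0; have := te; rewrite e0 lf0 => -[<-].
have genP (x : P) : exists b, x = u ** b by have [b <-] := simple_generated x simP u0; exists b.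
have simple_e l : e * l != 0 -> exists m, e * l * m = e.
  move=> el0; have [|m mE] := @simple_generated _ _ P (u ** l) u simP.
    by apply: contra el0 => /eqP ul; apply/eqP/tinj; rewrite tel ul lf0.
  by exists m; apply: tinj; rewrite -mulrA tel ractM mE te.
have simple_e_left l : e * l * e = l -> l != 0 -> exists m, m * l = e.
  move=> le l0; have [|m mE] := simple_e l.
    by apply: contra l0 => /eqP el; rewrite -le el mul0r.
  have el : e * l = l by rewrite -le !mulrA ee.
  have lee : l * e = l by rewrite -le -!mulrA ee.
  (* b is a right inverse of l in eAe, and it has a right inverse itself *)
  pose b := e * m * e; have eb : e * b = b by rewrite /b !mulrA ee.
  have lb : l * b = e by rewrite /b !mulrA lee -{1}el mE ee.
  have [|m' m'E] := simple_e b.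
    by rewrite eb; apply: contra e0 => /eqP b0; rewrite -lb b0 mulr0.
  rewrite eb in m'E; exists b.
  have -> : l = e * m' by rewrite -[LHS]lee -[X in l * X]m'E mulrA lb.
  by rewrite mulrA (_ : b * e = b) // /b -!mulrA ee.
(* P0 is generated by an element w0 = e w0, and f |-> f(w0) identifies P0^*
   with eA = P; the first map of the sequence is then p1^*, with e |-> x0 *)
have [P1 [P0 [p1 [p0 [q [pres homq kerq /limg_fullP surq]]]]]] := tauP.
have injp1 := min_presentation_inj idim pres.
have [[projP1 projP0] [homp1 homp0] [imp1 /limg_fullP surp0] sup0 _] := pres.
have kerp0 y : p0 y = 0 <-> exists x, y = p1 x := proj1 (limg_lkerP p1 p0) imp1 y.
have [xi xiu] := dual_separates u0.
pose xi0 : dual_mod P := lact e (xi : dual_mod P).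
have xi0E x : (xi0 : 'Hom(P, k^o)) x = xi (x ** e) by apply: dual_lact.
have xi0e : lact e xi0 = xi0 by rewrite /xi0 -lactM ee.
have xi0u : (xi0 : 'Hom(P, k^o)) u != 0 by rewrite xi0E ue.
have genDP (z : dual_mod P) : exists b, z = lact b xi0.
  have [|U UP] := @vspace_of_pred _ 'Hom(P, k^o) (fun z => exists b, z = lact b xi0).
    split; first by exists 0; rewrite lact0l.
    by move=> d _ _ [b ->] [b' ->]; exists (d *: b + b'); rewrite lactDl lactZl.
  apply/UP; rewrite (dual_span (U := U)) ?memvf // => x xU.
  apply/eqP; apply: contraNT xi0u => x0; have [b <-] := simple_generated u simP x0.
  by rewrite -dual_lact; apply/eqP/xU/UP; exists b.
have [y0 y0E] := surp0 xi0; pose w0 := lact e y0.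
have w0e : lact e w0 = w0 by rewrite /w0 -lactM ee.
have pw0 : p0 w0 = xi0 by rewrite /w0 lact_hom // y0E.
have genP0 (x : P0) : exists b, x = lact b w0.
  have [|U UP] := @vspace_of_pred _ P0 (fun z => exists b, z = lact b w0).
    split; first by exists 0; rewrite lact0l.
    by move=> d _ _ [b ->] [b' ->]; exists (d *: b + b'); rewrite lactDl lactZl.
  apply/UP; rewrite (sup0 U) ?memvf //.
    by move=> z b /UP[b' ->]; apply/UP; exists ((b : A) * b'); rewrite lactM.
  apply/eqP; rewrite eqEsubv subvf; apply/subvP => z _.
  have [b zb] := genDP (p0 z); rewrite -(subrK (lact b w0) z).
  apply: memv_add; last by apply/UP; exists b.
  by rewrite memv_ker lfB lact_hom // pw0 zb subrr.
have [fe fe0] : exists fe : star_mod P0, star_val fe w0 = e.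
  have [h [homh hE]] := @hom_from_regular k A^c P0 w0.
  have [y|v [homv vE]] := lproj_split projP0 homh.
    by have [b ->] := genP0 y; exists b; rewrite hE.
  have [g gE] := star_exists homv.
  have gw0 : e * star_val g w0 = star_val g w0 by rewrite -star_val_lact w0e.
  have [|m mE] := simple_e (star_val g w0).
    apply: contra xi0u => /eqP; rewrite gw0 gE => vw0.
    have := vE w0; rewrite (vw0 : v w0 = 0) lf0 => w00.
    by rewrite -pw0 -w00 lf0 zero_lfunE.
  by exists (g ** m); rewrite star_val_act -gw0.
have star0_eq (g g' : star_mod P0) : star_val g w0 = star_val g' w0 -> g = g'.
  move=> gg'; apply: star_val_eq => x; have [b ->] := genP0 x.
  by rewrite [LHS]star_val_lact [RHS]star_val_lact; congr (_ * _).
pose E : rmod A := star_mod P1.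
pose x0 : E := star_map p1 fe.
have x0E z : star_val x0 z = star_val fe (p1 z) by apply: star_mapE.
have kerqE y : q y = 0 <-> exists g, y = star_map p1 g.
  exact: proj1 (limg_lkerP (star_map p1) q) (esym kerq) y.
have kerqx y : q y = 0 <-> exists l, y = x0 ** l.
  split=> [/kerqE[g ->]|[l ->]].
    exists (star_val g w0); apply: star_val_eq => z; rewrite star_val_act x0E [LHS](star_mapE _ _ homp1).
    rewrite -[RHS]star_val_act; congr (star_val _ _); apply: star0_eq.
    by rewrite star_val_act fe0 -star_val_lact w0e.
  by apply/kerqE; exists (fe ** l); apply: star_val_eq => z; rewrite star_val_act x0E
    [RHS](star_mapE _ _ homp1) -[RHS]/(star_val (fe ** l) (p1 z)) star_val_act.
have x0e : x0 ** e = x0.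
  apply: star_val_eq => z; rewrite star_val_act !x0E -star_val_act; congr (star_val _ _).
  by apply: star0_eq; rewrite star_val_act fe0 ee.
(* if f_e vanished on the image of p1 it would induce a nonzero map DP -> A *)
have x0n0 : x0 != 0.
  apply/eqP => x00; have fep1 z : star_val fe (p1 z) = 0 by rewrite -x0E x00 star_val0l.
  have [h [homh hE]] : exists h : 'Hom(P0, regular_mod A^c),
      is_hom h /\ forall x, h x = star_val fe x.
    exists (vsval (fe : subvs_of (star_space P0))); split=> //.
    exact/(@homsP k A^c P0 (regular_mod A^c))/subvsP.
  have [x /kerp0[z ->]|g [homg gE]] := hom_factor homp0 homh surp0.
    by rewrite hE fep1.
  apply: noninj; apply: (@simple_injective _ _ P g xi0 u simP homg).
  have -> : g xi0 = e by rewrite -pw0 gE hE fe0.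
  by rewrite ue.
have [n [f [z basis]]] := dual_basis projP1.
have reflexive (h : 'Hom(E, regular_mod A)) := star_reflexive basis (h := h).
(* the map x |-> a l e x from eA to aA is evaluation at a preimage under p1 of
   a l e w0, which p0 kills since eAa = 0 *)
have extend l : exists v : 'Hom(E, regular_mod A), is_hom v /\ v x0 = a * l * e :> A.
  have [y yE] : exists y, lact (a * l * e) w0 = p1 y.
    apply/kerp0; rewrite lact_hom // pw0; apply/lfunP => x.
    rewrite zero_lfunE dual_lact xi0E; have [b ->] := genP x.
    rewrite -!ractM (_ : b * _ = b * a * (l * e * e)); last by rewrite !mulrA.
    have uba : u ** (b * a) = 0.
      apply: (congr1 fst (_ : (u ** (b * a), 0) = (0, 0) :> P * R)).
      by rewrite -tel mulrA eAa lf0.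
    by rewrite ractM uba ract0l lf0.
  have [v [homv vE]] := star_eval y; exists v; split=> //.
  by rewrite vE x0E -yE star_val_lact fe0 -!mulrA ee.
have vanish (h : 'Hom(E, regular_mod A)) : is_hom h -> h x0 = 0 -> forall y, h y = 0.
  move=> homh; have [y hE] := reflexive h homh; rewrite hE x0E => fy0 g.
  have p1y : p1 y = 0.
    have [b bE] := genP0 (p1 y); move: fy0; rewrite bE star_val_lact fe0 => be0.
    by rewrite -w0e -lactM be0 lact0l.
  by rewrite hE (injp1 y p1y) star_val0.
have separate (g : E) : (forall h : 'Hom(E, regular_mod A), is_hom h -> h g = 0) -> g = 0.
  move=> g0; apply: star_val_eq => y; rewrite star_val0l.
  by have [v [homv <-]] := star_eval y; rewrite g0.
have Pa (x : P) : x ** a = 0.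
  have [b ->] := genP x; rewrite -ractM.
  apply: (congr1 fst (_ : (u ** (b * a), 0) = (0, 0) :> P * R)).
  by rewrite -tel mulrA eAa lf0.
(* otherwise E has a nonzero map to P in A; it is evaluation at some x = e x
   of P1, and minimality of the presentation makes p1 x vanish *)
have genE : a_generated a E.
  have subE : is_sub (@a_gen k A a E).
    by apply: sub_spanned => _ l [m [l' ->]]; exists m, (l' * l); rewrite -ractM mulrA.
  have [Q [p [homp surp kerp]]] := quotient_exists subE.
  move=> y; apply/kerp/eqP; apply: contraT => py0.
  have divI l : e * l = 0 \/ exists l', e * (l * l' - 1) = 0.
    have [el|/simple_e[l' el']] := eqVneq (e * l) 0; first by left.
    by right; exists l'; rewrite mulrBr mulrA el' mulr1 subrr.
  have killI (X : rmod A) : (forall x : X, x ** a = 0) -> killed (fun l => e * l = 0) X.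
    move=> Xa x l el; rewrite -[x]ract1 -ea ractDr Xa addr0 -ractM el; exact: ract0r.
  have Qa (r : Q) : r ** a = 0.
    have [x <-] := surp r; rewrite -homp; apply/kerp/spanned_gen.
    by exists x, 1; rewrite mulr1.
  have [h [homh hy]] := killed_hom divI u (killI Q Qa) (killI P Pa) py0.
  have homv : is_hom (j1 \o h \o p)%VF by apply/hom_comp/homp/hom_comp.
  have [x xE] := reflexive _ homv.
  have ex : lact e x = x.
    apply/eqP; rewrite -subr_eq0; apply/eqP/(star_separates basis) => g.
    rewrite star_valB star_val_lact -xE !comp_lfunE; apply/eqP; rewrite subr_eq0; apply/eqP/tinj.
    have := j1E (h (p g)); rewrite [t _]tE => -[_ wj].
    by rewrite comp_lfunE in wj; rewrite tel [RHS]tE wj.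
  have p1x : p1 x = 0.
    have [b bE] := genP0 (p1 x).
    have p1xE : p1 x = lact (e * b * e) w0 by rewrite !lactM w0e -bE -lact_hom // ex.
    have [l0|l0] := eqVneq (e * b * e) 0; first by rewrite p1xE l0 lact0l.
    have [|m mE] := simple_e_left (e * b * e) _ l0; first by rewrite -!mulrA ee !mulrA ee.
    case/eqP: xi0u; rewrite -pw0 -w0e -mE lactM -p1xE lact_hom //.
    rewrite (_ : p0 (p1 x) = 0) ?lact0r ?zero_lfunE //; apply/kerp0; by exists x.
  case/eqP: e0; have := xE y; rewrite (injp1 x p1x) star_val0 !comp_lfunE hy.
  by rewrite /e comp_lfunE.
(* the copy of aA in T *)
have [i1' [homi1' i1'E]] := sum_inj1 P' R; have [q2' [homq2' q2'E]] := sum_proj2 P' R.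
pose r0 : T := s' (0, w).
pose c : 'Hom(T, regular_mod A) := (j2 \o q2' \o s)%VF.
pose pi : 'Hom(E, T) := (s' \o i1' \o q)%VF.
have homc : is_hom c by apply/hom_comp/homs/hom_comp.
have hompi : is_hom pi by apply/hom_comp/homq/hom_comp.
have cE x : c x = j2 (s x).2 by rewrite !comp_lfunE q2'E.
have piE y : s (pi y) = (q y, 0) by rewrite !comp_lfunE s'K i1'E.
have j2inj r : j2 r = 0 -> r = 0.
  by move=> j0; have := j2E r; rewrite j0 lf0 => -[].
have sinj x y : s x = s y -> x = y by move/(congr1 s'); rewrite !sK.
exists E, e, a, x0, r0, pi, c; split=> //.
- apply: sinj; rewrite homs s'K; congr pair; [exact: ract0l | exact: wa].
- by rewrite cE s'K.
- move=> x; apply: tinj; rewrite tal [RHS]tE cE /=.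
  by have := j2E (s x).2; rewrite [t _]tE => -[-> ->].
- move=> x; rewrite cE; split=> [/j2inj sx|[y ->]]; last by rewrite piE lf0.
  have [y yE] := surq (s x).1; exists y; apply: sinj.
  by rewrite piE yE -sx; case: (s x).
- move=> y; rewrite -kerqx; split=> [piy|qy].
    by have := piE y; rewrite piy lf0 => -[].
  by apply: sinj; rewrite piE qy lf0.
exact: star_projective basis.
Qed.

End AlmostSplit.

Theorem theorem1 (k : fieldType) (Lambda Gamma : falgType k)
    (basic_Lambda : is_basic Lambda) (basic_Gamma : is_basic Gamma) :
  related_by_APR_tilt Lambda Gamma ->
  related_by_flip_flop (fftors_poset Lambda) (fftors_poset Gamma).
Proof.
move=> [T [aprT [phi [phi_inj phi_im phi_1 phi_M]]]].
have [E [e [a [x0 [r0 [pi [c apr]]]]]]] := apr_data_exists basic_Lambda aprT.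
exact: (apr_flip_flop apr phi_inj phi_im phi_1 phi_M).
Qed.
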